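(* Let $\mathbb{G}$ be a stratified Lie group of homogeneous dimension $Q$ and let $\Omega\subset\mathbb{G}$ be a bounded open subset. Let $0<s<1$, $p>1$ and $sp>Q$. Let $\beta\in L^\infty(\Omega)$ with $\operatorname{ess\,inf}_{x\in\Omega}\beta(x)>0$, let $g:\mathbb{R}\to\mathbb{R}$ be continuous, and put $G(\tau)=\int_0^\tau g(\xi)\,d\xi$. Fix $M\in\{0^+,+\infty\}$. Suppose that $g$ is nonnegative with $g(0)=0$ and $$\liminf_{\tau\to M}\frac{G(\tau)}{\tau^p}=0,\qquad\limsup_{\tau\to M}\frac{G(\tau)}{\tau^p}=+\infty.$$ Then, for every $\lambda>0$, the problem $$\begin{cases}(-\Delta_{\mathbb{G},p})^su=\lambda\beta(x)g(u)&\text{in }\Omega,\\ u=0&\text{in }\mathbb{G}\setminus\Omega\end{cases}$$ has a sequence of nonnegative (weak) solutions $\{u_{\lambda,n}\}\subset X_0^{s,p}(\Omega)$. Moreover, $$\lim_{n\to\infty}\|u_{\lambda,n}\|_{X_0^{s,p}(\Omega)}=+\infty\quad\text{if }M=+\infty,$$ $$\lim_{n\to\infty}\|u_{\lambda,n}\|_{X_0^{s,p}(\Omega)}=\lim_{n\to\infty}\|u_{\lambda,n}\|_{L^\infty(\Omega)}=0\quad\text{if }M=0^+.$$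
   Context: A stratified Lie group is $\mathbb{G}=(\mathbb{R}^N,\circ)$ with $\mathbb{R}^N=\mathbb{R}^{N_1}\times\cdots\times\mathbb{R}^{N_k}$ such that for every $\lambda>0$ the dilation $D_\lambda(x^{(1)},\dots,x^{(k)})=(\lambda x^{(1)},\lambda^2x^{(2)},\dots,\lambda^k x^{(k)})$ is a group automorphism, and such that the left-invariant vector fields $X_1,\dots,X_{N_1}$ with $X_j(0)=\partial/\partial x_j|_0$ generate, via iterated commutators, a Lie algebra of rank $N$ at every point. We write $\lambda x$ for $D_\lambda(x)$ and $y^{-1}x$ for $y^{-1}\circ x$. The homogeneous dimension is $Q=N_1+2N_2+\dots+kN_k$. The Haar measure $dx$ is Lebesgue measure on $\mathbb{R}^N$. A homogeneous quasi-norm $|\cdot|:\mathbb{G}\to[0,\infty)$ is fixed: it is continuous, $|x|=0$ iff $x=0$, $|x^{-1}|=|x|$, and $|\lambda x|=\lambda|x|$ for $\lambda>0$. It is taken so that $d(x,y)=|y^{-1}x|$ is a (left-invariant, homogeneous) distance on $\mathbb{G}$. For $\Omega$ bounded, $X_0^{s,p}(\Omega)$ is the completion of $C_0^\infty(\Omega)$ (functions extended by $0$ to $\mathbb{G}$) under the norm $$\|u\|_{X_0^{s,p}(\Omega)}=\left(\int_{\mathbb{G}}\int_{\mathbb{G}}\frac{|u(x)-u(y)|^p}{|y^{-1}x|^{Q+sp}}\,dx\,dy\right)^{1/p},$$ which by a Poincaré inequality is equivalent to the norm obtained by adding $\|u\|_{L^p(\Omega)}$. Its elements are functions in $L^p(\mathbb{G})$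 vanishing in $\mathbb{G}\setminus\Omega$. $(-\Delta_{\mathbb{G},p})^s$ is the fractional $p$-sub-Laplacian, understood weakly: a (weak) solution of the problem is a function $u\in X_0^{s,p}(\Omega)\setminus\{0\}$ such that, for every $\varphi\in X_0^{s,p}(\Omega)$, $$\int_{\mathbb{G}}\int_{\mathbb{G}}\frac{|u(x)-u(y)|^{p-2}(u(x)-u(y))(\varphi(x)-\varphi(y))}{|y^{-1}x|^{Q+sp}}\,dx\,dy=\lambda\int_\Omega\beta(x)g(u)\varphi\,dx.$$ *)

(* Defs.v *)
From HB Require Import structures.
From mathcomp Require Import all_boot all_order all_algebra.
From mathcomp Require Import all_classical all_reals all_analysis ess_sup_inf.

Set Implicit Arguments.
Unset Strict Implicit.
Unset Printing Implicit Defensive.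

Import Order.TTheory GRing.Theory Num.Theory.
Import numFieldNormedType.Exports.

Local Open Scope classical_set_scope.
Local Open Scope ring_scope.

(* As for [n.-tuple T], the sigma-algebra on ['rV[R]_n] is the one generated by
   the coordinates; since the topology of ['rV[R]_n] is the product topology,
   it is the Borel sigma-algebra. *)
Definition measure_rV_display : measure_display.
Proof. exact: (measure_tuple_display default_measure_display). Qed.

Section measurable_rV.
Context {R : realType} (n : nat).

Let coors : 'I_n -> 'rV[R]_n -> measurableTypeR R := fun i x => x 0 i.

Let rV_set0 : g_sigma_preimage coors set0.
Proof. exact: sigma_algebra0. Qed.

Let rV_setC A : g_sigma_preimage coors A -> g_sigma_preimage coors (~` A).
Proof. exact: sigma_algebraC. Qed.

Let rV_bigcup (F : _^nat) : (forall i, g_sigma_preimage coors (F i)) ->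
  g_sigma_preimage coors (\bigcup_i (F i)).
Proof. exact: sigma_algebra_bigcup. Qed.

HB.instance Definition _ := @isMeasurable.Build measure_rV_display
  'rV[R]_n (g_sigma_preimage coors) rV_set0 rV_setC rV_bigcup.

End measurable_rV.

Lemma measurable_rV_coord (R : realType) n (i : 'I_n) :
  measurable_fun [set: 'rV[R]_n] (fun x => x 0 i : measurableTypeR R).
Proof.
move=> _ Y mY; rewrite setTI; apply: sub_sigma_algebra => /=.
rewrite -bigcup_seq/=; exists i => /=; first by rewrite mem_index_enum.
by exists Y => //; rewrite setTI.
Qed.

Lemma measurable_fun_rVP d (T : measurableType d) (R : realType) n
    (f : T -> 'rV[R]_n) :
  (forall i, measurable_fun setT (fun t => f t 0 i : measurableTypeR R)) ->
  measurable_fun setT f.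
Proof.
move=> mf; pose S := g_sigma_preimage
  (fun i t => (fun x : 'rV[R]_n => x 0 i : measurableTypeR R) (f t)).
have S_sub : S `<=` measurable.
  apply: smallest_sub; first exact: sigma_algebra_measurable.
  rewrite -bigcup_seq; apply: bigcup_sub => i _ A [B mB <-].
  exact: mf.
move=> _ A mA; rewrite setTI; apply: S_sub.
have := g_sigma_preimage_comp (fun i (x : 'rV[R]_n) =>
  x 0 i : measurableTypeR R) f.
rewrite /S /comp => ->.
by exists A => //; rewrite setTI.
Qed.

(* Lebesgue measure on R^n, by recursion on n along the identification of
   R * R^n with R^(1 + n) *)
Section lebesgue_rV_recursion.
Context {R : realType} (n : nat) (mu : {sigma_finite_measure set 'rV[R]_n -> \bar R}).

Definition rV_cons (z : measurableTypeR R * 'rV[R]_n) : 'rV[R]_n.+1 :=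
  row_mx (const_mx z.1 : 'rV_1) z.2.

Definition rV_uncons (x : 'rV[R]_n.+1) : measurableTypeR R * 'rV[R]_n :=
  (x 0 0, rsubmx (x : 'rV_(1 + n))).

Lemma rV_consK : cancel rV_cons rV_uncons.
Proof.
move=> [a x]; rewrite /rV_cons /rV_uncons (@row_mxKr _ 1 1 n); congr pair.
rewrite (_ : (0 : 'I_n.+1) = lshift n (0 : 'I_1)); last exact: val_inj.
by rewrite (@row_mxEl _ 1 1 n) mxE.
Qed.

Lemma rV_unconsK : cancel rV_uncons rV_cons.
Proof.
move=> x; apply/rowP => i; rewrite /rV_cons /rV_uncons/=.
rewrite -[i](@splitK 1 n); case: (@fintype.split 1 n i) => j /=.
  rewrite (@row_mxEl _ 1 1 n) mxE; congr (x _ _).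
  by apply: val_inj; rewrite /= ord1.
by rewrite (@row_mxEr _ 1 1 n) mxE.
Qed.

Lemma measurable_rV_cons : measurable_fun setT rV_cons.
Proof.
apply: measurable_fun_rVP => i.
rewrite -[i](@splitK 1 n); case: (@fintype.split 1 n i) => j.
  under eq_fun do rewrite /rV_cons (@row_mxEl _ 1 1 n) mxE.
  exact: measurable_fst.
under eq_fun do rewrite /rV_cons (@row_mxEr _ 1 1 n).
exact: measurableT_comp (measurable_rV_coord j) measurable_snd.
Qed.

Lemma measurable_rV_uncons : measurable_fun setT rV_uncons.
Proof.
apply: (@measurable_fun_pair _ _ _ _ _ _ (fun x : 'rV[R]_n.+1 =>
  x 0 0 : measurableTypeR R) (fun x => rsubmx (x : 'rV_(1 + n)))).
  exact: measurable_rV_coord.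
apply: measurable_fun_rVP => i.
by under eq_fun do rewrite mxE; exact: measurable_rV_coord.
Qed.

Definition lebesgue_rVS : set 'rV[R]_n.+1 -> \bar R :=
  pushforward (lebesgue_measure \x mu)%E rV_cons.

Let lebesgue_rVS0 : lebesgue_rVS set0 = 0%E.
Proof. by rewrite /lebesgue_rVS /pushforward preimage_set0 measure0. Qed.

Let lebesgue_rVS_ge0 A : (0 <= lebesgue_rVS A)%E.
Proof. by rewrite /lebesgue_rVS /pushforward measure_ge0. Qed.

Let lebesgue_rVS_sigma_additive : semi_sigma_additive lebesgue_rVS.
Proof.
move=> F mF tF mUF; rewrite /lebesgue_rVS /pushforward preimage_bigcup.
have mcons A : measurable A -> measurable (rV_cons @^-1` A).
  by move=> mA; rewrite -[X in measurable X]setTI; exact: measurable_rV_cons.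
apply: measure_semi_sigma_additive; first by move=> i; exact: mcons.
- apply/trivIsetP => /= i j _ _ ij; rewrite -preimage_setI.
  by move/trivIsetP : tF => /(_ _ _ _ _ ij) ->//; rewrite preimage_set0.
- by rewrite -preimage_bigcup; exact: mcons.
Qed.

HB.instance Definition _ := isMeasure.Build _ _ _ lebesgue_rVS
  lebesgue_rVS0 lebesgue_rVS_ge0 lebesgue_rVS_sigma_additive.

Let lebesgue_rVS_sigma_finite : sigma_finite setT lebesgue_rVS.
Proof.
have /sigma_finiteP[F [TF ndF Foo]] := sigma_finiteT (@lebesgue_measure R).
have /sigma_finiteP[G [TG ndG Goo]] := sigma_finiteT mu.
exists (fun i => rV_uncons @^-1` (F i `*` G i)).
  rewrite -preimage_bigcup -[LHS](preimage_setT rV_uncons); congr (_ @^-1` _).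
  rewrite -setXTT TF TG predeqE => -[x y]; split.
    move=> [/= [i _ Fix] [k _ Gky]]; exists (maxn i k) => //; split.
    - by move: x Fix; exact/subsetPset/ndF/leq_maxl.
    - by move: y Gky; exact/subsetPset/ndG/leq_maxr.
  by move=> [i _ []/= ? ?]; split; exists i.
move=> i; have [mF Fi_oo] := Foo i; have [mG Gi_oo] := Goo i; split.
  rewrite -[X in measurable X]setTI.
  by apply: measurable_rV_uncons => //; exact: measurableX.
rewrite /lebesgue_rVS /pushforward -comp_preimage.
rewrite (_ : _ \o _ = id); last by rewrite funeqE => z; exact: rV_consK.
by rewrite preimage_id product_measure1E// lte_mul_pinfty// ge0_fin_numE.
Qed.

HB.instance Definition _ := Measure_isSigmaFinite.Build _ _ _ lebesgue_rVS
  lebesgue_rVS_sigma_finite.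

End lebesgue_rV_recursion.

Fixpoint lebesgue_rV (R : realType) (n : nat) :
    {sigma_finite_measure set 'rV[R]_n -> \bar R} :=
  match n with
  | 0 => \d_(0 : 'rV[R]_0)
  | m.+1 => lebesgue_rVS (lebesgue_rV R m)
  end.

Lemma lebesgue_rV_box (R : realType) n (a b : 'rV[R]_n) :
  (forall i, a 0 i <= b 0 i) ->
  lebesgue_rV R n [set x | forall i, a 0 i <= x 0 i <= b 0 i] =
  (\prod_(i < n) (b 0 i - a 0 i))%:E.
Proof.
elim: n a b => [|n IH] a b ab.
  rewrite big_ord0 /= diracE mem_set//; last by case.
set A := [set x | _].
rewrite [LHS]/(lebesgue_rVS (lebesgue_rV R n) A) /lebesgue_rVS /pushforward.
pose a' : 'rV[R]_n := \row_i a 0 (lift ord0 i).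
pose b' : 'rV[R]_n := \row_i b 0 (lift ord0 i).
pose A' := [set x : 'rV[R]_n | forall i, a' 0 i <= x 0 i <= b' 0 i].
have cons0 z : (rV_cons z : 'rV[R]_n.+1) 0 0 = z.1.
  by rewrite -[in RHS](rV_consK z).
have consS (z : measurableTypeR R * 'rV[R]_n) i :
    (rV_cons z : 'rV[R]_n.+1) 0 (lift ord0 i) = z.2 0 i.
  rewrite (_ : lift ord0 i = rshift 1 i); last exact: val_inj.
  by rewrite /rV_cons (@row_mxEr _ 1 1 n).
have -> : (@rV_cons R n) @^-1` A = [set` `[a 0 0, b 0 0]] `*` A'.
  apply/seteqP; split=> [[r x]|[r x] [/= abr xA']] /=.
    move=> xA; split=> /=; first by have := xA 0; rewrite cons0 in_itv.
    by move=> i; have := xA (lift ord0 i); rewrite consS !mxE.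
  move=> i; case: (unliftP ord0 i) => [j ->|->].
    by have := xA' j; rewrite consS !mxE.
  by rewrite cons0/=; move: abr; rewrite in_itv.
have mA' : measurable A'.
  rewrite (_ : A' = \bigcap_i [set x : 'rV[R]_n |
      [set` `[a' 0 i, b' 0 i]] (x 0 i)]); last first.
    apply/seteqP; split=> x /= xA i; last by have := xA i I; rewrite /= in_itv.
    by move=> _ /=; rewrite in_itv; exact: xA.
  apply: fin_bigcap_measurable => // i _.
  rewrite -[X in measurable X]setTI.
  exact: (measurable_rV_coord i measurableT (measurable_itv _)).
have ab' i : a' 0 i <= b' 0 i by rewrite !mxE.
rewrite product_measure1E//= IH// big_ord_recl.
rewrite lebesgue_measure_itv/= lte_fin.
under eq_bigr do rewrite !mxE.
have [_|] := ltP (a 0 0) (b 0 0); first by rewrite -EFinD -EFinM.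
move=> ba; rewrite (_ : b 0 _ = a 0 ord0) ?subrr ?mul0r ?mul0e//.
by apply/le_anti/andP; split; [exact: ba|exact: ab].
Qed.

(* In finite dimension, f is of class C^m iff all its iterated directional
   derivatives of order at most m exist and are continuous. *)
Fixpoint continuously_derivable (R : realType) (V W : normedModType R) (m : nat)
    (f : V -> W) : Prop :=
  continuous f /\
  match m with
  | 0 => True
  | m'.+1 => forall v : V, (forall x, derivable f x v) /\
                           continuously_derivable m' ('D_v f)
  end.

Definition smooth (R : realType) (V W : normedModType R) (f : V -> W) : Prop :=
  forall m, continuously_derivable m f.

Section stratified_group.
Local Unset Implicit Arguments.

(* The strata are numbered from 0: stratum i has dimension [d i] and weight
   [i.+1], so that there are k = [r.+1] of them. *)
Definition stratified_space (R : realType) {r : nat} (d : 'I_r.+1 -> nat) :=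
  'rV[R]_(\sum_i d i).

Definition dilation {R : realType} {r : nat} {d : 'I_r.+1 -> nat} (lam : R)
    (x : stratified_space R d) : stratified_space R d :=
  \mxrow_(i < r.+1) (lam ^+ i.+1 *: submxrow x i).

Definition homogeneous_dim {r : nat} (d : 'I_r.+1 -> nat) : nat :=
  (\sum_(i < r.+1) i.+1 * d i)%N.

Definition lie_bracket {R : realType} {V : normedModType R} (X Y : V -> V) :
    V -> V :=
  fun x => 'D_(X x) Y x - 'D_(Y x) X x.

Inductive lie_algebra_generated {R : realType} {V : normedModType R}
    (gen : set (V -> V)) : (V -> V) -> Prop :=
| lie_gen X : gen X -> lie_algebra_generated gen X
| lie_linear a X Y : lie_algebra_generated gen X ->
    lie_algebra_generated gen Y ->
    lie_algebra_generated gen (fun x => a *: X x + Y x)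
| lie_comm X Y : lie_algebra_generated gen X -> lie_algebra_generated gen Y ->
    lie_algebra_generated gen (lie_bracket X Y).

(* the value at x of the left-invariant vector field that equals
   [d/dx_j] at the identity, for the j-th coordinate of the first stratum *)
Definition left_inv_field {R : realType} {r : nat} {d : 'I_r.+1 -> nat}
    (mul : stratified_space R d -> stratified_space R d -> stratified_space R d)
    (j : 'I_(d ord0)) (x : stratified_space R d) : stratified_space R d :=
  'D_(delta_mx 0 (tagnat.Rank ord0 j)) (mul x) 0.

(* The identity is the origin: it is fixed by every dilation. *)
Record stratified_group (R : realType) (r : nat) (d : 'I_r.+1 -> nat) := {
  sg_mul : stratified_space R d -> stratified_space R d -> stratified_space R d;
  sg_inv : stratified_space R d -> stratified_space R d;
  sg_dim_gt0 : forall i, (0 < d i)%N;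
  sg_mulA : associative sg_mul;
  sg_mul0g : left_id 0 sg_mul;
  sg_mulg0 : right_id 0 sg_mul;
  sg_mulVg : left_inverse 0 sg_inv sg_mul;
  sg_mulgV : right_inverse 0 sg_inv sg_mul;
  sg_smooth_mul : smooth
    (fun z : (stratified_space R d * stratified_space R d)%type =>
       sg_mul z.1 z.2);
  sg_smooth_inv : smooth sg_inv;
  sg_dilation_morph : forall lam : R, 0 < lam ->
    {morph (dilation lam) : x y / sg_mul x y};
  sg_generated : forall x : stratified_space R d,
    exists Z : 'I_(\sum_i d i) -> stratified_space R d -> stratified_space R d,
      (forall i, lie_algebra_generated (range (left_inv_field sg_mul)) (Z i)) /\
      \rank (\matrix_i Z i x) = (\sum_i d i)%N
}.

(* a homogeneous quasi-norm N such that N (y^-1 x) is a distance *)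
Record homogeneous_norm (R : realType) (r : nat) (d : 'I_r.+1 -> nat)
    (G : stratified_group R r d) (N : stratified_space R d -> R) : Prop := {
  hn_ge0 : forall x, 0 <= N x;
  hn_continuous : continuous N;
  hn_eq0 : forall x, N x = 0 <-> x = 0;
  hn_inv : forall x, N (sg_inv _ _ _ G x) = N x;
  hn_dilation : forall (lam : R) x, 0 < lam -> N (dilation lam x) = lam * N x;
  hn_triangle : forall x y z,
    N (sg_mul _ _ _ G (sg_inv _ _ _ G z) x) <=
    N (sg_mul _ _ _ G (sg_inv _ _ _ G y) x) +
    N (sg_mul _ _ _ G (sg_inv _ _ _ G z) y)
}.

End stratified_group.

Arguments stratified_group R {r} d.
Arguments sg_mul {R r d} _ _ _.
Arguments sg_inv {R r d} _ _.
Arguments homogeneous_norm {R r d} G N.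

Section fractional_sobolev.
Context {R : realType} {r : nat} {d : 'I_r.+1 -> nat}.
Variables (G : stratified_group R d) (N : stratified_space R d -> R).
Variables (Omega : set (stratified_space R d)) (s p : R).

Local Notation T := (stratified_space R d).
Local Notation mu := (lebesgue_rV R (\sum_i d i)).

Definition test_function (phi : T -> R) : Prop :=
  [/\ smooth phi, compact (closure [set x | phi x != 0]) &
      closure [set x | phi x != 0] `<=` Omega].

(* On the diagonal the inverse of 0 is 0; the diagonal is negligible. *)
Definition frac_kernel (x y : T) : R :=
  (N (sg_mul G (sg_inv G y) x) `^ ((homogeneous_dim d)%:R + s * p))^-1.

Definition X0_norm (u : T -> R) : \bar R :=
  ((\int[mu]_y \int[mu]_x (`|u x - u y| `^ p * frac_kernel x y)%:E)
     `^ p^-1)%E.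

(* The completion of the test functions is realized as their closure among the
   functions in L^p(G) vanishing outside Omega; two functions that are equal
   almost everywhere represent the same element. *)
Definition X0_space (u : T -> R) : Prop :=
  [/\ u \in Lfun mu p%:E, forall x, ~ Omega x -> u x = 0 &
      exists2 phi : nat -> T -> R, (forall n, test_function (phi n)) &
        X0_norm (phi n \- u) @[n --> \oo] --> 0%E].

Definition Linfty_norm (u : T -> R) : \bar R :=
  'N[mu]_+oo[EFin \o (u \_ Omega)].

Definition ess_inf_on (u : T -> R) : \bar R :=
  ess_inf mu (patch (cst +oo%E) Omega (EFin \o u)).

Definition frac_plap_form (u phi : T -> R) : \bar R :=
  \int[mu]_y \int[mu]_x (`|u x - u y| `^ (p - 2) * (u x - u y) *
                          (phi x - phi y) * frac_kernel x y)%:E.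

(* weak solution of (-Delta_p)^s u = lam * beta * g(u) in Omega, u = 0 outside *)
Definition weak_solution (beta : T -> R) (g : R -> R) (lam : R) (u : T -> R) :
    Prop :=
  [/\ X0_space u, ~ (\forall x \ae mu, u x = 0) &
      forall phi, X0_space phi ->
        frac_plap_form u phi =
        (lam%:E * \int[mu]_(x in Omega) (beta x * g (u x) * phi x)%:E)%E].

End fractional_sobolev.

(* G(tau), the integral of g from 0 to tau, with its sign when tau < 0 *)
Definition primitive0 (R : realType) (g : R -> R) (tau : R) : R :=
  if 0 <= tau then \int[lebesgue_measure]_(xi in `[0, tau]) g xi
  else - \int[lebesgue_measure]_(xi in `[tau, 0]) g xi.

Variant endpoint := zero_plus | plus_infty.

Definition endpoint_filter (R : realType) (M : endpoint) : set_system R :=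
  match M with
  | zero_plus => 0^'+
  | plus_infty => +oo%R
  end.
Arguments endpoint_filter R M : clear implicits.

(* Main.v *)
Require Import Defs.
From HB Require Import structures.
From mathcomp Require Import all_boot all_order all_algebra.
From mathcomp Require Import all_classical all_reals all_analysis.
From mathcomp Require Import measurable_realfun ess_sup_inf ring lra.

Set Implicit Arguments.
Unset Strict Implicit.
Unset Printing Implicit Defensive.

Import Order.TTheory GRing.Theory Num.Theory.
Import numFieldNormedType.Exports.

Local Open Scope classical_set_scope.
Local Open Scope ring_scope.

(** Solutions are local minima of J(u) = ||u||^p / p - lam * Psi(u), where Psi(u) is the integral of
    beta * G(u); one is found for each of infinitely many pairs of scales t, tau. Since sp > Q, a
    Morrey inequality ([morrey_embedding], [test_sup]) gives |u| <= C0 * ||u||. On the ball ||u|| <=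
    tau / C0 every function is therefore bounded by tau, and since g >= 0 makes G nondecreasing, Psi
    is at most a constant times G(tau). If G(tau) / tau^p is small, J is positive on the sphere of
    this ball whereas J(0) = 0, so a minimizer over the ball is interior, hence critical. If
    moreover G(t) / t^p is large for some t small against tau, then t times a fixed bump lies in the
    ball and J <= - t^p there, so the minimizer is nonzero and lam * Psi(u) >= t^p. This is
    [solution_between]; the lower and upper limits at M supply tau and t. As M = 0+, tau -> 0 forces
    both norms to 0. As M = +oo, t -> +oo forces Psi(u), hence ||u||, to infinity, because Psi is
    bounded on bounded sets.

    The minimizer ([minimizer]) is built without weak compactness. Test functions in the ball are
    equibounded and equicontinuous, so a minimizing sequence converges uniformly ([ascoli_cluster])
    and Psi converges with it. Midpoints stay in the ball, so the inequality
    [powR_uniform_convexity] turns near-minimality into the Cauchy property for the seminorm; the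
    limit thus lies in the closure of the test functions. Nonnegativity comes from composing the
    sequence with smooth approximations of the absolute value, which do not increase the seminorm.
    The equation is derived along test functions and extended to [X0_space] by density
    ([euler_lagrange]), with Young's inequality and [poincare].

    The geometry of the group enters through two facts. Left translations are triangular with unit
    diagonal ([is_shear_mul]), so they preserve Lebesgue measure; dilations then show that balls of
    radius rho have volume comparable to rho^Q. *)

(** * Convexity inequalities for the p-th power of real numbers *)

Section powR_inequalities.
Context {R : realType} (p : R).
Hypothesis p1 : 1 < p.
Implicit Types a b c t q : R.

Let p0 : 0 < p. Proof. exact: lt_trans p1. Qed.
Let pN0 : p != 0. Proof. by rewrite gt_eqF. Qed.
Let pB0 : 0 < p - 1. Proof. by rewrite subr_gt0. Qed.

Lemma continuous_norm_powR_neq0 q t : t != 0 -> {for t, continuous (fun x : R => `|x| `^ q)}.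
Proof.
move=> t0; apply: (@continuous_comp _ _ _ (@Num.norm R R) (fun x => x `^ q)).
  exact: norm_continuous.
apply: differentiable_continuous; apply/derivable1_diffP.
by apply: derivable_powR; rewrite in_itv/= andbT normr_gt0.
Qed.

Lemma continuous_norm_powR q : 0 < q -> continuous (fun t : R => `|t| `^ q).
Proof.
move=> q0 t; have [->|t0] := eqVneq t 0; last exact: continuous_norm_powR_neq0.
rewrite /continuous_at normr0 powR0 ?gt_eqF//; apply/cvgr0Pnorm_lt => e e0.
have [d d0 de] : exists2 d : R, 0 < d & d `^ q = e.
  by exists (e `^ q^-1); rewrite ?powR_gt0// -powRrM mulVf ?gt_eqF// powRr1// ltW.
have := @nbhs0_lt R R d d0; apply: filterS => x xd.
by rewrite ger0_norm ?powR_ge0// -de gt0_ltr_powR ?nnegrE ?(ltW d0).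
Qed.

(** For q = p this is the derivative of |c|^p / p; the factor c makes it vanish at 0 also when q <
    2. *)
Definition pdual (q c : R) : R := `|c| `^ (q - 2) * c.

Lemma pdualMl c : pdual p c * c = `|c| `^ p.
Proof.
rewrite /pdual -mulrA; have [->|c0] := eqVneq c 0.
  by rewrite mulr0 mulr0 normr0 powR0.
rewrite -expr2 -real_normK ?num_real// -powR_mulrn// -powRD ?subrK//.
by apply/implyP => _; rewrite normr_eq0.
Qed.

Lemma normr_pdual c : `|pdual p c| = `|c| `^ (p - 1).
Proof.
have [->|c0] := eqVneq c 0.
  by rewrite /pdual mulr0 normr0 powR0// gt_eqF.
rewrite /pdual normrM norm_powR// normr_id -[X in _ * X]powRr1//.
rewrite -powRD; last by apply/implyP => _; rewrite normr_eq0.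
by congr (_ `^ _); ring.
Qed.

Lemma continuous_pdual : continuous (pdual p).
Proof.
move=> t; have [->|t0] := eqVneq t 0; last first.
  apply: cvgM; first exact: (continuous_norm_powR_neq0 t0).
  exact: cvg_id.
rewrite /continuous_at {2}/pdual mulr0; apply/cvgr0Pnorm_lt => e e0.
under eq_near do rewrite normr_pdual.
have := @continuous_norm_powR _ pB0 0.
rewrite /continuous_at normr0 powR0 ?gt_eqF// => /cvgr0Pnorm_lt /(_ _ e0).
by apply: filterS => x; rewrite ger0_norm ?powR_ge0.
Qed.

(** Young's inequality for |a| and |c|^(p-1), with exponents p and p / (p - 1): the graph of the
    p-th power lies above its tangents. *)
Lemma powR_tangent a c : `|c| `^ p + p * pdual p c * (a - c) <= `|a| `^ p.
Proof.
pose q := p / (p - 1).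
have q0 : 0 < q by rewrite divr_gt0.
have pqE : q^-1 = 1 - p^-1.
  by rewrite /q invf_div mulrBl mulfV// mul1r.
have pq : p^-1 + q^-1 = 1 by rewrite pqE addrC subrK.
have := @conjugate_powR R `|a| (`|c| `^ (p - 1)) p q (normr_ge0 _) (powR_ge0 _ _) p0 q0 pq.
rewrite -powRrM (_ : (p - 1) * q = p); last by rewrite /q mulrC divfK// gt_eqF.
rewrite -normr_pdual pqE => H.
have : pdual p c * a <= `|a| * `|pdual p c|.
  by rewrite -normrM mulrC ler_norm.
move=> /le_trans /(_ H); rewrite -(ler_pM2l p0) => {}H.
have -> : p * pdual p c * (a - c) = p * (pdual p c * a) - p * `|c| `^ p.
  by rewrite -pdualMl; ring.
rewrite -(lerBrDl) in H *; apply: le_trans (lerB H (lexx _)) _.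
by rewrite le_eqVlt; apply/orP; left; apply/eqP; field.
Qed.

(** By the mean value theorem, since the derivative p x^(p-1) is strictly increasing on [c, 1]. *)
Lemma powR_tangent_strict c : 0 <= c < 1 -> c `^ p + p * c `^ (p - 1) * (1 - c) < 1.
Proof.
move=> /andP[]; rewrite le_eqVlt => /predU1P[<-|c0] c1.
  by rewrite !powR0 ?gt_eqF// mulr0 mul0r addr0.
have [||x xc E] := @MVT R (fun x => x `^ p) (fun x => p * x `^ (p - 1)) c 1 c1.
- move=> x; rewrite in_itv/= => /andP[cx _].
  exact: is_derive1_powR (lt_trans c0 cx).
- apply: continuous_in_subspaceT => x; rewrite inE/= in_itv/= => /andP[cx _].
  apply: differentiable_continuous; apply/derivable1_diffP.
  by apply: derivable_powR; rewrite in_itv/= andbT (lt_le_trans c0).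
move: E; rewrite powR1 => E.
rewrite -ltrBrDl E ltr_pM2r ?subr_gt0// ltr_pM2l//.
move: xc; rewrite in_itv/= => /andP[cx _].
apply: gt0_ltr_powR => //; rewrite nnegrE ltW//.
exact: lt_trans cx.
Qed.

(** Add the tangent inequalities at the midpoint c, evaluated at t and at 1: the linear terms
    cancel, as t - c = - (1 - c), and the second inequality is strict. *)
Lemma powR_midpoint_gt0 t : -1 <= t < 1 ->
  0 < (1 + `|t| `^ p) / 2 - `|(1 + t) / 2| `^ p.
Proof.
move=> /andP[t1 t2]; set c := (1 + t) / 2.
have c0 : 0 <= c by rewrite /c; lra.
have c1 : c < 1 by rewrite /c; lra.
have := powR_tangent_strict (introT andP (conj c0 c1)).
have := powR_tangent t c.
have -> : pdual p c = c `^ (p - 1).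
  rewrite -[in RHS](ger0_norm c0) -normr_pdual ger0_norm//.
  by rewrite mulr_ge0 ?powR_ge0.
rewrite (ger0_norm c0) => h1 h2.
have e : t - c = - (1 - c) by rewrite /c; field.
rewrite e in h1; lra.
Qed.

Lemma powR_uniform_convexity (e : R) : 0 < e -> exists2 C : R, 0 <= C &
  forall a b, `|a - b| `^ p <= e * (`|a| `^ p + `|b| `^ p) +
     C * ((`|a| `^ p + `|b| `^ p) / 2 - `|(a + b) / 2| `^ p).
Proof.
move=> e0.
pose d := Num.min (e `^ p^-1) 1.
have d0 : 0 < d by rewrite lt_min ltr01 powR_gt0.
have d1 : d <= 1 by rewrite ge_min lexx orbT.
have dp : d `^ p <= e.
  have -> : e = (e `^ p^-1) `^ p by rewrite -powRrM mulVf// powRr1// ltW.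
  by rewrite ge0_ler_powR ?nnegrE ?powR_ge0 ?(ltW d0) ?(ltW p0)// ge_min lexx.
pose h t : R := (1 + `|t| `^ p) / 2 - `|(1 + t) / 2| `^ p.
have ch : continuous h.
  move=> t; apply: cvgB.
    apply: cvgMl; apply: cvgD; first exact: cvg_cst.
    exact: (@continuous_norm_powR p p0).
  apply: (@continuous_comp _ _ _ (fun t : R => (1 + t) / 2) (fun t => `|t| `^ p)).
    by apply: cvgMl; apply: cvgD; [exact: cvg_cst|exact: cvg_id].
  exact: (@continuous_norm_powR p p0).
have [||t0 t0I ht0] := @EVT_min R h (-1) (1 - d).
- by lra.
- exact: continuous_subspaceT.
have m0 : 0 < h t0.
  apply: powR_midpoint_gt0; move: t0I; rewrite in_itv/= => /andP[? ?]; lra.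
pose C := 2 `^ p / h t0.
have C0 : 0 <= C by rewrite divr_ge0 ?powR_ge0// ltW.
have key t : -1 <= t <= 1 -> `|1 - t| `^ p <= e * (1 + `|t| `^ p) + C * h t.
  move=> /andP[tm1 t1].
  have [td|td] := leP t (1 - d).
    apply: (@le_trans _ _ (C * h t)); last first.
      by rewrite lerDr mulr_ge0 ?addr_ge0 ?powR_ge0 ?ltW.
    apply: (@le_trans _ _ (C * h t0)); last first.
      by rewrite ler_wpM2l// ht0// in_itv/= tm1.
    rewrite [C * _]divfK ?gt_eqF// ge0_ler_powR ?nnegrE ?(ltW p0)//.
    by rewrite ger0_norm; lra.
  have ht : 0 <= h t.
    move: t1; rewrite le_eqVlt => /predU1P[->|t1]; last first.
      by rewrite ltW// powR_midpoint_gt0// tm1.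
    by rewrite /h !normr1 powR1 (_ : (1 + 1) / 2 = 1 :> R) ?normr1 ?powR1 ?subrr//; lra.
  apply: (@le_trans _ _ e); last first.
    rewrite -[leLHS]addr0 lerD// ?(mulr_ge0 C0 ht)//.
    by rewrite ler_peMr ?(ltW e0)// lerDl powR_ge0.
  apply: le_trans dp; rewrite ge0_ler_powR ?nnegrE ?(ltW p0)//; first exact: ltW.
  by rewrite ger0_norm; lra.
exists C => //.
have main a b : `|b| <= `|a| -> a != 0 -> `|a - b| `^ p <= e * (`|a| `^ p + `|b| `^ p) +
     C * ((`|a| `^ p + `|b| `^ p) / 2 - `|(a + b) / 2| `^ p).
  move=> ba a0.
  have a0' : 0 < `|a| by rewrite normr_gt0.
  have : -1 <= b / a <= 1.
    by rewrite -ler_norml normrM normfV ler_pdivrMr// mul1r.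
  move=> /key; rewrite -(ler_pM2l (powR_gt0 p a0')) -powRM//.
  rewrite -normrM mulrBr mulr1 mulrCA mulfV// mulr1 => /le_trans; apply.
  rewrite /h mulrDr mulrCA [X in _ + X]mulrCA.
  have -> : `|a| `^ p * (1 + `|b / a| `^ p) = `|a| `^ p + `|b| `^ p.
    by rewrite mulrDr mulr1 -powRM// -normrM mulrCA mulfV// mulr1.
  rewrite mulrBr mulrA.
  have -> : `|a| `^ p * (1 + `|b / a| `^ p) = `|a| `^ p + `|b| `^ p.
    by rewrite mulrDr mulr1 -powRM// -normrM mulrCA mulfV// mulr1.
  rewrite -powRM// -normrM (_ : a * ((1 + b / a) / 2) = (a + b) / 2)//.
  by rewrite mulrA mulrDr mulr1 mulrCA mulfV// mulr1.
move=> a b; have [ab|/ltW ab] := leP `|b| `|a|.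
  have [a0|a0] := eqVneq a 0; last exact: main.
  move: ab; rewrite a0 normr0 normr_le0 => /eqP ->.
  by rewrite subrr addr0 mul0r normr0 powR0// addr0 !mul0r subrr !mulr0 addr0.
have [b0|b0] := eqVneq b 0; last first.
  by have := main b a ab b0; rewrite distrC [`|b| `^ p + _]addrC [b + a]addrC.
move: ab; rewrite b0 normr0 normr_le0 => /eqP ->.
by rewrite subrr addr0 mul0r normr0 powR0// addr0 !mul0r subrr !mulr0 addr0.
Qed.

Lemma powR_add_le a b : `|a + b| `^ p <= 2 `^ p * (`|a| `^ p + `|b| `^ p).
Proof.
wlog ab : a b / `|b| <= `|a|.
  move=> H; have [/H//|/ltW /H] := leP `|b| `|a|.
  by rewrite addrC [`|b| `^ p + _]addrC.
apply: (@le_trans _ _ ((2 * `|a|) `^ p)).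
  rewrite ge0_ler_powR ?nnegrE ?(ltW p0) ?mulr_ge0//.
  by rewrite (le_trans (ler_normD _ _))// mulrC mulr_natr mulr2n lerD.
by rewrite powRM// ler_wpM2l ?powR_ge0// lerDl powR_ge0.
Qed.

(** Compare w with eta * u: in each case a single term on the right dominates. The constants are not
    sharp, but eta can be taken as small as wanted. *)
Lemma powR_young_eta (eta u w : R) : 0 < eta -> 0 <= u -> 0 <= w ->
  u `^ (p - 1) * w <= eta * u `^ p + eta `^ (1 - p) * w `^ p.
Proof.
move=> e0 u0 w0; have [wu|uw] := leP w (eta * u).
  apply: (@le_trans _ _ (eta * u `^ p)); last first.
    by rewrite lerDl mulr_ge0 ?powR_ge0.
  rewrite -(mulr_powRB1 u0 p0) mulrA [leRHS]mulrC ler_wpM2l ?powR_ge0//.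
apply: (@le_trans _ _ (eta `^ (1 - p) * w `^ p)); last first.
  by rewrite lerDr mulr_ge0 ?powR_ge0// ltW.
rewrite -(mulr_powRB1 w0 p0) mulrCA mulrC ler_wpM2l//.
rewrite -[1 - p]opprB powRN -ler_pdivrMl ?invr_gt0 ?powR_gt0// invrK -powRM ?(ltW e0)//.
rewrite ge0_ler_powR ?nnegrE// ?mulr_ge0 ?(ltW uw) ?(ltW e0) ?(ltW pB0)//.
Qed.

End powR_inequalities.

(** * The p-energy on a measure space, its differential and its uniform convexity *)

Section p_energy.
Context d (W : measurableType d) (R : realType).
Variables (nu : {measure set W -> \bar R}) (p : R).
Hypothesis p1 : 1 < p.
Implicit Types U V : W -> R.

Let p0 : 0 < p. Proof. exact: lt_trans p1. Qed.
Let pN0 : p != 0. Proof. by rewrite gt_eqF. Qed.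
Let pB0 : 0 < p - 1. Proof. by rewrite subr_gt0. Qed.

Definition inLp U := measurable_fun setT U /\
  nu.-integrable setT (EFin \o (fun x => `|U x| `^ p)).

(** A real number whatever [U] is; it equals the integral of |U|^p under [inLp U], by [energyE]. *)
Definition energy U : R := \int[nu]_x (`|U x| `^ p).

Definition pnorm U : R := energy U `^ p^-1.

Lemma measurable_norm_powR U : measurable_fun setT U ->
  measurable_fun setT (fun x => `|U x| `^ p).
Proof.
move=> mU; apply: (@measurableT_comp _ _ _ _ _ _ (fun x : R => x `^ p)).
  exact: measurable_powR.
exact: measurableT_comp.
Qed.

Lemma measurable_pdual U : measurable_fun setT U ->
  measurable_fun setT (fun x => pdual p (U x)).
Proof.
move=> mU; apply: (@measurableT_comp _ _ _ _ _ _ (pdual p)) => //.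
by apply: continuous_measurable_fun; exact: continuous_pdual.
Qed.

Lemma energy_ge0 U : 0 <= energy U.
Proof. by apply: Rintegral_ge0 => x _; exact: powR_ge0. Qed.

Lemma pnorm_ge0 U : 0 <= pnorm U. Proof. exact: powR_ge0. Qed.

Lemma pnormK U : pnorm U `^ p = energy U.
Proof. by rewrite /pnorm -powRrM mulVf// powRr1// energy_ge0. Qed.

Lemma energyE U : inLp U -> (\int[nu]_x (`|U x| `^ p)%:E)%E = (energy U)%:E.
Proof. by move=> [_ iU]; rewrite /energy fineK// integrable_fin_num. Qed.

Lemma inLp_lty U : measurable_fun setT U ->
  (\int[nu]_x (`|U x| `^ p)%:E < +oo)%E -> inLp U.
Proof.
move=> mU Uoo; split=> //; apply/integrableP; split.
  by apply/measurable_EFinP; exact: measurable_norm_powR.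
by under eq_integral do rewrite /= ger0_norm ?powR_ge0//.
Qed.

Lemma inLp_le U V (c : R) : measurable_fun setT V -> inLp U ->
  (forall x, `|V x| `^ p <= c * `|U x| `^ p) -> inLp V.
Proof.
move=> mV [mU iU] VU; split=> //.
apply: (le_integrable measurableT _ _ (integrableZl measurableT c iU)) => /=.
  by apply/measurable_EFinP; exact: measurable_norm_powR.
move=> x _; rewrite lee_fin ger0_norm ?powR_ge0// (le_trans (VU x))//.
exact: ler_norm.
Qed.

Lemma inLpZ a U : inLp U -> inLp (fun x => a * U x).
Proof.
move=> LU; apply: (@inLp_le U _ (`|a| `^ p)) => //.
  by apply: measurable_funM => //; exact: LU.1.
by move=> x; rewrite normrM powRM.
Qed.

Lemma inLpD U V : inLp U -> inLp V -> inLp (fun x => U x + V x).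
Proof.
move=> [mU iU] [mV iV]; have mUV := measurable_funD mU mV; split=> //.
apply: (le_integrable measurableT _ _ (integrableZl measurableT (2 `^ p) (integrableD measurableT iU iV))) => /=.
  by apply/measurable_EFinP; exact: measurable_norm_powR.
move=> x _; rewrite lee_fin ger0_norm ?powR_ge0// (le_trans (powR_add_le p1 _ _))//.
exact: ler_norm.
Qed.

Lemma inLpB U V : inLp U -> inLp V -> inLp (fun x => U x - V x).
Proof.
move=> LU LV; have -> : (fun x => U x - V x) = (fun x => U x + (-1) * V x).
  by apply/funext => x; rewrite mulN1r.
exact/inLpD/inLpZ.
Qed.

Lemma energy_le U V : inLp U -> inLp V ->
  (forall x, `|U x| <= `|V x|) -> energy U <= energy V.
Proof.
move=> [mU iU] [mV iV] UV; apply: le_Rintegral => // x _.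
by rewrite ge0_ler_powR ?nnegrE ?(ltW p0).
Qed.

Lemma pnormE U : inLp U -> ('N[nu]_p%:E[EFin \o U])%E = (pnorm U)%:E.
Proof.
move=> LU; by rewrite unlock/= energyE.
Qed.

Lemma pnormD U V : inLp U -> inLp V ->
  pnorm (fun x => U x + V x) <= pnorm U + pnorm V.
Proof.
move=> LU LV; have := minkowski_EFin nu LU.1 LV.1 (ltW p1).
by rewrite (pnormE LU) (pnormE LV) (pnormE (inLpD LU LV)) lee_fin.
Qed.

Lemma energyZ a U : inLp U -> energy (fun x => a * U x) = `|a| `^ p * energy U.
Proof.
move=> [mU iU]; rewrite /energy -RintegralZl//.
by apply: eq_Rintegral => x _; rewrite normrM powRM.
Qed.

Lemma pnormZ a U : inLp U -> pnorm (fun x => a * U x) = `|a| * pnorm U.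
Proof.
move=> LU; rewrite /pnorm energyZ// powRM ?powR_ge0 ?energy_ge0//.
by rewrite -powRrM mulfV// powRr1.
Qed.

Lemma pnormN U : pnorm (fun x => - U x) = pnorm U.
Proof.
rewrite /pnorm /energy (_ : (fun x => `|- U x| `^ p) = (fun x => `|U x| `^ p))//.
by apply/funext => x; rewrite normrN.
Qed.

Lemma pnormB_sym U V : pnorm (fun x => U x - V x) = pnorm (fun x => V x - U x).
Proof.
rewrite -pnormN (_ : (fun x => - (U x - V x)) = (fun x => V x - U x))//.
by apply/funext => x; rewrite opprB.
Qed.

Lemma pairing_integrable U V : inLp U -> inLp V ->
  nu.-integrable setT (EFin \o (fun x => pdual p (U x) * V x)).
Proof.
move=> [mU iU] [mV iV].
apply: (le_integrable measurableT _ _ (integrableD measurableT iU iV)) => /=.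
  by apply/measurable_EFinP/measurable_funM => //; exact: measurable_pdual.
move=> x _; rewrite lee_fin normrM normr_pdual// (le_trans (powR_young_eta p1 ltr01 _ _))//.
by rewrite powR1 !mul1r ler_norm.
Qed.

(** The differential of [energy] / p at [U], applied to [V]. *)
Definition pairing U V : R := \int[nu]_x (pdual p (U x) * V x).

Lemma pairingZ U V (c : R) : inLp U -> inLp V ->
  pairing U (fun x => c * V x) = c * pairing U V.
Proof.
move=> LU LV; rewrite /pairing -RintegralZl//; last exact: pairing_integrable.
by apply: eq_Rintegral => x _; rewrite mulrCA.
Qed.

Lemma pairingD U V V' : inLp U -> inLp V -> inLp V' ->
  pairing U (fun x => V x + V' x) = pairing U V + pairing U V'.
Proof.
move=> LU LV LV'; rewrite /pairing -RintegralD//; try exact: pairing_integrable.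
by apply: eq_Rintegral => x _; rewrite mulrDr.
Qed.

(** Integrated form of [powR_tangent], with the tangent taken at the end point [U]: it bounds an
    increase of energy from above without differentiating under the integral. *)
Lemma pairing_tangent U V : inLp U -> inLp V ->
  energy U - energy V <= p * pairing U (fun x => U x - V x).
Proof.
move=> LU LV; have LUV := inLpB LU LV.
have iUV := pairing_integrable LU LUV.
rewrite /energy -RintegralB//; [|exact: LU.2|exact: LV.2].
rewrite -RintegralZl//; apply: le_Rintegral => //.
- exact: (integrableB _ LU.2 LV.2).
- exact: (integrableZl _ _ iUV).
move=> x _; have := powR_tangent p1 (V x) (U x).
rewrite -subr_ge0 => H; rewrite -subr_ge0; apply: le_trans H _.
by rewrite le_eqVlt; apply/orP; left; apply/eqP; ring.
Qed.

Lemma pairing_young eta U V : 0 < eta -> inLp U -> inLp V ->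
  `|pairing U V| <= eta * energy U + eta `^ (1 - p) * energy V.
Proof.
move=> e0 LU LV; have [[mU iU] [mV iV]] := (LU, LV).
have iUV := pairing_integrable LU LV.
apply: le_trans (le_normr_Rintegral measurableT iUV) _.
rewrite -!RintegralZl// -RintegralD//; last 2 first.
- exact: (integrableZl _ _ iU).
- exact: (integrableZl _ _ iV).
apply: le_Rintegral => //.
- exact: (integrable_abse iUV).
- by apply: (integrableD _ (integrableZl _ _ iU) (integrableZl _ _ iV)).
by move=> x _; rewrite normrM normr_pdual// powR_young_eta.
Qed.

Lemma pairing_cvg U V : inLp U -> inLp V ->
  pairing (fun x => U x + k.+1%:R^-1 * V x) V @[k --> \oo] --> pairing U V.
Proof.
move=> LU LV; have [[mU iU] [mV iV]] := (LU, LV).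
pose f_ k := fun x => (pdual p (U x + k.+1%:R^-1 * V x) * V x)%:E.
have LUV k : inLp (fun x => U x + k.+1%:R^-1 * V x) by exact/inLpD/inLpZ.
have mf k : measurable_fun [set: W] (f_ k : W -> \bar R).
  by have /integrableP[] := pairing_integrable (LUV k) LV.
have mf0 : measurable_fun setT (EFin \o (fun x => pdual p (U x) * V x)).
  by have /integrableP[] := pairing_integrable LU LV.
(* The dominating function 2^p (|U|^p + |V|^p) + |V|^p comes from [powR_young_eta] with eta = 1
   followed by [powR_add_le]. *)
have iUV := integrableD measurableT (integrableZl measurableT (2 `^ p)
  (integrableD measurableT iU iV)) iV.
have [||_ _] := dominated_convergence measurableT mf mf0 _ iUV _.
- apply: aeW => x _; apply: cvg_EFin; first exact: nearW.
  apply: cvgMl => //; apply: (continuous_cvg _ (@continuous_pdual _ _ p1 _)).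
  rewrite -[X in _ --> X]addr0; apply: cvgD; first exact: cvg_cst.
  rewrite -[X in _ --> X](mul0r (V x)); apply: cvgMl.
  exact: cvg_harmonic.
- apply: aeW => x k _ /=; rewrite lee_fin normrM normr_pdual//.
  apply: le_trans (powR_young_eta p1 ltr01 _ _) _ => //.
  rewrite powR1 !mul1r lerD2r; apply: le_trans (powR_add_le p1 _ _) _.
  rewrite ler_wpM2l ?powR_ge0// lerD2l ge0_ler_powR ?nnegrE ?(ltW p0)//.
  by rewrite normrM ler_piMl// ger0_norm// invf_le1// ler1n.
move=> H; apply: (@fine_cvg _ _ _ _ (fun k => \int[nu]_x f_ k x)%E).
rewrite /pairing /Rintegral fineK//; apply: integrable_fin_num => //.
exact: pairing_integrable.
Qed.

(** What makes minimizing sequences Cauchy: for bounded energies, [U] and [V] are close as soon as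
    the energy of their midpoint nearly reaches the mean of theirs. *)
Lemma energy_uniform_convexity (e : R) : 0 < e -> exists2 C : R, 0 <= C &
  forall U V, inLp U -> inLp V ->
    energy (fun x => U x - V x) <= e * (energy U + energy V) +
     C * ((energy U + energy V) / 2 - energy (fun x => (U x + V x) / 2)).
Proof.
move=> e0; have [C C0 HC] := powR_uniform_convexity p1 e0.
exists C => // U V LU LV; have [[mU iU] [mV iV]] := (LU, LV).
have LB := inLpB LU LV.
have LM : inLp (fun x => (U x + V x) / 2).
  have -> : (fun x => (U x + V x) / 2) = (fun x => 2^-1 * (U x + V x)).
    by apply/funext => x; rewrite mulrC.
  exact/inLpZ/inLpD.
have iD := integrableD measurableT iU iV.
have i1 := integrableZl measurableT e iD.
have i3 := integrableB measurableT (integrableZl measurableT 2^-1 iD) LM.2.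
have i2 := integrableZl measurableT C i3.
have -> : energy U + energy V = \int[nu]_x (`|U x| `^ p + `|V x| `^ p).
  by rewrite /energy RintegralD.
rewrite [X in C * (X - _)]mulrC -!RintegralZl//.
rewrite [X in C * (_ - X)]/energy -RintegralB//; first last.
- exact: LM.2.
- exact: (@integrableZl _ _ _ _ _ measurableT 2^-1 _ iD).
rewrite -RintegralZl// -RintegralD//.
apply: le_Rintegral => //; [exact: LB.2|exact: (integrableD _ i1 i2)|].
by move=> x _; apply: le_trans (HC _ _) _; rewrite [X in C * (X - _)]mulrC.
Qed.

Lemma fatou_energy (Un : nat -> W -> R) U (c : R) : measurable_fun setT U ->
  (forall n, inLp (Un n)) -> (forall x, Un n x @[n --> \oo] --> U x) ->
  (forall n, energy (Un n) <= c) -> inLp U /\ energy U <= c.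
Proof.
move=> mU LUn UnU Enc.
have /= := @fatou _ _ _ nu setT measurableT (fun n x => (`|Un n x| `^ p)%:E).
have -> : (\int[nu]_x limn_einf (fun n => (`|Un n x| `^ p)%:E) =
    \int[nu]_x (`|U x| `^ p)%:E)%E.
  apply: eq_integral => x _.
  have H : (`|Un n x| `^ p)%:E @[n --> \oo] --> (`|U x| `^ p)%:E.
    apply: cvg_EFin; first exact: nearW.
    exact: (continuous_cvg _ (@continuous_norm_powR _ _ p0 _)).
  by rewrite is_cvg_limn_einfE; [exact/cvg_lim|apply/cvg_ex; exists (`|U x| `^ p)%:E].
move=> /(_ _ _)/wrap[].
  by move=> n; apply/measurable_EFinP; apply: measurable_norm_powR; exact: (LUn n).1.
  by move=> n x _; rewrite lee_fin powR_ge0.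
move=> H; have {}H : (\int[nu]_x (`|U x| `^ p)%:E <= c%:E)%E.
  apply: le_trans H _; rewrite limn_einf_lim; apply: lime_le.
    exact: is_cvg_einfs.
  apply: nearW => n; apply: ereal_inf_le.
  exists (\int[nu]_x (`|Un n x| `^ p)%:E)%E; first by exists n => /=.
  by rewrite energyE ?lee_fin.
have LU : inLp U by apply: inLp_lty => //; apply: le_lt_trans H (ltry _).
by split=> //; move: H; rewrite energyE.
Qed.

End p_energy.

(** * Calculus of iterated directional derivatives *)

Section directional_derivative.
Context {R : realType} {V : normedModType R}.
Implicit Types (f g : V -> R) (x v : V).

(** With its converse [derive_line0], it reduces a directional derivative to that of a function of
    one real variable, so that one-variable rules apply. *)
Lemma is_derive_line f v x (t0 df : R) :
  is_derive (t0 *: v + x) v f df -> is_derive t0 1 (fun t => f (t *: v + x)) df.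
Proof.
move=> [dfx <-].
have E : (fun h : R => h^-1 *: (f (h *: v + (t0 *: v + x)) - f (t0 *: v + x))) =
    (fun h : R => h^-1 *: (f ((h *: 1 + t0) *: v + x) - f (t0 *: v + x))).
  by apply/funext => h; rewrite scalerDl addrA /GRing.scale/= mulr1.
by split; rewrite /derivable /derive /= -E.
Qed.

Lemma derive_line0 f v x (df : R) :
  is_derive (0 : R) 1 (fun t => f (t *: v + x)) df -> is_derive x v f df.
Proof.
move=> [dfx <-].
have E : (fun h : R => h^-1 *: (f (h *: v + x) - f x)) =
    (fun h : R => h^-1 *: (f ((h *: (1 : R) + 0 : R) *: v + x) - f ((0 : R) *: v + x))).
  by apply/funext => h; rewrite scale0r add0r addr0 /GRing.scale/= mulr1.
by split; rewrite /derivable /derive /= E.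
Qed.

Lemma is_derive_chain (h : R -> R) f v x (dh df : R) :
  is_derive x v f df -> is_derive (f x) 1 h dh ->
  is_derive x v (h \o f) (dh * df).
Proof.
move=> fx hx; apply: derive_line0.
apply: (@is_derive1_comp R h (fun t : R => f (t *: v + x)) 0 dh df).
- by rewrite scale0r add0r.
- by apply: is_derive_line; rewrite scale0r add0r.
Qed.

Lemma cdW m f : continuously_derivable m.+1 f -> continuously_derivable m f.
Proof.
elim: m f => [|m IH] f; first by case.
by move=> [cf H]; split=> // v; have [d1 d2] := H v; split=> //; exact: IH.
Qed.

Lemma cd_cst m (c : R) : continuously_derivable m (fun _ : V => c).
Proof.
elim: m c => [|m IH] c; (split; first by move=> x; exact: cvg_cst) => // v; split.
  by move=> x; exact: derivable_cst.
have -> : 'D_v (fun _ : V => c) = (fun _ => 0) by apply/funext => x; exact: derive_cst.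
exact: IH.
Qed.

Lemma cdD m f g : continuously_derivable m f -> continuously_derivable m g ->
  continuously_derivable m (fun x => f x + g x).
Proof.
elim: m f g => [|m IH] f g [cf df] [cg dg].
  by split=> // x; apply: cvgD; [exact: cf|exact: cg].
split; first by move=> x; apply: cvgD; [exact: cf|exact: cg].
move=> v; have [f1 f2] := df v; have [g1 g2] := dg v; split.
  by move=> x; exact: derivableD.
have -> : 'D_v (fun x => f x + g x) = (fun x => 'D_v f x + 'D_v g x).
  by apply/funext => x; exact: deriveD.
exact: IH.
Qed.

Lemma cdM m f g : continuously_derivable m f -> continuously_derivable m g ->
  continuously_derivable m (fun x => f x * g x).
Proof.
elim: m f g => [|m IH] f g cdf cdg; have [cf df] := cdf; have [cg dg] := cdg.
  by split=> // x; apply: cvgM; [exact: cf|exact: cg].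
split; first by move=> x; apply: cvgM; [exact: cf|exact: cg].
move=> v; have [f1 f2] := df v; have [g1 g2] := dg v; split.
  by move=> x; exact: derivableM.
have -> : 'D_v (fun x => f x * g x) = (fun x => f x * 'D_v g x + g x * 'D_v f x).
  by apply/funext => x; exact: deriveM.
by apply: cdD; apply: IH => //; exact: cdW.
Qed.

Lemma cd_comp m (h : R -> R) f : continuously_derivable m h ->
  continuously_derivable m f -> continuously_derivable m (h \o f).
Proof.
elim: m h f => [|m IH] h f cdh cdf; have [ch dh] := cdh; have [cf df] := cdf.
  by split=> // x; apply: continuous_comp; [exact: cf|exact: ch].
split; first by move=> x; apply: continuous_comp; [exact: cf|exact: ch].
move=> v; have [f1 f2] := df v; have [h1 h2] := dh 1.
have D x : is_derive x v (h \o f) ('D_1 h (f x) * 'D_v f x).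
  by apply: is_derive_chain; split.
split; first by move=> x; have [] := D x.
have -> : 'D_v (h \o f) = (fun x => 'D_1 h (f x) * 'D_v f x).
  by apply/funext => x; have [] := D x.
by apply: cdM => //; apply: (IH ('D_1 h) f) => //; exact: cdW.
Qed.

End directional_derivative.

(** * Smooth functions of one variable: regularized absolute value and flat functions *)

Section one_dimensional_smooth.
Context {R : realType}.
Implicit Types h : R -> R.

(** On the line a direction is a number v and the derivative along it is h' * v, so only h' has to
    be iterated. *)
Lemma cd1 m h h' : (forall x : R, is_derive x 1 h (h' x)) ->
  continuously_derivable m h' -> continuously_derivable m.+1 h.
Proof.
move=> hh' ch'; split.
  by move=> x; apply/differentiable_continuous/derivable1_diffP; case: (hh' x).
move=> v; have D x : is_derive x v h (h' x * v).
  exact: (@is_derive_chain R R h id v x (h' x) v).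
split; first by move=> x; case: (D x).
have -> : 'D_v h = (fun x => h' x * v) by apply/funext => x; case: (D x).
by apply: cdM => //; exact: cd_cst.
Qed.

(** A smooth, nonnegative, 1-Lipschitz function that vanishes at 0 and lies above |t| - e. Composed
    with a test function it yields a nonnegative test function of no larger seminorm. *)
Definition smooth_abs (e t : R) : R := Num.sqrt (t ^+ 2 + e ^+ 2) - e.

Let sq e t : R := Num.sqrt (t ^+ 2 + e ^+ 2).

Let sq_gt0 e t : 0 < e -> 0 < sq e t.
Proof. by move=> e0; rewrite sqrtr_gt0 ltr_wpDl ?sqr_ge0// exprn_gt0. Qed.

Let sqE e t : sq e t ^+ 2 = t ^+ 2 + e ^+ 2.
Proof. by rewrite sqr_sqrtr// addr_ge0 ?sqr_ge0. Qed.

Let is_derive_sq (e t : R) : 0 < e -> is_derive t 1 (sq e) (t * (sq e t)^-1).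
Proof.
move=> e0.
have H : 0 < t ^+ 2 + e ^+ 2 by rewrite ltr_wpDl ?sqr_ge0// exprn_gt0.
have D1 : is_derive t 1 (fun t : R => t ^+ 2 + e ^+ 2) (2 * t).
  apply: is_derive_eq; rewrite /GRing.scale/=; ring.
have := @is_derive_chain R R (@Num.sqrt R) (fun t : R => t ^+ 2 + e ^+ 2) 1 t _ _ D1 (is_derive1_sqrt H).
have -> // : (2 * Num.sqrt (t ^+ 2 + e ^+ 2))^-1 * (2 * t) = t * (sq e t)^-1.
by have := sq_gt0 t e0; rewrite /sq => s0; field; rewrite gt_eqF.
Qed.

(** The reciprocal w of the square root satisfies w' = - t w^3, so smoothness of w follows by
    induction on the order; the square root itself has derivative t w. *)
Lemma smooth_smooth_abs e : 0 < e -> smooth (smooth_abs e).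
Proof.
move=> e0.
pose w t := (sq e t)^-1.
have dw (t : R) : is_derive t 1 w (- (t * (w t * (w t * w t)))).
  have s0 : sq e t != 0 by rewrite gt_eqF// sq_gt0.
  have := @is_deriveV R (sq e) t _ 1 s0 (is_derive_sq t e0).
  have -> // : - (sq e t) ^- 2 *: (t * (sq e t)^-1) = - (t * (w t * (w t * w t))).
  by rewrite /w /GRing.scale/=; field.
have cdid m : continuously_derivable m (fun t : R => t).
  case: m => [|m]; first by split=> // t; exact: cvg_id.
  by apply: (@cd1 _ _ (fun=> 1)); exact: cd_cst.
have cdw m : continuously_derivable m w.
  elim: m => [|m IH].
    split=> // t; apply/differentiable_continuous/derivable1_diffP; by case: (dw t).
  apply: (cd1 dw); rewrite (_ : (fun _ => _) = (fun t => (-1) * (t * (w t * (w t * w t))))).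
    by apply: cdM; [exact: cd_cst|do 3 apply: cdM => //].
  by apply/funext => t; rewrite mulN1r.
move=> m; apply: (@cdD _ _ _ (sq e)); last exact: cd_cst.
by apply: cdW; apply: (@cd1 _ _ (fun t => t * w t)) => [t|]; [exact: is_derive_sq|exact: cdM].
Qed.

Lemma smooth_abs0 e : 0 <= e -> smooth_abs e 0 = 0.
Proof. by move=> e0; rewrite /smooth_abs expr0n add0r sqrtr_sqr ger0_norm// subrr. Qed.

Lemma smooth_abs_ge0 e t : 0 <= e -> 0 <= smooth_abs e t.
Proof.
move=> e0; rewrite subr_ge0 -{1}(ger0_norm e0) -sqrtr_sqr ler_wsqrtr//.
by rewrite lerDr sqr_ge0.
Qed.

Lemma smooth_abs_ge e t : `|t| - e <= smooth_abs e t.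
Proof. by rewrite lerD2r -sqrtr_sqr ler_wsqrtr// lerDl sqr_ge0. Qed.

Lemma smooth_abs_lip e a b : 0 < e -> `|smooth_abs e a - smooth_abs e b| <= `|a - b|.
Proof.
move=> e0; rewrite /smooth_abs opprB addrA subrK -/(sq e a) -/(sq e b).
have a0 := sq_gt0 a e0; have b0 := sq_gt0 b e0.
have ab0 : 0 < sq e a + sq e b by rewrite addr_gt0.
have la c : `|c| <= sq e c.
  by rewrite -sqrtr_sqr ler_wsqrtr// lerDl sqr_ge0.
rewrite -(ler_pM2r ab0) -{1}(gtr0_norm ab0) -normrM -subr_sqr !sqE.
rewrite (_ : _ - _ = (a - b) * (a + b)); last by ring.
rewrite normrM ler_wpM2l// (le_trans (ler_normD _ _))// lerD//.
Qed.

(** The family over all k, unlike exp(-1/t) alone, is stable under differentiation up to linear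
    combinations, which permits an induction. *)
Definition flat (k : nat) (t : R) : R :=
  if 0 < t then t ^- k * expR (- t^-1) else 0.

Lemma flat_ge0 k t : 0 <= flat k t.
Proof.
by rewrite /flat; case: ifPn => // t0; rewrite mulr_ge0 ?expR_ge0// invr_ge0 exprn_ge0// ltW.
Qed.

Lemma flat_gt0 k t : 0 < t -> 0 < flat k t.
Proof. by move=> t0; rewrite /flat t0 mulr_gt0 ?expR_gt0// invr_gt0 exprn_gt0. Qed.

(** From exp(1/t) >= (1/t)^(k+2) / (k+2)!. A quadratic bound is what gives a zero derivative at the
    origin. *)
Let flat_le k t : flat k t <= (k.+2)`!%:R * t ^+ 2.
Proof.
rewrite /flat; case: ifPn => t0; last by rewrite mulr_ge0// sqr_ge0.
have tV0 : 0 < t^-1 by rewrite invr_gt0.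
rewrite expRN ler_pdivrMr ?expR_gt0//.
have tk0 : 0 < t^-1 ^+ k.+2 / (k.+2)`!%:R by rewrite divr_gt0 ?exprn_gt0// ltr0n fact_gt0.
have H : t^-1 ^+ k.+2 / (k.+2)`!%:R <= expR t^-1.
  by apply: le_trans (expR_ge1Dxn k.+1 (ltW tV0)); rewrite lerDr.
apply: le_trans (_ : t ^- k <= (k.+2)`!%:R * t ^+ 2 * (t^-1 ^+ k.+2 / (k.+2)`!%:R)) _; last first.
  by rewrite ler_wpM2l// mulr_ge0// sqr_ge0.
rewrite le_eqVlt; apply/orP; left; apply/eqP.
rewrite -[k.+2]addn2 exprD exprVn; field.
have t0N : t != 0 by rewrite gt_eqF.
by rewrite pnatr_eq0 -lt0n fact_gt0 t0N expf_neq0.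
Qed.

Let is_derive_flat k (t : R) :
  is_derive t 1 (flat k) (flat k.+2 t - k%:R * flat k.+1 t).
Proof.
have [t0|] := ltP 0 t; last rewrite le_eqVlt => /predU1P[->|t0].
- have tN0 : t != 0 by rewrite gt_eqF.
  have D : is_derive t 1 (fun t => t ^- k * expR (- t^-1)) (flat k.+2 t - k%:R * flat k.+1 t).
    have Dx : is_derive t 1 (fun t : R => (t ^+ k)^-1) (- k%:R * t ^- k.+1).
      have tk0 : t ^+ k != 0 by rewrite expf_neq0.
      have Dk : is_derive t 1 (fun u : R => u ^+ k) ((k%:R * t ^+ k.-1) *: 1).
        by have := is_deriveX k (is_derive_id t 1); rewrite exprfctE.
      have /is_derive_eq := @is_deriveV R (fun t => t ^+ k) t _ 1 tk0 Dk.
      apply; rewrite /GRing.scale/= mulr1; case: k tk0 {Dk} => [|k] tk0.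
        by rewrite !(mul0r,mulr0,oppr0).
      by rewrite /= !exprS; field; rewrite tN0 expf_neq0.
    have De : is_derive t 1 (fun t : R => expR (- t^-1)) (expR (- t^-1) * t ^- 2).
      have /is_derive_eq := @is_derive_chain R R expR (fun t => - t^-1) 1 t _ _
        (is_deriveN (@is_deriveV R id t _ 1 tN0 (is_derive_id t 1))) (is_derive_expR _).
      by apply; rewrite /GRing.scale/= mulr1 opprK.
    have /is_derive_eq := is_deriveM Dx De; apply.
    rewrite /flat t0 /GRing.scale/= !exprS expr0 mulr1.
    by field; rewrite tN0 expf_neq0.
  apply: near_eq_is_derive D; have := lt_nbhsr t0; apply: filterS => u u0.
  by rewrite /flat u0.
- rewrite /flat ltxx mulr0 subr0.
  have H : h^-1 *: (flat k (h *: 1 + 0) - flat k 0) @[h --> (0 : R)^'] --> (0 : R).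
    apply/cvgr0Pnorm_le => e e0.
    have f0 : 0 < (k.+2)`!%:R :> R by rewrite ltr0n fact_gt0.
    have := @dnbhs0_lt R R _ (divr_gt0 e0 f0); apply: filterS => h hd.
    rewrite /GRing.scale/= mulr1 addr0 [flat k 0]/flat ltxx subr0.
    rewrite normrM normfV (ger0_norm (flat_ge0 _ _)).
    have [->|h0] := eqVneq h 0; first by rewrite normr0 invr0 mul0r ltW.
    apply: le_trans (ler_wpM2l _ (flat_le _ _)) _; first by rewrite invr_ge0.
    have h0' : 0 < `|h| by rewrite normr_gt0.
    rewrite -(real_normK (num_real h)) (_ : _ * _ = (k.+2)`!%:R * `|h|).
      by move: hd; rewrite ltr_pdivlMr// => /ltW; rewrite mulrC.
    by field; rewrite gt_eqF.
  split; first by apply/cvg_ex; exists 0.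
  exact: cvg_lim H.
- have tN : 0 < t = false by apply/negbTE; rewrite -leNgt ltW.
  rewrite /flat tN mulr0 subr0.
  apply: (@near_eq_is_derive _ _ _ (cst 0)).
  by have := lt_nbhsl t0; apply: filterS => u u0; rewrite /= ltNge (ltW u0).
Qed.

Lemma smooth_flat k : smooth (flat k).
Proof.
move=> m; elim: m k => [|m IH] k.
  split=> // t; apply/differentiable_continuous/derivable1_diffP.
  by case: (is_derive_flat k t).
apply: (cd1 (is_derive_flat k)).
rewrite (_ : (fun _ => _) = (fun t => flat k.+2 t + (- k%:R) * flat k.+1 t)).
  by apply: cdD => //; apply: cdM => //; exact: cd_cst.
by apply/funext => t; rewrite mulNr.
Qed.

End one_dimensional_smooth.

(** * Row vectors: sup norm, partial derivatives, bump functions *)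

Section row_vectors.
Context {R : realType}.

Lemma rV_norm_leP n (x : 'rV[R]_n) (c : R) : 0 <= c ->
  (`|x| <= c) <-> (forall i, `|x 0 i| <= c).
Proof.
move=> c0; split=> [xc i|H].
  by apply: le_trans xc; rewrite [leRHS]/Num.norm/= mx_normrE; apply: (le_bigmax _ _ (ord0, i)).
rewrite [leLHS]/Num.norm/= mx_normrE; apply: bigmax_le => // -[i j] _ /=.
by rewrite (ord1 i).
Qed.

Lemma rV_coord_le n (x : 'rV[R]_n) i : `|x 0 i| <= `|x|.
Proof. by have /(_ (lexx _)) := (rV_norm_leP x (normr_ge0 x)).1. Qed.

Lemma continuous_coord n (i : 'I_n) : continuous (fun x : 'rV[R]_n => x 0 i).
Proof.
exact: coord_continuous.
Qed.

Lemma continuous_rVP (X : topologicalType) n (f : X -> 'rV[R]_n) :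
  (forall i, continuous (fun x => f x 0 i)) -> continuous f.
Proof.
move=> cf x; apply/cvgrPdist_le => e e0.
have H : \forall y \near x, forall i, `|f x 0 i - f y 0 i| <= e.
  apply: filter_forall => i.
  by have /cvgrPdist_le/(_ _ e0) := cf i x.
apply: filterS H => y H; apply/(rV_norm_leP _ (ltW e0)) => i.
by rewrite !mxE.
Qed.

Lemma continuous_coord_comp (X : topologicalType) n (F : X -> 'rV[R]_n) (i : 'I_n) :
  continuous F -> continuous (fun x => F x 0 i).
Proof.
move=> cF x; apply: (@continuous_comp _ _ _ F (fun M : 'rV[R]_n => M 0 i)); first exact: cF.
exact: coord_continuous.
Qed.

Lemma continuous_pair (X Y Z : topologicalType) (f : X -> Y) (g : X -> Z) :
  continuous f -> continuous g -> continuous (fun x => (f x, g x)).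
Proof. by move=> cf cg x; exact: (cvg_pair (cf x) (cg x)). Qed.

Lemma continuous_pairl (X Y : topologicalType) (x : X) : continuous (fun y : Y => (x, y)).
Proof.
move=> y A /= [[B C] /= [Bx Cy] BCA]; apply: filterS Cy => z Cz; apply: BCA.
by split => //; exact: nbhs_singleton.
Qed.

Lemma cd_coord n m (i : 'I_n) : continuously_derivable m (fun x : 'rV[R]_n => x 0 i).
Proof.
case: m => [|m]; (split; first exact: continuous_coord) => // v.
have D (x : 'rV[R]_n) : is_derive x v (fun x : 'rV[R]_n => x 0 i) (v 0 i).
  apply: derive_line0.
  have -> : (fun t : R => (t *: v + x) 0 i) = (fun t => t * v 0 i + x 0 i).
    by apply/funext => t; rewrite !mxE.
  by apply: is_derive_eq; rewrite /GRing.scale/=; ring.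
split; first by move=> x; case: (D x).
have -> : 'D_v (fun x : 'rV[R]_n => x 0 i) = (fun=> v 0 i).
  by apply/funext => x; case: (D x).
exact: cd_cst.
Qed.

(** Go from y to x one coordinate at a time and apply the mean value theorem on each segment. Balls
    of the sup norm are boxes, so the intermediate points [z k] stay in the ball. *)
Lemma lipschitz_partials n (f : 'rV[R]_n -> R) (C rho : R) : 0 <= C -> 0 <= rho ->
  (forall x i, derivable f x (delta_mx 0 i)) ->
  (forall x i, `|x| <= rho -> `|'D_(delta_mx 0 i) f x| <= C) ->
  forall x y, `|x| <= rho -> `|y| <= rho -> `|f x - f y| <= n%:R * C * `|x - y|.
Proof.
move=> C0 rho0 df Df x y /(rV_norm_leP x rho0) xr /(rV_norm_leP y rho0) yr.
pose z k : 'rV[R]_n := \row_j (if (j < k)%N then x 0 j else y 0 j).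
have z0 : z 0%N = y by apply/rowP => j; rewrite mxE.
have zn : z n = x by apply/rowP => j; rewrite mxE ltn_ord.
have step (i : 'I_n) : `|f (z i.+1) - f (z i)| <= C * `|x - y|.
  pose dl := x 0 i - y 0 i.
  have zE t : t *: (dl *: delta_mx 0 i) + z i =
      \row_j (if j == i then y 0 i + t * dl else z i 0 j).
    apply/rowP => j; rewrite !mxE eqxx/=.
    by case: eqVneq => [->|]; rewrite ?ltnn ?mulr1 ?mulr0 ?add0r// addrC.
  have z1 : z i.+1 = 1 *: (dl *: delta_mx 0 i) + z i.
    rewrite zE; apply/rowP => j; rewrite !mxE ltnS leq_eqVlt.
    case: (eqVneq j i) => [->|ji]; first by rewrite eqxx/= mul1r addrC subrK.
    by rewrite (negbTE (_ : (j : nat) != i)).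
  pose phi t := f ((t * dl) *: delta_mx 0 i + z i).
  have dphi t : is_derive t (1 : R) phi ('D_(delta_mx 0 i) f ((t * dl) *: delta_mx 0 i + z i) * dl).
    apply: (@is_derive1_comp R (fun u => f (u *: delta_mx 0 i + z i)) (fun t => t * dl)).
      by apply: is_derive_line; split.
    by apply: is_derive_eq; rewrite /GRing.scale/=; ring.
  have [|c c01 E] := @MVT_segment R phi _ 0 1 ler01 (fun t _ => dphi t).
    by apply: derivable_within_continuous => t _; case: (dphi t).
  have -> : f (z i.+1) - f (z i) = phi 1 - phi 0.
    by rewrite /phi z1 mul0r scale0r add0r mul1r scale1r.
  rewrite E subr0 mulr1 normrM ler_pM//; last first.
    by have := rV_coord_le (x - y) i; rewrite !mxE.
  apply: Df; apply/(rV_norm_leP _ rho0) => j.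
  rewrite -scalerA zE mxE; have [_|_] := eqVneq j i; last by rewrite mxE; case: ifP.
  move: c01; rewrite in_itv/= => /andP[c0 c1].
  have -> : y 0 i + c * dl = (1 - c) * y 0 i + c * x 0 i by rewrite /dl; ring.
  apply: le_trans (ler_normD _ _) _; rewrite !normrM (ger0_norm c0).
  rewrite ger0_norm ?subr_ge0//.
  have -> : rho = (1 - c) * rho + c * rho by ring.
  by rewrite lerD// ler_wpM2l// subr_ge0.
have -> : f x - f y = \sum_(i < n) (f (z i.+1) - f (z i)).
  by rewrite -zn -z0 -(big_mkord xpredT (fun i => f (z i.+1) - f (z i))) telescope_sumr.
apply: le_trans (ler_norm_sum _ _ _) _.
apply: le_trans (ler_sum _ (fun i _ => step i)) _.
by rewrite sumr_const card_ord -mulrA [leRHS]mulr_natl.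
Qed.

Lemma bounded_on_ball n (f : 'rV[R]_n -> R) (rho : R) : continuous f -> 0 <= rho ->
  exists2 C, 0 <= C & forall x, `|x| <= rho -> `|f x| <= C.
Proof.
move=> cf rho0; pose A := [set x : 'rV[R]_n | `|x| <= rho].
have cA : compact A.
  apply: bounded_closed_compact.
    by exists rho; split; [exact: num_real|move=> M rM x /= /le_trans; apply; exact: ltW].
  by apply: (@closed_comp _ _ (fun x : 'rV[R]_n => `|x|) [set t | t <= rho]) => [x _|];
    [exact: norm_continuous|exact: closed_le].
have A0 : A !=set0 by exists 0; rewrite /A/= normr0.
have cnf : {within A, continuous (fun x => `|f x|)}.
  apply: continuous_subspaceT => x; apply: continuous_comp; [exact: cf|exact: norm_continuous].
have [c cA' Hc] := EVT_max_rV A0 cA cnf.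
by exists `|f c| => // x xr; apply: Hc; rewrite inE.
Qed.

Lemma compact_rV_ball n (rho : R) : compact [set x : 'rV[R]_n | `|x| <= rho].
Proof.
apply: bounded_closed_compact.
  by exists rho; split; [exact: num_real|move=> M rM x /= /le_trans; apply; exact: ltW].
by apply: (@closed_comp _ _ (fun x : 'rV[R]_n => `|x|) [set t | t <= rho]) => [x _|];
  [exact: norm_continuous|exact: closed_le].
Qed.

Lemma bounded_on_ball2 m n (f : 'rV[R]_m * 'rV[R]_n -> R) (rho : R) : continuous f ->
  exists2 C, 0 <= C & forall x y, `|x| <= rho -> `|y| <= rho -> `|f (x, y)| <= C.
Proof.
move=> cf; have cA := compact_setX (@compact_rV_ball m rho) (@compact_rV_ball n rho).
have := continuous_compact (continuous_subspaceT cf) cA => /compact_bounded[M [_ HM]].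
exists (Num.max 0 (M + 1)); first by rewrite le_max lexx.
move=> x y xr yr; rewrite le_max; apply/orP; right.
by apply: (HM (M + 1)); [rewrite ltrDl|exists (x, y)].
Qed.

(** A product of one-variable bumps, because the balls of the sup norm are products of intervals. *)
Definition rV_bump n (c : 'rV[R]_n) (e : R) (x : 'rV[R]_n) : R :=
  \prod_(i < n) flat 0 (e ^+ 2 - (x 0 i - c 0 i) ^+ 2).

Lemma smooth_rV_bump n (c : 'rV[R]_n) e : smooth (rV_bump c e).
Proof.
move=> m.
have H (s : seq 'I_n) : continuously_derivable m
    (fun x : 'rV[R]_n => \prod_(i <- s) flat 0 (e ^+ 2 - (x 0 i - c 0 i) ^+ 2)).
  elim: s => [|i s IH].
    by under eq_fun do rewrite big_nil; exact: cd_cst.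
  under eq_fun do rewrite big_cons.
  apply: cdM => //; apply: (@cd_comp R _ m (flat 0)); first exact: smooth_flat.
  apply: cdD; first exact: cd_cst.
  have Hi : continuously_derivable m (fun x : 'rV[R]_n => x 0 i - c 0 i).
    by apply: cdD; [exact: cd_coord|exact: cd_cst].
  have -> : (fun x : 'rV[R]_n => - (x 0 i - c 0 i) ^+ 2) =
      (fun x => (-1) * ((x 0 i - c 0 i) * (x 0 i - c 0 i))).
    by apply/funext => x; rewrite mulN1r expr2.
  by apply: cdM; [exact: cd_cst|exact: cdM].
exact: H.
Qed.

Lemma rV_bump_ge0 n (c : 'rV[R]_n) (e : R) (x : 'rV[R]_n) : 0 <= rV_bump c e x.
Proof. by apply: prodr_ge0 => i _; exact: flat_ge0. Qed.

Lemma rV_bump_neq0 n (c : 'rV[R]_n) (e : R) (x : 'rV[R]_n) : 0 < e -> rV_bump c e x != 0 -> `|x - c| <= e.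
Proof.
move=> e0 bx; apply/(rV_norm_leP _ (ltW e0)) => i; rewrite !mxE.
rewrite leNgt; apply: contra bx => ex; rewrite /rV_bump (bigD1 i)//= mulf_eq0.
apply/orP; left; rewrite /flat ltNge subr_le0 -[leRHS]real_normK ?num_real//.
by rewrite lerXn2r ?nnegrE// ltW.
Qed.

End row_vectors.

(** * Measurability of continuous functions and open sets by discretization *)

Section countable_approximation.

Lemma measurable_countable_comp d d' (X : measurableType d) (Y : measurableType d')
    (C : countType) (g : X -> C) (h : C -> Y) :
  (forall c, measurable (g @^-1` [set c])) -> measurable_fun setT (h \o g).
Proof.
move=> mg _ B mB; rewrite setTI.
rewrite (_ : _ @^-1` B = \bigcup_(c in [set: C]) (if `[< B (h c) >] then g @^-1` [set c] else set0)).
  apply: countable_bigcupT_measurable => [|c]; first exact: countableP.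
  by case: ifP.
apply/seteqP; split => [x Bx|x [c _]].
  by exists (g x) => //; case: ifPn => // /asboolP; apply.
by case: ifPn => //= /asboolP + ->.
Qed.

(** The sigma-algebra on row vectors is generated by the coordinates. A continuous function is a
    limit of functions that are constant on the cells of countable grids, and the cells are
    measurable by construction. *)
Lemma measurable_fun_discretized d (R : realType) (X : measurableType d) (C : nat -> countType)
    (g : forall k, X -> C k) (h : forall k, C k -> R) (f : X -> R) :
  (forall k c, measurable (g k @^-1` [set c])) ->
  (forall x, h k (g k x) @[k --> \oo] --> f x) -> measurable_fun setT f.
Proof.
move=> mg hgf; apply: (@measurable_fun_cvg _ _ _ setT (fun k => h k \o g k)).
  by move=> k; exact: measurable_countable_comp.
by move=> x _; exact: hgf.
Qed.

End countable_approximation.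

Section continuous_measurable_rV.
Context {R : realType}.

Let grid n k (x : 'rV[R]_n) : 'rV[int]_n := \row_i Num.floor (x 0 i * k.+1%:R).
Let ungrid n k (c : 'rV[int]_n) : 'rV[R]_n := \row_i ((c 0 i)%:~R / k.+1%:R).

Let measurable_grid n k (c : 'rV[int]_n) : measurable (@grid n k @^-1` [set c]).
Proof.
rewrite (_ : _ @^-1` _ = \bigcap_i
  [set x : 'rV[R]_n | [set` `[(c 0 i)%:~R / k.+1%:R, (c 0 i + 1)%:~R / k.+1%:R[] (x 0 i)]).
  apply: fin_bigcap_measurable => // i _; rewrite -[X in measurable X]setTI.
  exact: (measurable_rV_coord i measurableT (measurable_itv _)).
have k0 : 0 < k.+1%:R :> R by [].
apply/seteqP; split => x /=.
  move=> <- i _ /=; rewrite mxE in_itv/= ler_pdivrMr// ltr_pdivlMr//.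
  by rewrite floor_le_tmp ?num_real// floorD1_gt.
move=> H; apply/rowP => i; rewrite mxE; apply/eqP.
have /= := H i I; rewrite in_itv/= ler_pdivrMr// ltr_pdivlMr// => /andP[h1 h2].
by apply/eqP/floor_def; rewrite h1.
Qed.

Let ungridK n (x : 'rV[R]_n) : ungrid k (grid k x) @[k --> \oo] --> x.
Proof.
apply/cvgrPdist_le => e e0; have := @near_infty_natSinv_lt R (PosNum e0).
apply: filterS => k /= ke; apply/rV_norm_leP; first exact: ltW.
move=> i; rewrite !mxE; apply: le_trans (ltW ke).
have k0 : 0 < k.+1%:R :> R by [].
have kN0 : k.+1%:R != 0 :> R by rewrite gt_eqF.
rewrite -[X in X - _](mulfK kN0) -mulrBl normrM [X in _ * X]gtr0_norm ?invr_gt0//.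
rewrite ler_piMl ?invr_ge0//; set y := _ * _.
have /andP[h1 h2] : (Num.floor y)%:~R <= y < (Num.floor y + 1)%:~R.
  by rewrite floor_le_tmp ?num_real// floorD1_gt.
by rewrite ger0_norm ?subr_ge0// lerBlDl ltW// -[X in _ + X]/(1%:~R) -intrD.
Qed.

Lemma continuous_measurable_rV n (f : 'rV[R]_n -> R) :
  continuous f -> measurable_fun setT f.
Proof.
move=> cf; apply: (@measurable_fun_discretized _ _ _ (fun=> 'rV[int]_n)
  (fun k => grid k) (fun k c => f (ungrid k c))).
  by move=> k c; exact: measurable_grid.
by move=> x; apply: continuous_cvg; [exact: cf|exact: ungridK].
Qed.

(** An open set is the union of the grid cells, of all mesh sizes, that it contains, and these are
    countably many. *)
Lemma open_measurable_rV n (A : set 'rV[R]_n) : open A -> measurable A.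
Proof.
move=> oA; pose cell k (c : 'rV[int]_n) := @grid n k @^-1` [set c].
rewrite (_ : A = \bigcup_k \bigcup_(c in [set: 'rV[int]_n])
    (if `[< cell k c `<=` A >] then cell k c else set0)).
  apply: bigcupT_measurable => k; apply: countable_bigcupT_measurable => [|c].
    exact: countableP.
  by case: ifP => _ //; exact: measurable_grid.
apply/seteqP; split=> [x Ax|x [k _ [c _]]]; last first.
  by case: ifPn => // /asboolP; apply.
have /nbhs_ballP[e /= e0 xeA] : nbhs x A by exact: open_nbhs_nbhs.
have [k _ /(_ k (leqnn k))/= ke] := @near_infty_natSinv_lt R (PosNum e0).
exists k => //; exists (grid k x) => //.
have sub : cell k (grid k x) `<=` A.
  move=> y /= yx; apply: xeA; rewrite -ball_normE/=; apply: le_lt_trans ke.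
  apply/rV_norm_leP => // i; rewrite !mxE.
  have /rowP/(_ i) := yx; rewrite !mxE => E.
  have k0 : 0 < k.+1%:R :> R by [].
  have h1 := floorD1_gt (x 0 i * k.+1%:R); have h2 := floorD1_gt (y 0 i * k.+1%:R).
  have h3 : (Num.floor (x 0 i * k.+1%:R))%:~R <= x 0 i * k.+1%:R by rewrite floor_le_tmp ?num_real.
  have h4 : (Num.floor (y 0 i * k.+1%:R))%:~R <= y 0 i * k.+1%:R by rewrite floor_le_tmp ?num_real.
  rewrite E intrD in h2; rewrite E in h4; rewrite intrD in h1.
  rewrite -(ler_pM2r k0) mulVf ?gt_eqF// -[X in _ * X](gtr0_norm k0) -normrM mulrBl.
  rewrite ler_norml; move: h1 h2 h3 h4; rewrite -[1%:~R]/(1 : R); lra.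
by case: asboolP.
Qed.

Lemma continuous_measurable_rV2 n (f : 'rV[R]_n * 'rV[R]_n -> R) :
  continuous f -> measurable_fun setT f.
Proof.
move=> cf; apply: (@measurable_fun_discretized _ _ _ (fun=> ('rV[int]_n * 'rV[int]_n)%type)
  (fun k z => (grid k z.1, grid k z.2)) (fun k c => f (ungrid k c.1, ungrid k c.2))).
  move=> k [c1 c2]; rewrite (_ : _ @^-1` _ =
    (grid k @^-1` [set c1]) `*` (grid k @^-1` [set c2])); first exact: measurableX.
  by apply/seteqP; split => -[x y] /= [-> ->].
move=> [x y].
have H : (ungrid k (grid k x), ungrid k (grid k y)) @[k --> \oo] --> (x, y).
  exact: (cvg_pair (@ungridK n x) (@ungridK n y)).
exact: (@continuous_cvg _ _ _ _ _ (fun k => (ungrid k (grid k x), ungrid k (grid k y))) f (x, y) (cf (x, y)) H).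
Qed.

End continuous_measurable_rV.

(** * Maps that preserve Lebesgue measure *)

Section measure_preserving.
Context d (X : measurableType d) (R : realType).
Variables (mu : {measure set X -> \bar R}) (phi : X -> X).
Hypothesis mphi : measurable_fun setT phi.
Hypothesis phi_mu : forall A, measurable A -> mu (phi @^-1` A) = mu A.

Lemma ge0_integral_preserving (f : X -> \bar R) : measurable_fun setT f ->
  (forall x, 0 <= f x)%E -> (\int[mu]_x f (phi x) = \int[mu]_x f x)%E.
Proof.
move=> mf f0; rewrite -[in LHS](preimage_setT phi).
rewrite -(@ge0_integral_pushforward _ _ _ _ _ _ mphi mu setT f)//.
pose nu : {measure set X -> \bar R} :=
  measure_function_pushforward__canonical__measure_function_Measure mu mphi.
exact: (@eq_measure_integral _ _ _ setT mu nu f (fun A mA _ => phi_mu mA)).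
Qed.

End measure_preserving.

Lemma lebesgue_measure_shift (R : realType) (c : R) (A : set (measurableTypeR R)) :
  measurable A -> lebesgue_measure ((fun x => x + c) @^-1` A) = lebesgue_measure A.
Proof.
move=> mA; have mc : measurable_fun [set: measurableTypeR R] (fun x : measurableTypeR R => (x + c : measurableTypeR R)).
  exact: measurable_funD.
pose nu : {measure set (measurableTypeR R) -> \bar R} :=
  measure_function_pushforward__canonical__measure_function_Measure lebesgue_measure mc.
apply/esym; apply: (@lebesgue_measure_unique R nu) => // _ [[a b] _ <-].
rewrite /nu/= /pushforward (_ : _ @^-1` _ = [set` `]a - c, b - c]]); last first.
  by apply/seteqP; split => x /=; rewrite !in_itv/= ltrBlDr lerBrDr.
rewrite !lebesgue_measure_itv/= !lte_fin ltrD2r; case: ifP => // _.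
by rewrite -!EFinD; congr EFin; ring.
Qed.

Section shear.
Context {R : realType}.

(** Triangular maps with unit diagonal, possibly nonlinear. *)
Definition is_shear n (phi : 'rV[R]_n -> 'rV[R]_n) :=
  forall (i : 'I_n) (x y : 'rV[R]_n), (forall j : 'I_n, (j < i)%N -> x 0 j = y 0 j) ->
    phi x 0 i - x 0 i = phi y 0 i - y 0 i.

Lemma rV_cons0 n (z : measurableTypeR R * 'rV[R]_n) : (rV_cons z : 'rV[R]_n.+1) 0 0 = z.1.
Proof. by rewrite -[in RHS](rV_consK z). Qed.

Lemma rV_consS n (z : measurableTypeR R * 'rV[R]_n) i :
  (rV_cons z : 'rV[R]_n.+1) 0 (lift ord0 i) = z.2 0 i.
Proof.
rewrite (_ : lift ord0 i = rshift 1 i); last exact: val_inj.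
by rewrite /rV_cons (@row_mxEr _ 1 1 n).
Qed.

Lemma measurable_preimage d d' (X : measurableType d) (Y : measurableType d') (f : X -> Y) A :
  measurable_fun setT f -> measurable A -> measurable (f @^-1` A).
Proof. by move=> mf mA; rewrite -[X in measurable X]setTI; exact: mf. Qed.

(** Fubini and induction on the dimension: the first coordinate is translated by a constant c, and
    for each of its values a the other coordinates undergo a shear [phi_ a]. *)
Lemma shear_preserving n (phi : 'rV[R]_n -> 'rV[R]_n) : measurable_fun setT phi ->
  is_shear phi -> forall A, measurable A ->
  lebesgue_rV R n (phi @^-1` A) = lebesgue_rV R n A.
Proof.
elim: n phi => [|n IH] phi mphi sphi A mA.
  by congr (lebesgue_rV R 0 _); apply/seteqP; split=> x /=;
    rewrite (_ : phi x = x)//; apply/rowP => -[].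
pose c : measurableTypeR R := phi (rV_cons (0, 0)) 0 0.
pose phi_ (a : measurableTypeR R) (x : 'rV[R]_n) : 'rV[R]_n := (rV_uncons (phi (rV_cons (a, x)))).2.
have mS (B : set 'rV[R]_n.+1) : measurable B -> measurable (@rV_cons R n @^-1` B).
  by apply: measurable_preimage; exact: measurable_rV_cons.
have mphi_ a : measurable_fun setT (phi_ a).
  apply: (measurableT_comp measurable_snd).
  apply: (measurableT_comp (@measurable_rV_uncons R n)).
  apply: (measurableT_comp mphi).
  apply: (measurableT_comp (@measurable_rV_cons R n)).
  exact: measurable_pair1.
have sphi_ a : is_shear (phi_ a).
  move=> i x y xy.
  have E (z : 'rV[R]_n) : phi_ a z 0 i = phi (rV_cons (a, z)) 0 (lift ord0 i).
    by rewrite -[in RHS](rV_unconsK (phi _)) rV_consS.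
  rewrite !E.
  have := sphi (lift ord0 i) (rV_cons (a, x)) (rV_cons (a, y)); rewrite !rV_consS; apply.
  move=> j; case: (unliftP ord0 j) => [k ->|->] ji; last by rewrite !rV_cons0.
  by rewrite !rV_consS/=; apply: xy; move: ji; rewrite !lift0.
have phiE a x : phi (rV_cons (a, x)) = rV_cons ((a + c : measurableTypeR R), phi_ a x).
  rewrite -[LHS]rV_unconsK; congr rV_cons; rewrite [LHS]surjective_pairing; congr pair.
  have H : phi (rV_cons (a, x)) 0 0 - a = c.
    by have := sphi 0 (rV_cons (a, x)) (rV_cons (0, 0)); rewrite !rV_cons0/= subr0; exact.
  by rewrite -H /= addrC subrK.
rewrite [LHS]/(lebesgue_rVS (lebesgue_rV R n) _) /lebesgue_rVS /pushforward.
rewrite [RHS]/(lebesgue_rVS (lebesgue_rV R n) _) /lebesgue_rVS /pushforward.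
rewrite /product_measure1/=.
pose F (a : measurableTypeR R) := lebesgue_rV R n (xsection (@rV_cons R n @^-1` A) a).
have mF : measurable_fun setT F by apply: measurable_fun_xsection; exact: mS.
have mc : measurable_fun [set: measurableTypeR R] (fun x : measurableTypeR R => (x + c : measurableTypeR R)).
  exact: measurable_funD.
have := @ge0_integral_preserving _ _ _ lebesgue_measure _ mc (@lebesgue_measure_shift R c) F mF.
move=> <-//.
apply: eq_integral => a _ /=; rewrite /F.
rewrite (_ : xsection (@rV_cons R n @^-1` (phi @^-1` A)) a =
    phi_ a @^-1` (xsection (@rV_cons R n @^-1` A) (a + c))).
  by apply: IH => //; apply: measurable_xsection; exact: mS.
by apply/seteqP; split => x; rewrite /= /xsection /= !inE /= phiE.
Qed.

End shear.

(** * The group law in coordinates and left invariance of Lebesgue measure *)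

Section derivative_coordinates.
Context {R : realType} {V : normedModType R}.

Lemma is_derive_coord n (F : V -> 'rV[R]_n) (x v : V) (i : 'I_n) :
  derivable F x v -> is_derive x v (fun z => F z 0 i) ('D_v F x 0 i).
Proof.
move=> dF; have H : (h^-1 *: (F (h *: v + x) - F x)) 0 i @[h --> (0 : R)^'] --> 'D_v F x 0 i.
  by apply: (@continuous_cvg _ _ _ _ _ (fun h => h^-1 *: (F (h *: v + x) - F x)) (fun M : 'rV[R]_n => M 0 i)); [exact: coord_continuous|exact: dF].
have E : (fun h : R => (h^-1 *: (F (h *: v + x) - F x)) 0 i) =
    (fun h : R => h^-1 *: (F (h *: v + x) 0 i - F x 0 i)).
  by apply/funext => h; rewrite !mxE.
rewrite E in H; split; first by apply/cvg_ex; exists ('D_v F x 0 i).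
exact: cvg_lim H.
Qed.

End derivative_coordinates.

Lemma limit_of_products (R : realType) (u v : nat -> R) (c a b : R) :
  (forall k, c = u k * v k) -> u k @[k --> \oo] --> a -> v k @[k --> \oo] --> b ->
  c = a * b.
Proof.
move=> cuv ua vb; have H := cvgM ua vb.
rewrite (_ : u \* v = fun=> c) in H; last by apply/funext => k /=; rewrite -cuv.
by apply: (cvg_unique _ _ (H _)) => //; exact: cvg_cst.
Qed.

Section stratified_coordinates.
Context {R : realType} {r : nat} {d : 'I_r.+1 -> nat}.
Local Notation n := (\sum_i d i)%N.
Local Notation T := (stratified_space R d).
Implicit Types (x y z : T) (lam : R).

(** The exponent with which [dilation] scales coordinate j; the successor is due to the strata being
    numbered from 0. *)
Definition weight (j : 'I_n) : nat := (tagnat.sig1 j).+1.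

Lemma dilationE lam x j : (dilation lam x) 0 j = lam ^+ weight j * x 0 j.
Proof. by rewrite !mxE tagnat.sig2K. Qed.

Lemma weight_le (i j : 'I_n) : (i <= j)%N -> (weight i <= weight j)%N.
Proof. by move=> ij; rewrite ltnS; exact: (tagnat.le_sig1 ij). Qed.

Lemma sum_weight : (\sum_(j < n) weight j = homogeneous_dim d)%N.
Proof.
rewrite /homogeneous_dim (reindex (@tagnat.rank _ d))/=; last first.
  by apply: onW_bij; exact: tagnat.rank_bij.
have -> : (\sum_(p : {i : 'I_r.+1 & 'I_(d i)}) weight (tagnat.rank p) =
    \sum_(p : {i : 'I_r.+1 & 'I_(d i)}) (tag p).+1)%N.
  by apply: eq_bigr => p _; rewrite /weight tagnat.rankE tagnat.Rank1K.
rewrite -(@sig_big_dep _ _ _ _ (fun i => 'I_(d i)) xpredT (fun _ => xpredT) (fun (i : 'I_r.+1) _ => i.+1))/=.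
by apply: eq_bigr => i _; rewrite sum_nat_const card_ord mulnC.
Qed.

Variable G : stratified_group R d.
Local Notation mul := (sg_mul G).
Local Notation inv := (sg_inv G).
Local Notation mul0g := (sg_mul0g _ _ _ G).
Local Notation mulg0 := (sg_mulg0 _ _ _ G).

Lemma continuous_mul : continuous (fun z : T * T => mul z.1 z.2).
Proof. by case: (sg_smooth_mul _ _ _ G 0%N). Qed.

Lemma continuous_inv : continuous inv.
Proof. by case: (sg_smooth_inv _ _ _ G 0%N). Qed.

Lemma continuous_mull x : continuous (mul x).
Proof.
move=> y; apply: (@continuous_comp _ _ _ (fun y : T => (x, y)) (fun z : T * T => mul z.1 z.2)).
  exact: continuous_pairl.
exact: continuous_mul.
Qed.

Let coordm (i : 'I_n) (z : T * T) : R := mul z.1 z.2 0 i.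
(** The partial derivative of the i-th coordinate of x y with respect to y_j, at z = (x, y). *)
Let dcoordm (i j : 'I_n) (z : T * T) : R :=
  ('D_((0 : T), (delta_mx 0 j : T)) (fun z : T * T => mul z.1 z.2) z : T) 0 i.

Let is_derive_coordm i j (z : T * T) :
  is_derive z ((0 : T), (delta_mx 0 j : T)) (coordm i) (dcoordm i j z).
Proof.
apply: is_derive_coord; have [_ H] := sg_smooth_mul _ _ _ G 1%N.
by have [+ _] := H ((0 : T), (delta_mx 0 j : T)); apply.
Qed.

Let continuous_dcoordm i j : continuous (dcoordm i j).
Proof.
have [_ H] := sg_smooth_mul _ _ _ G 1%N.
have [_ [+ _]] := H ((0 : T), (delta_mx 0 j : T)) => cD.
exact: continuous_coord_comp cD.
Qed.

Let line_coordm i j (x y : T) (t0 : R) :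
  is_derive t0 (1 : R) (fun t : R => mul x (t *: (delta_mx 0 j : T) + y) 0 i)
    (dcoordm i j (x, t0 *: (delta_mx 0 j : T) + y)).
Proof.
have := @is_derive_line R _ (coordm i) ((0 : T), (delta_mx 0 j : T)) (x, y) t0
  (dcoordm i j (x, t0 *: (delta_mx 0 j : T) + y)).
have -> : t0 *: ((0 : T), (delta_mx 0 j : T)) + (x, y) = (x, t0 *: (delta_mx 0 j : T) + y).
  by congr pair => /=; rewrite scaler0 add0r.
move=> /(_ (is_derive_coordm _ _ _)).
rewrite (_ : (fun t : R => coordm i (t *: ((0 : T), (delta_mx 0 j : T)) + (x, y))) =
  (fun t : R => mul x (t *: (delta_mx 0 j : T) + y) 0 i))//.
by apply/funext => t; rewrite /coordm/= scaler0 add0r.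
Qed.

(** Differentiate in y_j the identity that expresses that dilations are automorphisms. *)
Let dilation_dcoordm i j lam x y : 0 < lam ->
  lam ^+ weight j * dcoordm i j (dilation lam x, dilation lam y) =
  lam ^+ weight i * dcoordm i j (x, y).
Proof.
move=> lam0.
have H1 := line_coordm i j x y 0; rewrite scale0r add0r in H1.
have H2 := line_coordm i j (dilation lam x) (dilation lam y) 0.
rewrite scale0r add0r in H2.
have D1 : is_derive (0 : R) (1 : R) (fun t : R => lam ^+ weight i * mul x (t *: (delta_mx 0 j : T) + y) 0 i)
   (lam ^+ weight i * dcoordm i j (x, y)).
  exact: (@is_deriveZ _ _ _ _ (lam ^+ weight i) _ _ _ H1).
have D2 : is_derive (0 : R) (1 : R) (fun t : R => lam ^+ weight i * mul x (t *: (delta_mx 0 j : T) + y) 0 i)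
   (dcoordm i j (dilation lam x, dilation lam y) * lam ^+ weight j).
  rewrite (_ : (fun t : R => _) = (fun u => mul (dilation lam x) (u *: (delta_mx 0 j : T) + dilation lam y) 0 i) \o (fun t => t * lam ^+ weight j)).
    apply: is_derive1_comp; first by rewrite mul0r.
    by apply: is_derive_eq; rewrite /GRing.scale/=; ring.
  apply/funext => t /=.
  rewrite -dilationE sg_dilation_morph//; congr (mul _ _ 0 i).
  apply/rowP => k; rewrite dilationE !mxE mulrDr eqxx/= tagnat.sig2K; congr (_ + _).
  have [->|_] := eqVneq k j; last by rewrite !mulr0.
  by rewrite !mulr1 mulrC.
by rewrite mulrC; case: D1 => _ <-; case: D2.
Qed.

Let harmonic_dilation x : dilation (k.+1%:R^-1 : R) x @[k --> \oo] --> (0 : T).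
Proof.
have H : \row_j (k.+1%:R^-1 ^+ weight j * x 0 j) @[k --> \oo] --> (0 : 'rV[R]_n).
  apply/cvgrPdist_le => e e0.
  have c0 : 0 < e / (1 + `|x|) by rewrite divr_gt0// ltr_pwDl.
  have := @near_infty_natSinv_lt R (PosNum c0); apply: filterS => k /= ke.
  apply/rV_norm_leP; first exact: ltW.
  move=> j; rewrite !mxE add0r normrN normrM.
  have k1 : 0 <= k.+1%:R^-1 :> R by rewrite invr_ge0.
  have k2 : k.+1%:R^-1 <= 1 :> R by rewrite invf_le1// ler1n.
  rewrite ger0_norm ?exprn_ge0// /weight exprS -mulrA.
  apply: le_trans (_ : k.+1%:R^-1 * (1 + `|x|) <= e); last first.
    by rewrite -ler_pdivlMr ?ltr_pwDl// ltW.
  rewrite ler_wpM2l// (le_trans _ (_ : `|x| <= _)) ?lerDr//.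
  by rewrite (le_trans _ (rV_coord_le x j))// ler_piMl// exprn_ile1.
rewrite (_ : (fun k : nat => _) = (fun k : nat => \row_j (k.+1%:R^-1 ^+ weight j * x 0 j)))//.
by apply/funext => k; apply/rowP => j; rewrite dilationE mxE.
Qed.

Let dcoordm_id i j : dcoordm i j (0, 0) = (i == j)%:R.
Proof.
have := line_coordm i j 0 0 0; rewrite scale0r add0r.
rewrite (_ : (fun t : R => _) = (fun t : R => t * (i == j)%:R)); last first.
  by apply/funext => t; rewrite mul0g !mxE eqxx/= addr0.
move=> [_ <-]; have D : is_derive (0 : R) (1 : R) (fun t : R => t * (i == j)%:R) (i == j)%:R.
  by apply: is_derive_eq; rewrite /GRing.scale/=; ring.
by case: D.
Qed.

(** By homogeneity the derivative at (x, y) is lam^(weight j - weight i) times its value at the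
    dilated point. The exponent is nonnegative, and as lam -> 0 the point tends to the origin, where
    y |-> 0 y is the identity. *)
Let dcoordmE i j (z : T * T) : (weight i <= weight j)%N -> dcoordm i j z = (i == j)%:R.
Proof.
case: z => x y wij.
have H k : dcoordm i j (x, y) = k.+1%:R^-1 ^+ (weight j - weight i) *
    dcoordm i j (dilation k.+1%:R^-1 x, dilation k.+1%:R^-1 y).
  have k0 : 0 < k.+1%:R^-1 :> R by rewrite invr_gt0.
  have := dilation_dcoordm i j x y k0.
  move: (dcoordm i j (x, y)) (dcoordm i j (dilation _ x, dilation _ y)) => a b E.
  apply: (mulfI (expf_neq0 (weight i) (lt0r_neq0 k0))).
  by rewrite mulrA -exprD subnKC.
have Hc : dcoordm i j (dilation k.+1%:R^-1 x, dilation k.+1%:R^-1 y) @[k --> \oo] -->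
    dcoordm i j (0, 0).
  apply: (@continuous_cvg _ _ _ _ _ (fun k : nat => (dilation k.+1%:R^-1 x, dilation k.+1%:R^-1 y)) (dcoordm i j)).
    exact: continuous_dcoordm.
  exact: (cvg_pair (@harmonic_dilation x) (@harmonic_dilation y)).
have Hp : (k.+1%:R^-1 : R) ^+ (weight j - weight i) @[k --> \oo] -->
    (0 : R) ^+ (weight j - weight i).
  by apply: (@continuous_cvg _ _ _ _ _ (fun k : nat => k.+1%:R^-1 : R) (fun t : R => t ^+ (weight j - weight i))); [exact: exprn_continuous|exact: cvg_harmonic].
rewrite (limit_of_products H Hp Hc).
rewrite dcoordm_id expr0n.
(* On the diagonal the limit of the power is 0 ^+ 0 = 1; off the diagonal the derivative at the
   origin is already 0. *)
have [->|ij] := eqVneq i j; first by rewrite subnn mul1r.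
by rewrite mulr0.
Qed.

(** Freeze the coordinates before i with [mask]. The others have weight at least that of i, so by
    [dcoordmE] all partial derivatives of (x u)_i - u_i vanish, and this quantity is constant. *)
Lemma is_shear_mul x : is_shear (mul x).
Proof.
move=> i y y' yy'.
pose mask (u : T) : T := \row_j (if (j < i)%N then y 0 j else u 0 j).
pose H (u : T) : R := mul x (mask u) 0 i - mask u 0 i.
have maskD u (t : R) j : mask (t *: (delta_mx 0 j : T) + u) =
    (if (j < i)%N then 0 else t) *: (delta_mx 0 j : T) + mask u.
  apply/rowP => k; rewrite !mxE eqxx/=; have [->|kj] := eqVneq k j.
    by case: ifP => _; rewrite ?mul0r ?add0r.
  by rewrite !mulr0 !add0r.
have dH u j : is_derive u (delta_mx 0 j : T) H 0.
  apply: derive_line0; rewrite /H.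
  have [ji|ij] := ltnP j i.
    rewrite (_ : (fun t : R => _) = cst (H u)); first exact: is_derive_cst.
    by apply/funext => t; rewrite maskD ji scale0r add0r.
  have D1 := line_coordm i j x (mask u) 0.
  have D2 : is_derive (0 : R) (1 : R) (fun t : R => - (t * (i == j)%:R + mask u 0 i)) (- (i == j)%:R).
    by apply: is_derive_eq; rewrite /GRing.scale/=; ring.
  have := is_deriveD D1 D2; rewrite dcoordmE ?weight_le// subrr.
  rewrite (_ : _ + _ = (fun t : R => mul x (mask (t *: (delta_mx 0 j : T) + u)) 0 i -
             mask (t *: (delta_mx 0 j : T) + u) 0 i))//.
  apply/funext => t; rewrite /= maskD ltnNge ij/= !mxE eqxx/= ltnn.
  by [].
have HE (u : T) : (forall j : 'I_n, (j < i)%N -> y 0 j = u 0 j) -> H u = mul x u 0 i - u 0 i.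
  move=> uy; rewrite /H (_ : mask u = u)//.
  by apply/rowP => j; rewrite mxE; case: ifP => // /uy.
rewrite -(HE y)// -(HE y')//; apply/eqP; rewrite -subr_eq0 -normr_le0.
pose rho := Num.max `|y| `|y'|.
have := @lipschitz_partials R n H 0 rho (lexx _) _ _ _ y y'.
rewrite mulr0 mul0r; apply.
- by rewrite le_max normr_ge0.
- by move=> u j; case: (dH u j).
- by move=> u j _; case: (dH u j) => _ ->; rewrite normr0.
- by rewrite le_max lexx.
- by rewrite le_max lexx orbT.
Qed.

(** The derivatives in the second factor are bounded on compact sets, and the product with the
    identity returns y. *)
Lemma mul_lipschitz (rho : R) : 0 <= rho -> exists2 L : R, 0 <= L &
  forall y z, `|y| <= rho -> `|z| <= rho -> `|mul y z - y| <= L * `|z|.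
Proof.
move=> rho0.
pose C (q : 'I_n * 'I_n) := projT1 (cid2 (bounded_on_ball2 rho (@continuous_dcoordm q.1 q.2))).
pose S := \sum_q C q.
have C0 q : 0 <= C q by rewrite /C; case: cid2.
have CP i j y z : `|y| <= rho -> `|z| <= rho -> `|dcoordm i j (y, z)| <= S.
  move=> yr zr; apply: (@le_trans _ _ (C (i, j))).
    by rewrite /C; case: cid2 => c c0 /= /(_ y z yr zr).
  by rewrite /S (bigD1 (i, j))//= lerDl sumr_ge0.
have S0 : 0 <= S by exact: sumr_ge0.
exists (n%:R * S); first by rewrite mulr_ge0.
move=> y z yr zr; apply/rV_norm_leP => [|i]; first by rewrite !mulr_ge0.
rewrite !mxE.
have D (u : T) j : is_derive u (delta_mx 0 j : T) (fun u => mul y u 0 i) (dcoordm i j (y, u)).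
  by apply: derive_line0; have := line_coordm i j y u 0; rewrite scale0r add0r.
have H1 u j : derivable (fun u : 'rV[R]_n => mul y u 0 i) u (delta_mx 0 j).
  by case: (D u j).
have H2 (u : 'rV[R]_n) j : `|u| <= rho ->
    `|'D_(delta_mx 0 j) (fun u : 'rV[R]_n => mul y u 0 i) u| <= S.
  by move=> ur; case: (D u j) => _ ->; exact: CP.
have z0 : `|0 : 'rV[R]_n| <= rho by rewrite normr0.
have := @lipschitz_partials R n _ S rho S0 rho0 H1 H2 z 0 zr z0.
by rewrite mulg0 subr0.
Qed.

Lemma measurable_mull x : measurable_fun setT (mul x).
Proof.
apply: (@measurable_fun_rVP _ T) => i.
apply: continuous_measurable_rV; apply: continuous_coord_comp; exact: continuous_mull.
Qed.

Local Notation mu := (lebesgue_rV R n).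

Lemma mul_preserving x (A : set T) : measurable A -> mu (mul x @^-1` A) = mu A.
Proof. exact: shear_preserving (@measurable_mull x) (@is_shear_mul x) A. Qed.

End stratified_coordinates.

(** * The homogeneous distance and the volume of its balls *)

Section homogeneous_distance.
Context {R : realType} {r : nat} {d : 'I_r.+1 -> nat}.
Local Notation n := (\sum_i d i)%N.
Local Notation T := (stratified_space R d).
Local Notation mu := (lebesgue_rV R n).
Variables (G : stratified_group R d) (N : T -> R) (hN : homogeneous_norm G N).
Local Notation mul := (sg_mul G).
Local Notation inv := (sg_inv G).
Local Notation mulA := (sg_mulA _ _ _ G).
Local Notation mul0g := (sg_mul0g _ _ _ G).
Local Notation mulg0 := (sg_mulg0 _ _ _ G).
Local Notation mulVg := (sg_mulVg _ _ _ G).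
Local Notation mulgV := (sg_mulgV _ _ _ G).
Local Notation Q := (homogeneous_dim d).
Implicit Types (x y z a b : T).

Lemma sg_mulKg a b : mul (inv a) (mul a b) = b.
Proof. by rewrite mulA mulVg mul0g. Qed.

Lemma sg_mulKVg a b : mul a (mul (inv a) b) = b.
Proof. by rewrite mulA mulgV mul0g. Qed.

Lemma sg_invK a : inv (inv a) = a.
Proof. by rewrite -[LHS]mulg0 -(mulVg a) sg_mulKg. Qed.

Lemma sg_invM a b : inv (mul a b) = mul (inv b) (inv a).
Proof.
rewrite -[LHS]mulg0 -(mulgV a) -[in X in mul _ (mul a X)](mul0g (inv a)) -(mulgV b).
by rewrite -(mulA b) (mulA a) sg_mulKg.
Qed.

Definition hdist x y : R := N (mul (inv y) x).

Lemma hdist_ge0 x y : 0 <= hdist x y. Proof. exact: hn_ge0 hN _. Qed.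

Lemma hdistC x y : hdist x y = hdist y x.
Proof. by rewrite /hdist -(hn_inv _ _ _ _ _ hN) sg_invM sg_invK. Qed.

Lemma hdist_triangle x y z : hdist x z <= hdist x y + hdist y z.
Proof. exact: hn_triangle hN _ _ _. Qed.

Lemma hnorm0 : N 0 = 0. Proof. by apply/(hn_eq0 _ _ _ _ _ hN). Qed.

Lemma hdist_eq0 x y : hdist x y = 0 -> x = y.
Proof. by move=> /(hn_eq0 _ _ _ _ _ hN) H; rewrite -(sg_mulKVg y x) H mulg0. Qed.

Lemma hdistxx x : hdist x x = 0. Proof. by rewrite /hdist mulVg hnorm0. Qed.

Lemma continuous_hdist : continuous (fun z : T * T => hdist z.1 z.2).
Proof.
have c1 : continuous (fun z : T * T => (inv z.2, z.1)).
  apply: continuous_pair; last by move=> z; exact: cvg_fst.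
  move=> z; apply: (@continuous_comp _ _ _ snd inv); first exact: cvg_snd.
  exact: continuous_inv.
have c2 : continuous (fun z : T * T => mul (inv z.2) z.1).
  move=> z; apply: (@continuous_comp _ _ _ (fun z : T * T => (inv z.2, z.1)) (fun z : T * T => mul z.1 z.2)).
    exact: c1.
  exact: continuous_mul.
move=> z; apply: (@continuous_comp _ _ _ (fun z : T * T => mul (inv z.2) z.1) N); first exact: c2.
exact: hn_continuous hN _.
Qed.

Lemma measurable_hdist : measurable_fun setT (fun z : T * T => hdist z.1 z.2).
Proof. exact: (continuous_measurable_rV2 continuous_hdist). Qed.

Lemma measurable_hnorm : measurable_fun setT N.
Proof. exact: (continuous_measurable_rV (hn_continuous _ _ _ _ _ hN)). Qed.

Lemma dilation_norm_ge (lam : R) x : 1 <= lam -> lam * `|x| <= `|dilation lam x|.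
Proof.
move=> l1; have l0 : 0 < lam by exact: lt_le_trans l1.
rewrite -ler_pdivlMl//; apply/rV_norm_leP; first by rewrite mulr_ge0// invr_ge0 ltW.
move=> j; rewrite ler_pdivlMl//; apply: le_trans (rV_coord_le _ j).
rewrite dilationE normrM ler_wpM2r// ger0_norm ?exprn_ge0 ?(ltW l0)//.
by rewrite /weight exprS ler_peMr ?(ltW l0)// exprn_ege1.
Qed.

Let dim_gt0 : (0 < n)%N.
Proof.
rewrite (bigD1 ord0)//= addn_gt0; have := sg_dim_gt0 _ _ _ G ord0.
by move=> ->.
Qed.

Let unit_vector : exists z : T, `|z| = 1.
Proof.
exists (const_mx 1); apply/eqP; rewrite eq_le; apply/andP; split.
  by apply/rV_norm_leP => // i; rewrite mxE normr1.
by have := rV_coord_le (const_mx 1 : 'rV[R]_n) (Ordinal dim_gt0); rewrite mxE normr1.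
Qed.

Let dilation_unit x (a b : R) : 0 <= a <= b -> `|dilation a x| <= 1 <= `|dilation b x| ->
  exists2 c : R, a <= c <= b & `|dilation c x| = 1.
Proof.
move=> /andP[a0 ab] /andP[h1 h2].
have cf : continuous (fun c : R => `|dilation c x|).
  move=> c; apply: (@continuous_comp _ _ _ (fun c : R => dilation c x : 'rV[R]_n) (fun z : 'rV[R]_n => `|z|)).
    apply: continuous_rVP => j; rewrite (_ : (fun c : R => _) = (fun c : R => c ^+ weight j * x 0 j)).
      by move=> u; apply: cvgMl; exact: exprn_continuous.
    by apply/funext => u; rewrite dilationE.
  exact: norm_continuous.
have [||c cab <-] := @IVT R (fun c => `|dilation c x|) a b 1 ab.
- exact: continuous_subspaceT.
- by rewrite ge_min le_max h1 h2 orbT.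
by exists c => //; move: cab; rewrite in_itv.
Qed.

Lemma dilation1 x : dilation 1 x = x.
Proof. by apply/rowP => j; rewrite dilationE expr1n mul1r. Qed.

(** m is the minimum of [N] on the unit sphere of the sup norm, and dilations carry the estimate
    elsewhere. For |x| <= 1 a dilation by some l >= 1 brings x to the sphere; since it enlarges
    every coordinate at least l times, |x| <= 1 / l, whereas N x >= m / l. *)
Lemma hnorm_lower : exists2 m : R, 0 < m &
  (forall x, N x < m -> `|x| <= 1) /\ (forall x, `|x| <= 1 -> m * `|x| <= N x).
Proof.
pose S := [set z : 'rV[R]_n | `|z| = 1].
have cS : compact S.
  apply: bounded_closed_compact.
    by exists 1; split; [exact: num_real|move=> M M1 x /= ->; exact: ltW].
  by apply: (@closed_comp _ _ (fun x : 'rV[R]_n => `|x|) [set t | t = 1]) => [x _|];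
    [exact: norm_continuous|exact: closed_eq].
have cN : {within S, continuous N} by apply: continuous_subspaceT; exact: hn_continuous hN.
have S0 : S !=set0 by have [z z1] := unit_vector; exists z.
have [c cS' Hc] := EVT_min_rV S0 cS cN.
have c1 : `|c| = 1 by move: cS'; rewrite inE.
have m0 : 0 < N c.
  rewrite lt0r (hn_ge0 _ _ _ _ _ hN) andbT; apply/eqP => /(hn_eq0 _ _ _ _ _ hN) c0.
  by move: c1; rewrite c0 normr0 => /esym/eqP; rewrite oner_eq0.
have Nge z : `|z| = 1 -> N c <= N z by move=> z1; apply: Hc; rewrite inE.
exists (N c) => //; split=> x.
  apply: contraTT; rewrite -ltNge -leNgt => x1.
  have [||l /andP[l0 l1] lx] := @dilation_unit x 0 1; first by rewrite lexx/=.
    rewrite dilation1 (ltW x1) andbT.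
    apply/rV_norm_leP => // j; rewrite dilationE expr0n/= mul0r normr0//.
  have lpos : 0 < l.
    rewrite lt0r l0 andbT; apply/eqP => l00; move: lx; rewrite l00 => H.
    have : `|dilation 0 x| <= 0 by apply/rV_norm_leP => // j; rewrite dilationE expr0n/= mul0r normr0.
    by rewrite H ler10.
  have := Nge _ lx; rewrite (hn_dilation _ _ _ _ _ hN)// => /le_trans; apply.
  by rewrite ler_piMl// (hn_ge0 _ _ _ _ _ hN).
move=> x1; have [->|x0] := eqVneq x 0; first by rewrite normr0 mulr0 hnorm0.
have nx0 : 0 < `|x| by rewrite normr_gt0.
have V1 : 1 <= `|x|^-1 by rewrite invf_ge1.
have [||l /andP[l1 l2] lx] := @dilation_unit x 1 `|x|^-1; first by rewrite ler01.
  rewrite dilation1 x1/=; apply: le_trans (dilation_norm_ge x V1).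
  by rewrite mulVf ?gt_eqF.
have l0 : 0 < l by exact: lt_le_trans l1.
have := dilation_norm_ge x l1; rewrite lx -ler_pdivlMl// mulr1 => xl.
have := Nge _ lx; rewrite (hn_dilation _ _ _ _ _ hN)// => H.
apply: le_trans (ler_wpM2l (ltW m0) xl) _.
by rewrite ler_pdivrMr// mulrC.
Qed.

Definition box (c a : 'I_n -> R) : set T := [set x | forall i, c i - a i <= x 0 i <= c i + a i].

Lemma measurable_box (c a : 'I_n -> R) : measurable (box c a).
Proof.
rewrite (_ : box c a = \bigcap_i [set x : T | [set` `[c i - a i, c i + a i]] (x 0 i)]); last first.
  apply/seteqP; split=> x /= xA i; last by have := xA i I; rewrite /= in_itv.
  by move=> _ /=; rewrite in_itv; exact: xA.
apply: fin_bigcap_measurable => // i _; rewrite -[X in measurable X]setTI.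
exact: (@measurable_rV_coord R n i measurableT _ (measurable_itv _)).
Qed.

Lemma lebesgue_box (c a : 'I_n -> R) : (forall i, 0 <= a i) -> mu (box c a) = (\prod_i (2 * a i))%:E.
Proof.
move=> a0; have := @lebesgue_rV_box R n (\row_i (c i - a i)) (\row_i (c i + a i)).
rewrite (_ : (fun x : 'rV[R]_n => [set x0 : 'rV[R]_n | _] x) = box c a); last first.
  by apply/seteqP; split => x H i; have := H i; rewrite !mxE.
move=> ->; last by move=> i; rewrite !mxE; have := a0 i; lra.
by congr EFin; apply: eq_bigr => i _; rewrite !mxE; ring.
Qed.

Lemma bounded_lebesgue_lty (A : set T) (rho : R) : measurable A ->
  (forall x, A x -> `|x| <= rho) -> (mu A < +oo)%E.
Proof.
move=> mA Ar; apply: (@le_lt_trans _ _ (mu (box (fun=> 0) (fun=> Num.max 0 rho)))).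
  apply: le_measure; rewrite ?inE//; first exact: measurable_box.
  move=> x /Ar xr i; rewrite sub0r add0r -ler_norml.
  by rewrite (le_trans (rV_coord_le x i))// (le_trans xr)// le_max lexx orbT.
rewrite lebesgue_box ?ltry// => i.
by rewrite le_max lexx.
Qed.

Let hball0 (rho : R) := [set z : T | N z < rho].

Let measurable_hball0 rho : measurable (hball0 rho).
Proof.
rewrite (_ : hball0 rho = N @^-1` [set` `]-oo, rho[]); last first.
  by apply/seteqP; split => x /=; rewrite in_itv.
by apply: measurable_preimage; [exact: measurable_hnorm|exact: measurable_itv].
Qed.

Let prod_pow_weight (a rho : R) : \prod_(i < n) (a * rho ^+ weight i) = a ^+ n * rho ^+ Q.
Proof. by rewrite big_split/= prodr_const card_ord -sum_weight; congr (_ * _); rewrite expr_sum. Qed.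

(** The dilation of ratio rho maps a fixed box inside the unit ball into the ball of radius rho, and
    multiplies its volume by rho^Q because the weights add up to Q. *)
Let hball0_lower : exists2 c : R, 0 < c & forall rho, 0 < rho -> ((c * rho ^+ Q)%:E <= mu (hball0 rho))%E.
Proof.
have [e e0 He] : exists2 e : R, 0 < e & forall x, `|x| <= e -> N x < 1.
  have /cvgrPdist_lt/(_ 1 ltr01) := hn_continuous _ _ _ _ _ hN 0.
  rewrite hnorm0; move=> /nbhs_norm0P[e /= e0 H].
  exists (e / 2); first by rewrite divr_gt0.
  move=> x xe; have := H x; rewrite sub0r normrN ger0_norm; last exact: hn_ge0 hN _.
  apply => /=; apply: le_lt_trans xe _.
  by rewrite ltr_pdivrMr// mulr_natr mulr2n ltrDl.
exists ((2 * e) ^+ n); first by rewrite exprn_gt0// mulr_gt0.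
move=> rho rho0.
have <- : mu (box (fun=> 0) (fun i => e * rho ^+ weight i)) = ((2 * e) ^+ n * rho ^+ Q)%:E.
  rewrite lebesgue_box; last by move=> i; rewrite mulr_ge0 ?exprn_ge0 ?ltW.
  by under eq_bigr do rewrite mulrA; rewrite prod_pow_weight.
apply: le_measure; rewrite ?inE//; first exact: measurable_box.
move=> x xb; rewrite /hball0/=.
have := hn_dilation _ _ _ _ _ hN rho^-1 x; rewrite invr_gt0 => /(_ rho0) E.
have : N (dilation rho^-1 x) < 1.
  apply: He; apply/rV_norm_leP => [|j]; first exact: ltW.
  rewrite dilationE normrM exprVn ger0_norm ?invr_ge0 ?exprn_ge0 ?(ltW rho0)//.
  rewrite mulrC ler_pdivrMr ?exprn_gt0//.
  by rewrite ler_norml; have := xb j; rewrite sub0r add0r.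
by rewrite E ltr_pdivrMl// mulr1.
Qed.

(** Dilating by m / rho brings the ball inside the region N < m, which [hnorm_lower] encloses in the
    unit box. *)
Let hball0_upper : exists2 c : R, 0 < c & forall rho, 0 < rho -> (mu (hball0 rho) <= (c * rho ^+ Q)%:E)%E.
Proof.
have [m m0 [Hm _]] := hnorm_lower.
exists (2 ^+ n * (m^-1) ^+ Q); first by rewrite mulr_gt0 ?exprn_gt0 ?invr_gt0.
move=> rho rho0.
have <- : mu (box (fun=> 0) (fun i => (rho / m) ^+ weight i)) = (2 ^+ n * m^-1 ^+ Q * rho ^+ Q)%:E.
  rewrite lebesgue_box; last by move=> i; rewrite exprn_ge0// divr_ge0 ?ltW.
  by rewrite prod_pow_weight exprMn [rho ^+ Q * _]mulrC mulrA.
apply: le_measure; rewrite ?inE//; first exact: measurable_box.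
move=> x; rewrite /hball0/= => xr j.
have mr0 : 0 < m / rho by rewrite divr_gt0.
have /Hm : N (dilation (m / rho) x) < m.
  by rewrite (hn_dilation _ _ _ _ _ hN)// mulrAC ltr_pdivrMr// ltr_pM2l.
move=> /(le_trans (rV_coord_le _ j)); rewrite dilationE normrM.
rewrite ger0_norm ?exprn_ge0 ?(ltW mr0)// => H.
rewrite sub0r add0r -ler_norml -[rho / m]invf_div exprVn -(ler_pM2l (exprn_gt0 (weight j) mr0)).
by rewrite mulfV// gt_eqF// exprn_gt0.
Qed.

Definition hball x (rho : R) : set T := [set z | hdist z x < rho].

Lemma measurable_hball x rho : measurable (hball x rho).
Proof. exact: (measurable_preimage (@measurable_mull _ _ _ G (inv x)) (@measurable_hball0 rho)). Qed.

Let hballE x rho : mu (hball x rho) = mu (hball0 rho).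
Proof. exact: (@mul_preserving _ _ _ G (inv x) (hball0 rho)). Qed.

Lemma hball_lower : exists2 c : R, 0 < c &
  forall x rho, 0 < rho -> ((c * rho ^+ Q)%:E <= mu (hball x rho))%E.
Proof. by have [c c0 H] := hball0_lower; exists c => // x rho rho0; rewrite hballE H. Qed.

Lemma hball_upper : exists2 c : R, 0 < c &
  forall x rho, 0 < rho -> (mu (hball x rho) <= (c * rho ^+ Q)%:E)%E.
Proof. by have [c c0 H] := hball0_upper; exists c => // x rho rho0; rewrite hballE H. Qed.

End homogeneous_distance.

(** * Dyadic scales, geometric series and monotonicity of real powers *)

Lemma dyadic_bracket (R : realType) (t : R) : 0 < t <= 1 ->
  exists k : nat, 2^-1 ^+ k.+1 < t <= 2^-1 ^+ k.
Proof.
move=> /andP[t0 t1].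
have ex : exists k, 2^-1 ^+ k.+1 < t.
  have := near_infty_natSinv_expn_lt (PosNum t0) => -[k _ /(_ k.+1 (leqnSn k))/= H].
  by exists k; rewrite exprVn -div1r.
have [k kt kmin] := ex_minnP ex.
exists k; rewrite kt/=; case: k kt kmin => [|k] kt kmin; first by rewrite expr0.
by rewrite leNgt; apply/negP => /kmin; rewrite ltnn.
Qed.

Lemma powRV (R : realType) (t e : R) : 0 <= t -> t^-1 `^ e = (t `^ e)^-1.
Proof. by move=> t0; rewrite -powR_inv1// -powRrM mulN1r powRN. Qed.

Lemma nneseries_geometric_lty (R : realType) (c q : R) : 0 <= c -> 0 <= q < 1 ->
  (\sum_(0 <= k <oo) (c * q ^+ k)%:E < +oo)%E.
Proof.
move=> c0 /andP[q0 q1].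
apply: (@le_lt_trans _ _ (c / (1 - q))%:E); last exact: ltry.
apply: lime_le; first by apply: is_cvg_nneseries => k _ _; rewrite lee_fin mulr_ge0 ?exprn_ge0.
apply: nearW => k; rewrite sumEFin lee_fin -mulr_sumr ler_wpM2l//.
rewrite -[leRHS]mul1r ler_pdivlMr ?subr_gt0// big_mkord mulrC.
have -> : (1 - q) * (\sum_(i < k) q ^+ i) = 1 - q ^+ k.
  by rewrite -opprB mulNr -subrX1 opprB.
by rewrite gerBl exprn_ge0.
Qed.

Lemma ler_powR_base (R : realType) (q a b : R) : 0 <= q -> 0 <= a -> a <= b -> a `^ q <= b `^ q.
Proof.
by move=> q0 a0 ab; apply: ge0_ler_powR => //; rewrite nnegrE// (le_trans a0).
Qed.

Lemma ler_powR_inv (R : realType) (q a b : R) : 0 < q -> 0 <= b -> a `^ q <= b `^ q -> a <= b.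
Proof.
move=> q0 b0; rewrite !leNgt; apply: contra => ba.
by apply: gt0_ltr_powR => //; rewrite nnegrE// (le_trans b0)// ltW.
Qed.

Lemma ge0_integral_cstM d (X : measurableType d) (R : realType) (mu : {measure set X -> \bar R})
    (c : R) (f : X -> R) : measurable_fun setT f -> 0 <= c -> (forall x, 0 <= f x) ->
  (\int[mu]_x (c * f x)%:E = c%:E * \int[mu]_x (f x)%:E)%E.
Proof.
move=> mf c0 f0; under eq_integral do rewrite EFinM.
by rewrite ge0_integralZl_EFin//; [move=> x _; rewrite lee_fin|exact/measurable_EFinP].
Qed.

(** * The Gagliardo seminorm as an L^p norm on the product space *)

Section fractional_seminorm.
Context {R : realType} {r : nat} {d : 'I_r.+1 -> nat}.
Local Notation n := (\sum_i d i)%N.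
Local Notation T := (stratified_space R d).
Local Notation mu := (lebesgue_rV R n).
Variables (G : stratified_group R d) (N : T -> R) (hN : homogeneous_norm G N).
Local Notation mul := (sg_mul G).
Local Notation inv := (sg_inv G).
Local Notation Q := (homogeneous_dim d).
Local Notation hd := (hdist G N).
Variables (s p : R).
Hypotheses (s0 : 0 < s) (s1 : s < 1) (p1 : 1 < p) (sp : Q%:R < s * p).
Implicit Types (x y z : T) (u v w : T -> R).

Let p0 : 0 < p. Proof. exact: lt_trans p1. Qed.
Let a : R := Q%:R + s * p.
Let a0 : 0 < a. Proof. by rewrite ltr_wpDl// mulr_gt0. Qed.
Let aN0 : a != 0. Proof. by rewrite gt_eqF. Qed.

Local Notation kern := (frac_kernel G N s p).

Lemma kernE x y : kern x y = (hd x y `^ a)^-1. Proof. by []. Qed.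

Lemma kern_ge0 x y : 0 <= kern x y. Proof. by rewrite invr_ge0 powR_ge0. Qed.

Lemma kernC x y : kern x y = kern y x.
Proof. by rewrite !kernE (hdistC hN). Qed.

Lemma measurable_kern : measurable_fun setT (fun z : T * T => kern z.2 z.1).
Proof.
have H : measurable_fun setT (fun z : T * T => hd z.1 z.2 `^ (- a)).
  apply: (@measurableT_comp _ _ _ _ _ _ (fun t : R => t `^ (- a))).
    exact: measurable_powR.
  exact: (measurable_hdist hN).
by rewrite (_ : (fun z : T * T => _) = (fun z : T * T => hd z.1 z.2 `^ (- a)))//;
  apply/funext => z; rewrite kernC kernE powRN.
Qed.

(** The map u |-> [gdiff u] is linear and carries the seminorm to the L^p norm of the product
    measure, so everything about [energy] and [pairing] applies to it. In z = (y, x) the inner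
    variable x of [X0_norm] comes second. *)
Definition gdiff u (z : T * T) : R := (u z.2 - u z.1) * kern z.2 z.1 `^ p^-1.

Lemma gdiff_powR u (z : T * T) : `|gdiff u z| `^ p = `|u z.2 - u z.1| `^ p * kern z.2 z.1.
Proof.
rewrite normrM powRM// (ger0_norm (powR_ge0 _ _)) -powRrM mulVf ?gt_eqF//.
by rewrite powRr1// kern_ge0.
Qed.

Lemma measurable_gdiff u : measurable_fun setT u -> measurable_fun setT (gdiff u).
Proof.
move=> mu_; apply: measurable_funM.
  apply: measurable_funB.
    exact: (measurableT_comp mu_ measurable_snd).
  exact: (measurableT_comp mu_ measurable_fst).
apply: (@measurableT_comp _ _ _ _ _ _ (fun t : R => t `^ p^-1)).
  exact: measurable_powR.
exact: measurable_kern.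
Qed.

Local Notation nu := (mu \x mu)%E.

Lemma X0_normE u : measurable_fun setT u ->
  X0_norm G N s p u = ((\int[nu]_z (`|gdiff u z| `^ p)%:E) `^ p^-1)%E.
Proof.
move=> mu_; rewrite /X0_norm fubini_tonelli1.
- rewrite (_ : (\int[mu]_y \int[mu]_x _ = \int[mu]_y fubini_F mu (fun z : T * T => (`|gdiff u z| `^ p)%:E) y)%E)//.
  by apply: eq_integral => y _; apply: eq_integral => x _; rewrite gdiff_powR.
- by apply/measurable_EFinP/measurable_norm_powR; exact: measurable_gdiff.
- by move=> z; rewrite lee_fin powR_ge0.
Qed.

Definition gagliardo u := measurable_fun setT u /\ inLp nu p (gdiff u).

Definition gagliardo_norm u := pnorm nu p (gdiff u).
Local Notation gnorm := gagliardo_norm.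

Lemma X0_norm_gagliardo u : gagliardo u -> X0_norm G N s p u = (gagliardo_norm u)%:E.
Proof. by move=> [mu_ Lu]; rewrite X0_normE// energyE. Qed.

Lemma X0_norm_lty u : measurable_fun setT u -> (X0_norm G N s p u < +oo)%E -> gagliardo u.
Proof.
move=> mu_; rewrite X0_normE// => H; split=> //; apply: inLp_lty => //.
  exact: measurable_gdiff.
by apply: lty_poweRy H; rewrite invr_neq0 ?gt_eqF.
Qed.

Lemma gdiffD u v : gdiff (fun x => u x + v x) = (fun z : T * T => gdiff u z + gdiff v z).
Proof. by apply/funext => z; rewrite /gdiff; ring. Qed.

Lemma gdiffZ (c : R) u : gdiff (fun x => c * u x) = (fun z : T * T => c * gdiff u z).
Proof. by apply/funext => z; rewrite /gdiff; ring. Qed.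

Lemma gdiffB u v : gdiff (fun x => u x - v x) = (fun z : T * T => gdiff u z - gdiff v z).
Proof. by apply/funext => z; rewrite /gdiff; ring. Qed.

Lemma gagliardoD u v : gagliardo u -> gagliardo v -> gagliardo (fun x => u x + v x).
Proof. by move=> [? ?] [? ?]; split; [exact: measurable_funD|rewrite gdiffD; exact: inLpD]. Qed.

Lemma gagliardoZ c u : gagliardo u -> gagliardo (fun x => c * u x).
Proof. by move=> [? ?]; split; [exact: measurable_funM|rewrite gdiffZ; exact: inLpZ]. Qed.

Lemma gagliardoB u v : gagliardo u -> gagliardo v -> gagliardo (fun x => u x - v x).
Proof. by move=> [? ?] [? ?]; split; [exact: measurable_funB|rewrite gdiffB; exact: inLpB]. Qed.

Lemma gnorm_ge0 u : 0 <= gnorm u. Proof. exact: pnorm_ge0. Qed.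

Lemma gnorm_powR u : gnorm u `^ p = energy nu p (gdiff u). Proof. exact: pnormK. Qed.

Lemma gnormZ c u : gagliardo u -> gnorm (fun x => c * u x) = `|c| * gnorm u.
Proof. by move=> [_ Lu]; rewrite /gagliardo_norm gdiffZ pnormZ. Qed.

Lemma gnormD u v : gagliardo u -> gagliardo v ->
  gnorm (fun x => u x + v x) <= gnorm u + gnorm v.
Proof. by move=> [_ Lu] [_ Lv]; rewrite /gagliardo_norm gdiffD pnormD. Qed.

Lemma gnormB_sym u v : gnorm (fun x => u x - v x) = gnorm (fun x => v x - u x).
Proof. by rewrite /gagliardo_norm !gdiffB pnormB_sym. Qed.

Lemma gnormB_le u v : gagliardo u -> gagliardo v ->
  gnorm u <= gnorm v + gnorm (fun x => u x - v x).
Proof.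
move=> Lu Lv; have := gnormD Lv (gagliardoB Lu Lv).
by rewrite (_ : (fun x => v x + (u x - v x)) = u)//; apply/funext => x; rewrite addrC subrK.
Qed.

Lemma gdiff_contraction u v (z : T * T) : (forall x y, `|v x - v y| <= `|u x - u y|) ->
  `|gdiff v z| <= `|gdiff u z|.
Proof. by move=> vu; rewrite !normrM ler_wpM2r. Qed.

Lemma gagliardo_contraction u v : gagliardo u -> measurable_fun setT v ->
  (forall x y, `|v x - v y| <= `|u x - u y|) -> gagliardo v /\ gnorm v <= gnorm u.
Proof.
move=> [_ Lu] mv vu.
have Lv : inLp nu p (gdiff v).
  apply: (inLp_le (c := 1) (measurable_gdiff mv) Lu) => z.
  by rewrite mul1r ge0_ler_powR ?nnegrE ?(ltW p0)// gdiff_contraction.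
split; first exact: (conj mv Lv).
apply: ler_powR_base; [by rewrite invr_ge0 ltW|exact: energy_ge0|].
by apply: energy_le => // z; exact: gdiff_contraction.
Qed.

(** If |u x - u y| <= L min(d(x, y), 1), the integrand of the seminorm is at most L^p times this
    function at y^-1 x. *)
Definition trunc_kernel z : R := Num.min (N z) 1 `^ p * (N z `^ a)^-1.

Lemma measurable_trunc_kernel : measurable_fun setT trunc_kernel.
Proof.
rewrite (_ : trunc_kernel = (fun z => Num.min (N z) 1 `^ p * N z `^ (- a))); last first.
  by apply/funext => z; rewrite powRN.
have mN := measurable_hnorm hN.
apply: measurable_funM.
  apply: (@measurableT_comp _ _ _ _ _ _ (fun t : R => t `^ p)).
    exact: measurable_powR.
  exact: measurable_minr.
by apply: (@measurableT_comp _ _ _ _ _ _ (fun t : R => t `^ (- a))); first exact: measurable_powR.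
Qed.

Lemma trunc_kernel_ge0 z : 0 <= trunc_kernel z.
Proof. by rewrite mulr_ge0 ?powR_ge0// invr_ge0 powR_ge0. Qed.

(** * Integrability of the truncated kernel *)

Section kernel_integral.

Let hdistx0 z : hd z 0 = N z.
Proof. by rewrite /hdist -[in LHS](sg_mul0g _ _ _ G z) sg_mulKg. Qed.

Let b k : R := 2^-1 ^+ k.

Let b_gt0 k : 0 < b k. Proof. by rewrite exprn_gt0// invr_gt0. Qed.

Let b_powR k (t : R) : b k `^ t = (2^-1 `^ t) ^+ k.
Proof.
by rewrite /b -powR_mulrn ?invr_ge0// -powRrM mulrC powRrM powR_mulrn// powR_ge0.
Qed.

Let theta : R := p - s * p.
Let theta0 : 0 < theta. Proof. by rewrite subr_gt0 gtr_pMl. Qed.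
Let sp0 : 0 < s * p. Proof. by rewrite mulr_gt0. Qed.

(** [A k] bounds the truncated kernel on the shell where [N] lies between 2^-(k+1) and 2^-k, and
    [B k] does so where 1 / N lies there. *)
Let A k : R := b k `^ theta * b k.+1 ^- Q.
Let B k : R := b k `^ (s * p) * b k ^+ Q.
Let A_ge0 k : 0 <= A k.
Proof. by rewrite mulr_ge0 ?powR_ge0// invr_ge0 exprn_ge0// ltW. Qed.
Let B_ge0 k : 0 <= B k.
Proof. by rewrite mulr_ge0 ?powR_ge0// exprn_ge0// ltW. Qed.

Let hb (rho : R) := hball G N 0 rho.

(** Shells are replaced by balls containing them. The radius is 2 * b k because [hball] is open
    while the shell includes N z = b k. *)
Let fk k z : \bar R := ((A k)%:E * (\1_(hb (2 * b k)) z)%:E + (B k)%:E * (\1_(hb (b k.+1)^-1) z)%:E)%E.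

Let fk_ge0 k z : (0 <= fk k z)%E.
Proof. by rewrite adde_ge0// mule_ge0// lee_fin. Qed.

Let measurable_hb rho : measurable (hb rho). Proof. exact: measurable_hball. Qed.

Let measurable_fk k : measurable_fun setT (fk k).
Proof.
by apply: emeasurable_funD; apply: measurable_funeM; apply/measurable_EFinP; exact: measurable_indic.
Qed.

Let kap_le z : ((trunc_kernel z)%:E <= \sum_(0 <= k <oo) fk k z)%E.
Proof.
suff [->|[k Hk]] : trunc_kernel z = 0 \/ exists k, ((trunc_kernel z)%:E <= fk k z)%E.
- by apply: nneseries_ge0 => k _ _; exact: fk_ge0.
- apply: le_trans Hk _; apply: (@le_trans _ _ (\sum_(0 <= i < k.+1) fk i z)%E).
    by rewrite big_nat_recr//= leeDr// sume_ge0.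
  by apply: nneseries_lim_ge => i _ _; exact: fk_ge0.
have := hn_ge0 _ _ _ _ _ hN z; rewrite le_eqVlt => /predU1P[Nz0|Nz0].
  by left; rewrite /trunc_kernel -Nz0 powR0// invr0 mulr0.
have NzN0 : N z != 0 by rewrite gt_eqF.
have aE (t : R) : t != 0 -> t `^ a = t `^ (s * p) * t `^ Q%:R.
  by move=> t0; rewrite /a [_ + s * p]addrC powRD// t0 implybT.
right; have [Nz1|Nz1] := leP (N z) 1.
  have [k /andP[k1 k2]] := dyadic_bracket (introT andP (conj Nz0 Nz1)).
  exists k; apply: (@le_trans _ _ ((A k)%:E * (\1_(hb (2 * b k)) z)%:E)%E); last first.
    by rewrite leeDl// mule_ge0// lee_fin.
  rewrite indicE mem_set; last first.
    by rewrite /hb/hball/= hdistx0 (le_lt_trans k2)// mulr_natl mulr2n ltrDl.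
  rewrite -EFinM mulr1 lee_fin /trunc_kernel min_l//.
  have -> : N z `^ p * (N z `^ a)^-1 = N z `^ theta * (N z ^+ Q)^-1.
    have -> : N z `^ p = N z `^ theta * N z `^ (s * p).
      by rewrite -powRD ?NzN0 ?implybT// /theta subrK.
    rewrite aE// powR_mulrn ?ltW//; field.
    by rewrite expf_neq0// gt_eqF// powR_gt0.
  apply: ler_pM; rewrite ?powR_ge0 ?invr_ge0 ?exprn_ge0 ?(ltW Nz0)//.
    by rewrite ge0_ler_powR ?nnegrE ?(ltW theta0) ?(ltW Nz0) ?(ltW (b_gt0 k)).
  rewrite lef_pV2 ?posrE ?exprn_gt0// lerXn2r ?nnegrE ?(ltW k1) ?(ltW Nz0) ?(ltW (b_gt0 k.+1))//.
have Nz01 : 0 < (N z)^-1 <= 1 by rewrite invr_gt0 Nz0 invf_le1// ltW.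
have [k /andP[k1 k2]] := dyadic_bracket Nz01.
exists k; apply: (@le_trans _ _ ((B k)%:E * (\1_(hb (b k.+1)^-1) z)%:E)%E); last first.
  by rewrite leeDr// mule_ge0// lee_fin.
rewrite indicE mem_set; last first.
  by rewrite /hb/hball/= hdistx0 -[N z]invrK ltf_pV2 ?posrE ?invr_gt0.
rewrite -EFinM mulr1 lee_fin /trunc_kernel min_r ?(ltW Nz1)// powR1 mul1r.
have -> : (N z `^ a)^-1 = (N z)^-1 `^ (s * p) * (N z)^-1 ^+ Q.
  by rewrite aE// invfM powRV ?(ltW Nz0)// exprVn powR_mulrn ?(ltW Nz0).
have NV0 : 0 <= (N z)^-1 by rewrite invr_ge0 ltW.
apply: ler_pM; rewrite ?powR_ge0 ?exprn_ge0//.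
  by rewrite ge0_ler_powR ?nnegrE ?(ltW sp0) ?(ltW (b_gt0 k)).
by rewrite lerXn2r ?nnegrE ?(ltW (b_gt0 k)).
Qed.

(** The kernel is N^(p - sp - Q) near the origin and N^(- Q - sp) at infinity. As balls have volume
    of order rho^Q, the dyadic sums are geometric of ratios 2^-(p - sp) and 2^-(sp), both less than
    1 because 0 < s < 1. *)
Lemma integral_trunc_kernel_lty : (\int[mu]_z (trunc_kernel z)%:E < +oo)%E.
Proof.
have [C C0 HC] := hball_upper hN.
apply: (@le_lt_trans _ _ (\int[mu]_z \sum_(0 <= k <oo) fk k z)%E).
  apply: ge0_le_integral => //.
  - by move=> z _; rewrite lee_fin; exact: trunc_kernel_ge0.
  - by apply/measurable_EFinP; exact: measurable_trunc_kernel.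
  - by apply: ge0_emeasurable_sum.
rewrite (@integral_nneseries _ _ _ mu setT measurableT fk)//.
pose q : R := Num.max (2^-1 `^ theta) (2^-1 `^ (s * p)).
have qlt t : 0 < t -> 2^-1 `^ t < 1 :> R.
  move=> t0; rewrite [ltRHS](_ : 1 = 1 `^ t :> R); last by rewrite powR1.
  by rewrite gt0_ltr_powR ?nnegrE// invf_lt1// ltr1n.
have q1 : 0 <= q < 1 by rewrite le_max powR_ge0/= gt_max !qlt.
pose c := C * 4 ^+ Q + C * 2 ^+ Q.
have c0 : 0 <= c by rewrite addr_ge0// mulr_ge0// ltW.
apply: le_lt_trans (nneseries_geometric_lty c0 q1).
apply: lee_nneseries => [k _ _|k _]; first by apply: integral_ge0 => z _; exact: fk_ge0.
rewrite ge0_integralD//; last 4 first.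
- by move=> z _; rewrite mule_ge0// lee_fin.
- by apply: measurable_funeM; apply/measurable_EFinP; exact: measurable_indic.
- by move=> z _; rewrite mule_ge0// lee_fin.
- by apply: measurable_funeM; apply/measurable_EFinP; exact: measurable_indic.
rewrite !ge0_integralZl_EFin//; [|exact/measurable_EFinP/measurable_indic|exact/measurable_EFinP/measurable_indic].
rewrite !integral_indic// !setIT.
have bb : 0 < 2 * b k by rewrite mulr_gt0.
have bbV : 0 < (b k.+1)^-1 by rewrite invr_gt0.
apply: (@le_trans _ _ ((A k)%:E * (C * (2 * b k) ^+ Q)%:E + (B k)%:E * (C * (b k.+1)^-1 ^+ Q)%:E)%E).
  by apply: leeD; apply: lee_wpmul2l; rewrite ?lee_fin//; exact: HC.
have bS : b k.+1 = b k / 2 by rewrite /b exprS mulrC.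
have bk0 : b k != 0 by rewrite gt_eqF.
have E1 : A k * (C * (2 * b k) ^+ Q) = C * 4 ^+ Q * b k `^ theta.
  rewrite /A -exprVn bS invf_div [LHS](_ : _ = C * ((2 / b k) ^+ Q * (2 * b k) ^+ Q) * b k `^ theta); last by ring.
  by rewrite -exprMn (_ : 2 / b k * (2 * b k) = 4)//; field.
have E2 : B k * (C * (b k.+1)^-1 ^+ Q) = C * 2 ^+ Q * b k `^ (s * p).
  rewrite /B bS invf_div [LHS](_ : _ = C * (b k ^+ Q * (2 / b k) ^+ Q) * b k `^ (s * p)); last by ring.
  by rewrite -exprMn (_ : b k * (2 / b k) = 2)//; field.
rewrite -!EFinM -EFinD lee_fin E1 E2 !b_powR /c mulrDl.
have qk t : 2^-1 `^ t <= q -> (2^-1 `^ t) ^+ k <= q ^+ k.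
  by move=> tq; apply: lerXn2r; rewrite ?nnegrE ?powR_ge0// le_max powR_ge0.
by rewrite lerD// ler_wpM2l ?mulr_ge0 ?exprn_ge0 ?(ltW C0)// qk// le_max lexx ?orbT.
Qed.

End kernel_integral.

(** * Finite energy of smooth functions with bounded support *)

Lemma smooth_locally_lipschitz (phi : 'rV[R]_n -> R) (rho : R) : smooth phi -> 0 <= rho ->
  exists2 L : R, 0 <= L & forall x y, `|x| <= rho -> `|y| <= rho ->
    `|phi x - phi y| <= L * `|x - y|.
Proof.
move=> sphi rho0; have [_ H] := sphi 1%N.
pose e (j : 'I_n) : 'rV[R]_n := delta_mx 0 j.
have cD j : continuous ('D_(e j) phi) by have [_ []] := H (e j).
pose C j := projT1 (cid2 (bounded_on_ball (@cD j) rho0)).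
have C0 j : 0 <= C j by rewrite /C; case: cid2.
have CP j x : `|x| <= rho -> `|'D_(e j) phi x| <= \sum_j C j.
  move=> xr; apply: (@le_trans _ _ (C j)).
    by rewrite /C; case: cid2 => c c0 /= /(_ x xr).
  by rewrite (bigD1 j)//= lerDl sumr_ge0.
exists (n%:R * \sum_j C j); first by rewrite mulr_ge0// sumr_ge0.
move=> x y xr yr; apply: (@lipschitz_partials R n phi _ rho) => //.
- exact: sumr_ge0.
- by move=> z j; have [H1 _] := H (e j); exact: H1.
- by move=> z j zr; exact: CP.
Qed.

(** With x = y z and N z small, |x - y| <= L2 |z| by [mul_lipschitz] and |z| <= N z / m by
    [hnorm_lower]. When N z is not small the bound on phi suffices. *)
Lemma smooth_hdist_lipschitz (phi : T -> R) (rho : R) : smooth phi ->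
  (forall x, phi x != 0 -> `|x| <= rho) ->
  exists2 L : R, 0 <= L & forall x y, `|phi x - phi y| <= L * Num.min (hd x y) 1.
Proof.
move=> sphi supp0.
wlog rho1 : rho supp0 / 1 <= rho.
  move=> H; apply: (H (Num.max 1 rho)); last by rewrite le_max lexx.
  by move=> x /supp0 xr; rewrite le_max xr orbT.
have rho0 : 0 <= rho by exact: le_trans rho1.
have [m m0 [Nm mN]] := hnorm_lower hN.
have [L2 L20 HL2] := mul_lipschitz G rho0.
have [L1 L10 HL1] := @smooth_locally_lipschitz phi (rho + L2) sphi (addr_ge0 rho0 L20).
have [A A0 HA] := @bounded_on_ball R n phi rho (sphi 0%N).1 rho0.
have phiA x : `|phi x| <= A.
  have [->|/supp0 xr] := eqVneq (phi x) 0; first by rewrite normr0.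
  exact: HA.
pose m' := Num.min m 1.
have m'0 : 0 < m' by rewrite lt_min m0/=.
pose L := L1 * L2 / m + (A + A) / m'.
have La : 0 <= L1 * L2 / m by rewrite divr_ge0 ?mulr_ge0// ltW.
have Lb : 0 <= (A + A) / m' by rewrite divr_ge0 ?addr_ge0// ltW.
have key y z : phi y != 0 -> `|phi (mul y z) - phi y| <= L * Num.min (N z) 1.
  move=> /supp0 yr; have [Nz|Nz] := ltP (N z) m'.
    have Nzm : N z < m by apply: lt_le_trans Nz _; rewrite ge_min lexx.
    have Nz1 : N z <= 1 by apply: ltW; apply: lt_le_trans Nz _; rewrite ge_min lexx orbT.
    have z1 := Nm _ Nzm; have zr := le_trans z1 rho1.
    rewrite min_l//.
    have D := HL2 y z yr zr.
    have Lz : L2 * `|z| <= L2 by rewrite ler_piMr.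
    apply: (@le_trans _ _ (L1 * `|mul y z - y|)).
      apply: HL1; last by rewrite (le_trans yr)// lerDl.
      rewrite -[mul y z](subrK y) addrC (le_trans (ler_normD _ _))// lerD//.
      exact: le_trans D Lz.
    apply: (@le_trans _ _ (L1 * L2 / m * N z)); last first.
      by rewrite ler_wpM2r ?lerDl// (hn_ge0 _ _ _ _ _ hN).
    rewrite -!mulrA ler_wpM2l// (le_trans D)// ler_wpM2l//.
    by rewrite ler_pdivlMl// mN.
  apply: (@le_trans _ _ ((A + A) / m' * Num.min (N z) 1)).
    apply: (@le_trans _ _ ((A + A) / m' * m')).
      by rewrite divfK ?gt_eqF// (le_trans (ler_normB _ _))// lerD.
    by rewrite ler_wpM2l// le_min Nz ge_min lexx orbT.
  by rewrite ler_wpM2r ?lerDr// le_min ler01 (hn_ge0 _ _ _ _ _ hN).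
have L0 : 0 <= L by rewrite addr_ge0.
(* The estimate needs a base point in the support; by symmetry of the distance either point may be
   taken. *)
exists L => // x y.
have [py|py] := eqVneq (phi y) 0; last first.
  by have := key y (mul (inv y) x) py; rewrite sg_mulKVg.
have [px|px] := eqVneq (phi x) 0; last first.
  by have := key x (mul (inv x) y) px; rewrite sg_mulKVg distrC (hdistC hN).
by rewrite px py subrr normr0 mulr_ge0// le_min ler01 (hdist_ge0 hN).
Qed.

(** The integrand vanishes unless one of the two points lies in the bounded set [S]. With that point
    fixed, the other integral is that of [trunc_kernel], by left invariance, so the total is at most
    a multiple of the measure of [S]. *)
Lemma gagliardo_lipschitz (u : T -> R) (rho L : R) : continuous u ->
  (forall x, u x != 0 -> `|x| <= rho) -> 0 <= L ->
  (forall x y, `|u x - u y| <= L * Num.min (hd x y) 1) -> gagliardo u.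
Proof.
move=> cu supp0 L0 uL; have mu_ := @continuous_measurable_rV R n u cu.
split=> //; apply: inLp_lty; first exact: measurable_gdiff.
pose S := [set x : T | u x != 0].
have mS : measurable S.
  rewrite (_ : S = u @^-1` (~` [set 0])).
    by apply: measurable_preimage => //; exact: measurableC.
  by apply/seteqP; split => x /=; [move=> /eqP|move=> /eqP].
have muS : (mu S < +oo)%E.
  by apply: (bounded_lebesgue_lty mS (rho := rho)) => x /supp0.
pose kk (z : T * T) : R := trunc_kernel (mul (inv z.1) z.2).
have mkk : measurable_fun setT kk.
  have E : kk = (fun z : T * T => Num.min (hd z.2 z.1) 1 `^ p * kern z.2 z.1) by [].
  rewrite E; apply: measurable_funM; last exact: measurable_kern.
  apply: (@measurableT_comp _ _ _ _ _ _ (fun t : R => t `^ p)).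
    exact: measurable_powR.
  apply: measurable_minr => //.
  have -> : (fun z : T * T => hd z.2 z.1) = (fun z : T * T => hd z.1 z.2).
    by apply/funext => z; rewrite (hdistC hN).
  exact: (measurable_hdist hN).
have kkC x y : kk (x, y) = kk (y, x).
  by rewrite /kk /trunc_kernel/= -/(hdist G N x y) -/(hdist G N y x) (hdistC hN).
have kk0 (z : T * T) : 0 <= kk z by exact: trunc_kernel_ge0.
have kkB (z : T * T) : `|u z.2 - u z.1| `^ p * kern z.2 z.1 <= L `^ p * kk z.
  rewrite /kk /trunc_kernel mulrA ler_wpM2r ?invr_ge0 ?powR_ge0//.
  have m0 : 0 <= Num.min (hd z.2 z.1) 1 by rewrite le_min ler01 (hdist_ge0 hN).
  by rewrite -powRM// ge0_ler_powR ?nnegrE ?(ltW p0) ?mulr_ge0// uL.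
pose I := (\int[mu]_z (trunc_kernel z)%:E)%E.
have I0 : (0 <= I)%E by apply: integral_ge0 => z _; rewrite lee_fin trunc_kernel_ge0.
have Ioo : (I < +oo)%E by apply: integral_trunc_kernel_lty.
have kkI y : (\int[mu]_x (kk (y, x))%:E = I)%E.
  have mkap : measurable_fun setT (fun z : T => (trunc_kernel z)%:E).
    by apply/measurable_EFinP; exact: measurable_trunc_kernel.
  have kap0 (z : T) : (0 <= (trunc_kernel z)%:E)%E by rewrite lee_fin trunc_kernel_ge0.
  exact: (@ge0_integral_preserving _ T R mu (mul (inv y)) (@measurable_mull _ _ _ G (inv y)) (@mul_preserving _ _ _ G (inv y)) (fun z : T => (trunc_kernel z)%:E) mkap kap0).
clearbody kk I.
pose F1 (z : T * T) : \bar R := (\1_S z.1 * kk z)%:E.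
pose F2 (z : T * T) : \bar R := (\1_S z.2 * kk z)%:E.
have mF1 : measurable_fun setT F1.
  apply/measurable_EFinP/measurable_funM => //.
  exact: (measurableT_comp (measurable_indic mS) measurable_fst).
have mF2 : measurable_fun setT F2.
  apply/measurable_EFinP/measurable_funM => //.
  exact: (measurableT_comp (measurable_indic mS) measurable_snd).
have F10 (z : T * T) : (0 <= F1 z)%E by rewrite lee_fin mulr_ge0.
have F20 (z : T * T) : (0 <= F2 z)%E by rewrite lee_fin mulr_ge0.
have inner y : (\int[mu]_x (\1_S y * kk (y, x))%:E = (\1_S y)%:E * I)%E.
  rewrite -(kkI y); apply: ge0_integral_cstM => //.
  by apply: (measurableT_comp mkk); exact: measurable_pair1.
have outer : (\int[mu]_y ((\1_S y)%:E * I) = mu S * I)%E.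
  rewrite ge0_integralZr//; last exact/measurable_EFinP/measurable_indic.
  by rewrite integral_indic// setIT.
have IF1 : (\int[nu]_z F1 z = mu S * I)%E.
  rewrite fubini_tonelli1// -outer; apply: eq_integral => y _; exact: inner.
have IF2 : (\int[nu]_z F2 z = mu S * I)%E.
  rewrite fubini_tonelli2// -outer; apply: eq_integral => x _; rewrite -inner.
  by apply: eq_integral => y _; rewrite kkC.
apply: (@le_lt_trans _ _ (\int[nu]_z ((L `^ p)%:E * (F1 z + F2 z)))%E).
  apply: ge0_le_integral => //.
  - by apply/measurable_EFinP/measurable_norm_powR; exact: measurable_gdiff.
  - by apply: measurable_funeM; exact: emeasurable_funD.
  - move=> z _; rewrite gdiff_powR// /F1 /F2 -EFinD -EFinM lee_fin -mulrDl.
    have [z2|z2] := eqVneq (u z.2) 0.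
      have [z1|z1] := eqVneq (u z.1) 0.
        rewrite z1 z2 subrr normr0 powR0 ?gt_eqF// mul0r.
        by rewrite mulr_ge0 ?powR_ge0// mulr_ge0// addr_ge0.
      apply: le_trans (kkB z) _; rewrite ler_wpM2l ?powR_ge0// ler_peMl//.
      by rewrite !indicE (mem_set (z1 : S z.1)) lerDl.
    apply: le_trans (kkB z) _; rewrite ler_wpM2l ?powR_ge0// ler_peMl//.
    by rewrite !indicE (mem_set (z2 : S z.2)) lerDr.
rewrite ge0_integralZl_EFin ?powR_ge0//; last 2 first.
- by move=> z _; rewrite adde_ge0.
- exact: emeasurable_funD.
rewrite ge0_integralD// IF1 IF2.
by rewrite lte_mul_pinfty ?lee_fin ?powR_ge0// lte_add_pinfty// lte_mul_pinfty// ge0_fin_numE.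
Qed.

Lemma energy_ge_rectangle u (A B : set T) (k : R) : gagliardo u -> 0 <= k ->
  measurable A -> measurable B ->
  (forall y x, A y -> B x -> k <= `|u x - u y| `^ p * kern x y) ->
  (k%:E * (mu A * mu B) <= (gnorm u `^ p)%:E)%E.
Proof.
move=> [mu_ Lu] k0 mA mB H; rewrite /gagliardo_norm pnormK// -energyE//.
rewrite -(product_measure1E mu mu mA mB).
have mAB : measurable (A `*` B) by exact: measurableX.
have <- : (\int[nu]_z (k * \1_(A `*` B) z)%:E = k%:E * nu (A `*` B))%E.
  by rewrite ge0_integral_cstM// integral_indic// setIT.
apply: ge0_le_integral => //.
- by move=> z _; rewrite lee_fin mulr_ge0.
- by apply/measurable_EFinP/measurable_funM => //; exact: measurable_indic.
- by apply/measurable_EFinP/measurable_norm_powR; exact: Lu.1.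
- move=> [y x] _; rewrite lee_fin gdiff_powR//= indicE.
  have [/set_mem[/= Ay Bx]|_] := boolP ((y, x) \in A `*` B).
    by rewrite mulr1; exact: H.
  by rewrite mulr0 mulr_ge0 ?powR_ge0 ?kern_ge0.
Qed.

(** * Morrey embedding into Hölder functions *)

Definition holder_exponent : R := s - Q%:R / p.
Local Notation al := holder_exponent.

Lemma holder_exponent_gt0 : 0 < al.
Proof. by rewrite subr_gt0 ltr_pdivrMr. Qed.

Let al1 : al <= 1.
Proof. by rewrite lerBlDr (le_trans (ltW s1))// lerDl divr_ge0// ltW. Qed.

Let min_le_powR (t : R) : 0 <= t -> Num.min t 1 <= t `^ al.
Proof.
rewrite le_eqVlt => /predU1P[<-|t0]; first by rewrite ge_min powR_ge0.
have [t1|t1] := leP t 1; first by apply: ger1_powR => //; rewrite t0.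
rewrite [leLHS](_ : 1 = 1 `^ al); last by rewrite powR1.
by rewrite ge0_ler_powR ?nnegrE ?(ltW t1) ?(ltW t0) ?(ltW holder_exponent_gt0).
Qed.

(** If the pair x, y attains half of the Hölder bound H, then u varies little on small balls around
    x and y, so the jump persists for all pairs of points in these balls. Their contribution alone
    makes the energy at least a constant times H^p. *)
Let morrey_seminorm_bound : exists2 K : R, 0 < K & forall u (H : R) x y,
  gagliardo u -> 0 < H -> (forall x y, `|u x - u y| <= H * hd x y `^ al) ->
  0 < hd x y -> H / 2 * hd x y `^ al <= `|u x - u y| -> H `^ p * K <= gnorm u `^ p.
Proof.
have al0 := holder_exponent_gt0.
have [c c0 Hc] := hball_lower hN.
(* On balls of radius eta * rho the oscillation is at most H rho^al / 16, so the jump stays at least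
   (1/2 - 2/16) H rho^al, more than the quarter used below. *)
have [eta /andP[e0 e1] eE] : exists2 eta : R, 0 < eta <= 1 & eta `^ al = 16^-1.
  exists (16^-1 `^ al^-1); last by rewrite -powRrM mulVf ?gt_eqF// powRr1.
  rewrite powR_gt0//= [leRHS](_ : 1 = 1 `^ al^-1); last by rewrite powR1.
  by rewrite ge0_ler_powR ?nnegrE ?invr_ge0 ?(ltW al0)// invf_le1// ler1n.
(* The factors come from the jump, from the kernel at distance at most 3 rho, and from the volumes
   of the two balls. The powers of rho cancel since al * p = s p - Q. *)
pose K := (4^-1 `^ p) * (3 `^ a)^-1 * (c * eta ^+ Q) ^+ 2.
have K0 : 0 < K.
  by rewrite !mulr_gt0 ?invr_gt0 ?powR_gt0 ?exprn_gt0// mulr_gt0// exprn_gt0.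
exists K => // u H x y Lu H0 uH xy0 Hxy; set rho := hd x y in xy0 Hxy.
have er0 : 0 < eta * rho by rewrite mulr_gt0.
have near (z x0 : T) : hd z x0 < eta * rho -> `|u z - u x0| <= H * (16^-1 * rho `^ al).
  move=> zx; apply: le_trans (uH z x0) _; rewrite ler_wpM2l ?(ltW H0)//.
  rewrite -eE -powRM ?(ltW e0) ?(ltW xy0)//.
  by rewrite ge0_ler_powR ?nnegrE ?(ltW al0) ?(ltW er0) ?(ltW zx)// (hdist_ge0 hN).
pose k := (H / 4 * rho `^ al) `^ p * ((3 * rho) `^ a)^-1.
have rho_al : 0 < rho `^ al by rewrite powR_gt0.
have k0 : 0 <= k by rewrite mulr_ge0 ?invr_ge0 ?powR_ge0.
have kle (w z : T) : hball G N y (eta * rho) w -> hball G N x (eta * rho) z ->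
    k <= `|u z - u w| `^ p * kern z w.
  rewrite /hball/= => wy zx.
  have B1 := near _ _ wy; have B2 := near _ _ zx.
  have zw : H / 4 * rho `^ al <= `|u z - u w|.
    have : `|u x - u y| <= `|u z - u x| + `|u z - u w| + `|u w - u y|.
      rewrite -[`|u z - u x|]normrN opprB.
      rewrite (_ : u x - u y = (u x - u z) + (u z - u w) + (u w - u y)); last by ring.
      by rewrite (le_trans (ler_normD _ _))// lerD2r ler_normD.
    move: Hxy B1 B2; move: (rho `^ al) rho_al => q q0.
    set A1 := `|u x - u y|; set A2 := `|u z - u x|; set A3 := `|u w - u y|.
    move: A1 A2 A3 (`|u z - u w|) => A1 A2 A3 A4 h1 h2 h3 h4.
    have hq : 0 < H * q by rewrite mulr_gt0.
    rewrite (_ : H / 4 * q = (H * q) / 4); last by ring.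
    rewrite (_ : H / 2 * q = (H * q) / 2) in h1; last by ring.
    rewrite (_ : H * (16^-1 * q) = (H * q) / 16) in h2; last by ring.
    rewrite (_ : H * (16^-1 * q) = (H * q) / 16) in h3; last by ring.
    move: (H * q) hq h1 h2 h3 => t t0 h1 h2 h3; lra.
  have zw0 : 0 < hd z w.
    rewrite lt0r (hdist_ge0 hN) andbT; apply/eqP => /(hdist_eq0 hN) E.
    move: zw; rewrite E subrr normr0 leNgt mulr_gt0// divr_gt0//.
  have zw3 : hd z w <= 3 * rho.
    apply: le_trans (hdist_triangle hN z x w) _.
    apply: le_trans (lerD (ltW zx) (hdist_triangle hN x y w)) _.
    rewrite (hdistC hN y w) -/rho; move: wy; move: (hd w y) => t ty.
    have : eta * rho <= rho by rewrite ler_piMl// ltW.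
    lra.
  rewrite /k ler_pM ?powR_ge0// ?invr_ge0 ?powR_ge0//.
    by rewrite ge0_ler_powR ?nnegrE ?(ltW p0)// mulr_ge0 ?(ltW rho_al)// divr_ge0// ltW.
  rewrite kernE lef_pV2 ?posrE ?powR_gt0 ?mulr_gt0//.
  by rewrite ge0_ler_powR ?nnegrE ?(ltW a0) ?(ltW zw0)// mulr_ge0// ltW.
have := energy_ge_rectangle Lu k0 (measurable_hball hN y (eta * rho)) (measurable_hball hN x (eta * rho)) kle.
rewrite -lee_fin; apply: le_trans.
pose m := c * (eta * rho) ^+ Q.
have m0 : 0 <= m by rewrite mulr_ge0 ?exprn_ge0 ?(ltW c0) ?(ltW er0).
apply: (@le_trans _ _ (k%:E * (m%:E * m%:E))%E); last first.
  apply: lee_wpmul2l; first by rewrite lee_fin.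
  by apply: lee_pmul; rewrite ?lee_fin//; exact: Hc.
rewrite -!EFinM lee_fin /k /K /m.
have Hal : (H / 4 * rho `^ al) `^ p = H `^ p * 4^-1 `^ p * (rho `^ (s * p) / rho ^+ Q).
  rewrite !powRM ?mulr_ge0 ?(ltW H0) ?(ltW rho_al)// -powRrM.
  congr (_ * _); rewrite mulrBl divfK ?gt_eqF// powRB; last by rewrite gt_eqF ?implybT.
  by rewrite powR_mulrn// ltW.
have Ha : (3 * rho) `^ a = 3 `^ a * (rho `^ (s * p) * rho ^+ Q).
  rewrite powRM ?(ltW xy0)// /a [X in rho `^ X]addrC [in X in _ * X = _]powRD ?powR_mulrn ?(ltW xy0)//.
  by rewrite (gt_eqF xy0) implybT.
rewrite Hal Ha [(eta * rho) ^+ Q]exprMn.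
have h1 : rho ^+ Q != 0 by rewrite gt_eqF// exprn_gt0.
have h2 : rho `^ (s * p) != 0 by rewrite gt_eqF// powR_gt0.
have h3 : 3 `^ a != 0 by rewrite gt_eqF// powR_gt0.
move: (rho ^+ Q) (rho `^ (s * p)) (3 `^ a) (4^-1 `^ p) (eta ^+ Q) (H `^ p) h1 h2 h3.
move=> A1 A2 A3 A4 A5 A6 h1 h2 h3; rewrite le_eqVlt; apply/orP; left; apply/eqP; field.
by rewrite h1 h2 h3.
Qed.

(** The Lipschitz bound makes the Hölder seminorm finite, so that some pair of points attains half
    of it; the resulting constant does not depend on L. *)
Lemma morrey_embedding : exists2 C : R, 0 < C & forall u (L : R), gagliardo u -> 0 <= L ->
  (forall x y, `|u x - u y| <= L * Num.min (hd x y) 1) ->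
  forall x y, `|u x - u y| <= C * gnorm u * hd x y `^ al.
Proof.
have [K K0 HK] := morrey_seminorm_bound.
have al0 := holder_exponent_gt0.
exists (K^-1 `^ p^-1); first by rewrite powR_gt0// invr_gt0.
move=> u L Lu L0 uL.
have hd_powR x y : hd x y != 0 -> 0 < hd x y `^ al.
  by move=> xy; rewrite powR_gt0// lt0r xy (hdist_ge0 hN).
(* The value 0 is included so that the set is nonempty and its supremum nonnegative. *)
pose E : set R := [set q | q = 0 \/ exists x y, hd x y != 0 /\ q = `|u x - u y| / hd x y `^ al].
have Eub : ubound E L.
  move=> q [->//|[x [y [xy ->]]]]; rewrite ler_pdivrMr ?hd_powR//.
  by apply: le_trans (uL x y) _; rewrite ler_wpM2l// min_le_powR// (hdist_ge0 hN).
have supE : has_sup E by split; [exists 0; left|exists L].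
pose H := sup E.
have uH x y : `|u x - u y| <= H * hd x y `^ al.
  have [xy|xy] := eqVneq (hd x y) 0.
    by rewrite (hdist_eq0 hN xy) subrr normr0 (hdistxx hN) powR0 ?gt_eqF// mulr0.
  rewrite -ler_pdivrMr ?hd_powR//; apply: ub_le_sup; first by exists L.
  by right; exists x, y.
have H0 : 0 <= H by apply: ub_le_sup; [exists L|left].
suff HC : H <= K^-1 `^ p^-1 * gnorm u.
  by move=> x y; apply: le_trans (uH x y) _; rewrite ler_wpM2r// powR_ge0.
have [H00|HN0] := eqVneq H 0; first by rewrite H00 mulr_ge0 ?powR_ge0.
have Hpos : 0 < H by rewrite lt0r HN0.
have [q Eq Hq] := sup_adherent (divr_gt0 Hpos (ltr0Sn R 1)) supE.
have {}Hq : H / 2 < q by apply: le_lt_trans Hq; rewrite -/H; lra.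
case: Eq => [q0|[x [y [xy qE]]]].
  by move: Hq; rewrite q0 ltNge divr_ge0.
have xy0 : 0 < hd x y by rewrite lt0r xy (hdist_ge0 hN).
have := HK u H x y Lu Hpos uH xy0.
rewrite -ler_pdivlMr ?hd_powR// -qE => /(_ (ltW Hq)) HKp.
rewrite -[H](powRr1 H0) -[X in H `^ X](mulfV (lt0r_neq0 p0)) powRrM.
rewrite -[gnorm u]powRr1 ?pnorm_ge0// -[X in gnorm u `^ X](mulfV (lt0r_neq0 p0)) powRrM.
rewrite -powRM ?powR_ge0 ?invr_ge0 ?(ltW K0)//.
rewrite ge0_ler_powR ?nnegrE ?invr_ge0 ?powR_ge0 ?(ltW p0) ?mulr_ge0 ?invr_ge0 ?(ltW K0) ?powR_ge0//.
by rewrite ler_pdivlMl// mulrC.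
Qed.

(** * Test functions on a bounded domain: sup bound and Poincaré inequality *)

Section bounded_domain.
Variable (Omega : set T).
Hypothesis bOmega : bounded_set Omega.

Lemma domain_radius : exists2 rho : R, 0 <= rho & forall x, Omega x -> `|x| <= rho.
Proof.
have [M [_ HM]] := bOmega.
exists (Num.max 0 (M + 1)); first by rewrite le_max lexx.
by move=> x Ox; rewrite le_max (HM (M + 1)) ?orbT// ltrDl.
Qed.

Lemma test_continuous phi : test_function Omega phi -> continuous phi.
Proof. by move=> [/(_ 0%N)[]]. Qed.

Lemma test_notin phi x : test_function Omega phi -> ~ Omega x -> phi x = 0.
Proof.
move=> [_ _ H] Ox; apply/eqP/negP => /negP px; apply: Ox; apply: H.
exact: subset_closure.
Qed.

Lemma test_supp_sub phi psi : test_function Omega phi -> smooth psi ->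
  (forall x, phi x = 0 -> psi x = 0) -> test_function Omega psi.
Proof.
move=> [sphi cphi Ophi] spsi pp.
have sub : closure [set x | psi x != 0] `<=` closure [set x | phi x != 0].
  by apply: closure_subset => x /=; apply: contra => /eqP/pp ->.
split => //; last exact: subset_trans Ophi.
exact: (subclosed_compact (@closed_closure _ _) cphi sub).
Qed.

Lemma testZ (c : R) phi : test_function Omega phi -> test_function Omega (fun x => c * phi x).
Proof.
move=> tphi; apply: (test_supp_sub tphi).
  by move=> m; apply: cdM; [exact: cd_cst|case: tphi].
by move=> x ->; rewrite mulr0.
Qed.

Lemma testD phi psi : test_function Omega phi -> test_function Omega psi ->
  test_function Omega (fun x => phi x + psi x).
Proof.
move=> [sphi cphi Ophi] [spsi cpsi Opsi].
have sub : closure [set x | phi x + psi x != 0] `<=`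
    closure [set x | phi x != 0] `|` closure [set x | psi x != 0].
  rewrite -closureU; apply: closure_subset => x /=.
  have [->|px] := eqVneq (phi x) 0; last by left.
  by rewrite add0r; right.
split; first by move=> m; exact: cdD.
- apply: (subclosed_compact (@closed_closure _ _) _ sub).
  exact: compactU.
- by apply: subset_trans sub _ => x []; [exact: Ophi|exact: Opsi].
Qed.

Lemma test_comp (h : R -> R) phi : smooth h -> h 0 = 0 ->
  test_function Omega phi -> test_function Omega (h \o phi).
Proof.
move=> sh h0 tphi; apply: (test_supp_sub tphi); last by move=> x /= ->.
by move=> m; apply: cd_comp => //; case: tphi.
Qed.

Lemma test_lipschitz phi : test_function Omega phi ->
  exists2 L : R, 0 <= L & forall x y, `|phi x - phi y| <= L * Num.min (hd x y) 1.
Proof.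
move=> tphi; have [rho rho0 Hr] := domain_radius.
apply: (smooth_hdist_lipschitz (rho := rho)); first by case: tphi.
move=> x px; apply: Hr; case: (pselect (Omega x)) => // /(test_notin tphi) E.
by rewrite E eqxx in px.
Qed.

Lemma test_gagliardo phi : test_function Omega phi -> gagliardo phi.
Proof.
move=> tphi; have [rho rho0 Hr] := domain_radius.
have [L L0 HL] := test_lipschitz tphi.
apply: (gagliardo_lipschitz (rho := rho) (test_continuous tphi) _ L0 HL).
move=> x px; apply: Hr; case: (pselect (Omega x)) => // /(test_notin tphi) E.
by rewrite E eqxx in px.
Qed.

Lemma test_holder : exists2 C : R, 0 < C & forall phi, test_function Omega phi ->
  forall x y, `|phi x - phi y| <= C * gnorm phi * hd x y `^ al.
Proof.
have [C C0 HC] := morrey_embedding; exists C => // phi tphi.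
have [L L0 HL] := test_lipschitz tphi.
exact: (HC phi L (test_gagliardo tphi) L0 HL).
Qed.

Let dim_gt0 : (0 < n)%N.
Proof.
rewrite (bigD1 ord0)//= addn_gt0; have := sg_dim_gt0 _ _ _ G ord0.
by move=> ->.
Qed.

Let far_point (t : R) : 0 <= t -> forall x : T, (forall i, t < x 0 i) -> ~ (`|x| <= t).
Proof.
move=> t0 x xt xn; have := rV_coord_le x (Ordinal dim_gt0).
rewrite ger0_norm; last by rewrite (le_trans t0)// ltW.
by move=> /le_trans/(_ xn); rewrite leNgt xt.
Qed.

(** Apply the Hölder bound between x and a fixed point y0 outside the domain, where phi vanishes;
    distances from the domain to y0 are bounded. *)
Lemma test_sup : exists2 C : R, 0 < C & forall phi, test_function Omega phi ->
  forall x, `|phi x| <= C * gnorm phi.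
Proof.
have [C C0 HC] := test_holder; have [rho rho0 Hr] := domain_radius.
pose y0 : T := const_mx (rho + 1).
have Oy0 : ~ Omega y0.
  by move=> /Hr; apply: far_point => // i; rewrite mxE ltrDl.
have [D D0 HD] := @bounded_on_ball2 R n n (fun z : T * T => hd z.1 z.2) (rho + 1) (continuous_hdist hN).
exists (C * (D + 1) `^ al); first by rewrite mulr_gt0// powR_gt0// ltr_wpDl.
move=> phi tphi x; case: (pselect (Omega x)) => [Ox|Ox]; last first.
  by rewrite (test_notin tphi Ox) normr0 !mulr_ge0 ?powR_ge0// ltW.
have := HC phi tphi x y0; rewrite (test_notin tphi Oy0) subr0 => /le_trans; apply.
rewrite mulrAC ler_wpM2r ?powR_ge0// ler_wpM2l ?(ltW C0)//.
rewrite ge0_ler_powR ?nnegrE ?(ltW holder_exponent_gt0) ?(hdist_ge0 hN) ?addr_ge0//.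
have := HD x y0; rewrite /= ger0_norm ?(hdist_ge0 hN)// => /(_ _ _)/le_trans; apply.
- by rewrite (le_trans (Hr _ Ox))// lerDl.
- apply/rV_norm_leP; first by rewrite addr_ge0.
  by move=> i; rewrite mxE ger0_norm// addr_ge0.
- by rewrite lerDl.
Qed.

(** On a box B away from the domain w vanishes, and the kernel between B and the domain is bounded
    below by some k. The part of the energy over pairs in B and the domain therefore dominates k
    times the measure of B times the integral of |w|^p. *)
Lemma poincare : exists2 C : R, 0 < C & forall w, gagliardo w ->
  (forall x, ~ Omega x -> w x = 0) ->
  (\int[mu]_x (`|w x| `^ p)%:E <= (C * gnorm w `^ p)%:E)%E.
Proof.
have [rho rho0 Hr] := domain_radius.
(* Every coordinate of a point of this box is at least rho + 1, which puts it outside the domain. *)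
pose c (i : 'I_n) : R := rho + 2; pose e (i : 'I_n) : R := 1.
pose B := box c e.
have mB : measurable B by exact: measurable_box.
have muB : mu B = (2 ^+ n)%:E.
  by rewrite lebesgue_box// /e mulr1 prodr_const card_ord.
have B1 y : B y -> forall i, rho + 1 <= y 0 i <= rho + 3.
  move=> By i; have := By i; rewrite /c /e.
  rewrite (_ : rho + 2 - 1 = rho + 1); last by ring.
  by rewrite (_ : rho + 2 + 1 = rho + 3)//; ring.
have BO y : B y -> ~ Omega y.
  move=> /B1 By /Hr; apply: far_point => // i; have /andP[h _] := By i.
  by apply: lt_le_trans h; rewrite ltrDl.
have [D D0 HD] := @bounded_on_ball2 R n n (fun z : T * T => hd z.1 z.2) (rho + 3) (continuous_hdist hN).
pose k := ((D + 1) `^ a)^-1.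
have D1 : 0 < D + 1 by rewrite ltr_wpDl.
have k0 : 0 < k by rewrite invr_gt0 powR_gt0.
have kle x y : B y -> Omega x -> k <= kern x y.
  move=> By Ox; have xy : 0 < hd x y.
    rewrite lt0r (hdist_ge0 hN) andbT; apply/eqP => /(hdist_eq0 hN) E.
    by apply: (BO _ By); rewrite -E.
  rewrite kernE lef_pV2 ?posrE ?powR_gt0//.
  rewrite ge0_ler_powR ?nnegrE ?(ltW a0) ?(ltW xy) ?(ltW D1)//.
  have := HD x y; rewrite /= ger0_norm ?(hdist_ge0 hN)// => H.
  rewrite (le_trans (H _ _)) ?lerDl//; first by rewrite (le_trans (Hr _ Ox))// lerDl.
  apply/rV_norm_leP; first by rewrite addr_ge0.
  move=> i; have /andP[h1 h2] := B1 _ By i.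
  by rewrite ger0_norm// (le_trans _ h1)// addr_ge0.
exists (k * 2 ^+ n)^-1; first by rewrite invr_gt0 mulr_gt0// exprn_gt0.
move=> w [mw Lw] w0.
have mwp : measurable_fun setT (fun x => `|w x| `^ p) by exact: measurable_norm_powR.
pose F (z : T * T) : R := \1_B z.1 * (k * `|w z.2| `^ p).
have F0 (z : T * T) : 0 <= F z by rewrite mulr_ge0// mulr_ge0 ?powR_ge0// ltW.
have mF : measurable_fun setT F.
  apply: measurable_funM; first exact: (measurableT_comp (measurable_indic mB) measurable_fst).
  apply: measurable_funM => //; exact: (measurableT_comp mwp measurable_snd).
pose I := (\int[mu]_x (`|w x| `^ p)%:E)%E.
have I0 : (0 <= I)%E by apply: integral_ge0 => x _; rewrite lee_fin powR_ge0.
have IF : (\int[nu]_z (F z)%:E = (k * 2 ^+ n)%:E * I)%E.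
  have mFE : measurable_fun setT (fun z : T * T => (F z)%:E) by exact/measurable_EFinP.
  have FE0 (z : T * T) : (0 <= (F z)%:E)%E by rewrite lee_fin.
  rewrite fubini_tonelli1//.
  have inner y : (\int[mu]_x (F (y, x))%:E = (\1_B y)%:E * (k%:E * I))%E.
    rewrite /F/= ge0_integral_cstM//.
    - by rewrite ge0_integral_cstM// ltW.
    - exact: measurable_funM.
    - by move=> x; rewrite mulr_ge0 ?powR_ge0// ltW.
  rewrite /fubini_F; under eq_integral do rewrite inner.
  have mB1 : measurable_fun setT (fun x : T => (\1_B x : R)%:E).
    by apply/measurable_EFinP; exact: measurable_indic.
  have kI0 : (0 <= k%:E * I)%E by rewrite mule_ge0// lee_fin ltW.
  rewrite ge0_integralZr//.
  have -> : (\int[mu]_x (\1_B x : R)%:E = (2 ^+ n)%:E)%E.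
    by rewrite integral_indic// setIT.
  by rewrite muleA -EFinM mulrC.
have le1 : (\int[nu]_z (F z)%:E <= (gnorm w `^ p)%:E)%E.
  rewrite /gagliardo_norm pnormK// -energyE//; apply: ge0_le_integral => //.
  - by move=> z _; rewrite lee_fin.
  - exact/measurable_EFinP.
  - by apply/measurable_EFinP/measurable_norm_powR; exact: Lw.1.
  move=> [y x] _; rewrite lee_fin gdiff_powR// /F/=.
  case: (pselect (Omega x)) => [Ox|Ox]; last first.
    by rewrite (w0 _ Ox) normr0 powR0 ?gt_eqF// !mulr0 mulr_ge0 ?powR_ge0 ?kern_ge0.
  rewrite indicE; have [/set_mem By|_] := boolP (y \in B); last first.
    by rewrite mul0r mulr_ge0 ?powR_ge0 ?kern_ge0.
  by rewrite mul1r (w0 _ (BO _ By)) subr0 mulrC ler_wpM2l ?powR_ge0// kle.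
have kk0 : 0 < k * 2 ^+ n by rewrite mulr_gt0// exprn_gt0.
rewrite IF in le1; rewrite EFinM -/I.
by rewrite lee_pdivlMl.
Qed.

End bounded_domain.

End fractional_seminorm.

(** * Compactness of equicontinuous sequences *)

(** Tychonoff's theorem gives a cluster point u for pointwise convergence. Equicontinuity passes to
    u, and a finite cover of K turns closeness at finitely many centres into uniform closeness. *)
Lemma ascoli_cluster (R : realType) n (K : set 'rV[R]_n) (phi : nat -> 'rV[R]_n -> R) (C : R) :
  compact K -> (forall k x, `|phi k x| <= C) ->
  (forall x (e : R), 0 < e -> \forall y \near x, forall k, `|phi k x - phi k y| <= e) ->
  exists u : 'rV[R]_n -> R, forall (e : R) m, 0 < e ->
    exists2 k, (m <= k)%N & forall x, K x -> `|phi k x - u x| <= e.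
Proof.
move=> cK phiC equi.
pose X := prod_topology (fun _ : 'rV[R]_n => R).
pose A : set X := [set f : X | forall x, [set` `[- C, C]] (f x)].
have cA : @compact X A.
  exact: (@tychonoff 'rV[R]_n (fun _ => R) (fun _ => [set` `[- C, C]]) (fun _ => @segment_compact R (- C) C)).
pose F : set_system X := (phi : nat -> X) @ \oo.
have FF : ProperFilter F by exact: fmap_proper_filter.
have FA : F A.
  by exists 0%N => // k _ x /=; rewrite in_itv/= -ler_norml.
have [u [_ clu]] := cA F FF FA.
have near_u (l : seq 'rV[R]_n) (e : R) : 0 < e ->
    nbhs (u : X) [set f : X | forall x, x \in l -> `|f x - u x| < e].
  move=> e0; elim: l => [|x l IH].
    by apply: (@filterS _ _ _ setT); [move=> f _ x; rewrite in_nil|exact: filterT].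
  have H : nbhs (u : X) [set f : X | `|f x - u x| < e].
    have O : nbhs (u x : R) [set t : R | `|t - u x| < e].
      by apply: (filterS _ (nbhsx_ballx (u x : R) e e0)) => t; rewrite /ball/= distrC.
    exact: (@proj_continuous 'rV[R]_n (fun _ => R) x u _ O).
  apply: filterS2 H IH => f fx fl y; rewrite inE => /predU1P[->//|]; exact: fl.
have pick (l : seq 'rV[R]_n) (e : R) m : 0 < e ->
    exists2 k, (m <= k)%N & forall x, x \in l -> `|phi k x - u x| < e.
  move=> e0.
  have FB : F [set f : X | exists2 k, (m <= k)%N & f = phi k].
    by exists m => // k mk; exists k.
  have [f [[k mk ->] H]] := clu _ _ FB (near_u l e e0).
  by exists k.
have uequi x y (e : R) : 0 < e -> (forall k, `|phi k x - phi k y| <= e) -> `|u x - u y| <= e + (e + e).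
  move=> e0 xy; have [k _ Hk] := pick [:: x; y] e 0%N e0.
  have h1 := Hk x; have h2 := Hk y; rewrite !inE !eqxx orbT in h1 h2.
  rewrite (_ : u x - u y = (phi k x - phi k y) + ((phi k y - u y) - (phi k x - u x))); last by ring.
  rewrite (le_trans (ler_normD _ _))// lerD ?xy// (le_trans (ler_normB _ _))// lerD// ltW//.
    exact: h2.
  exact: h1.
exists u => e m e0.
(* One e' for phi k at the centre, one for the variation of phi k, and three for the variation of u
   given by [uequi]. *)
pose e' := e / 5.
have e'0 : 0 < e' by rewrite divr_gt0.
pose U x := interior [set y | forall k, `|phi k x - phi k y| <= e'].
have UP x : nbhs x [set y | forall k, `|phi k x - phi k y| <= e'] by exact: equi.
move: cK; rewrite compact_cover => /(_ _ K U).
have oU i : K i -> open (U i) by move=> _; exact: open_interior.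
have KU : K `<=` cover K U.
  move=> x Kx; exists x => //; rewrite /U /interior/=; exact: UP.
move=> /(_ oU KU)[D DK KD].
have [k mk Hk] := pick (finmap.enum_fset D) e' m e'0.
exists k => // x /KD[c cD].
have cD' : c \in finmap.enum_fset D by [].
move=> /interior_subset/= cx.
have := uequi _ _ _ e'0 cx; have := cx k; have := Hk _ cD'.
rewrite (_ : phi k x - u x = (phi k c - u c) - (phi k c - phi k x) + (u c - u x)); last by ring.
move=> h1 h2 h3; apply: le_trans (ler_normD _ _) _.
apply: le_trans (lerD (ler_normB _ _) (lexx _)) _.
apply: le_trans (lerD (lerD (ltW h1) h2) h3) _.
rewrite /e'; lra.
Qed.

(** * The primitive G of the nonlinearity *)

Section antiderivative.
Context {R : realType} (g : R -> R).
Hypotheses (cg : continuous g) (g_ge0 : forall t, 0 <= g t).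
Local Notation leb := (@lebesgue_measure R).
Local Notation P := (primitive0 g).

Let integrable_g (a b : R) : leb.-integrable `[a, b] (EFin \o g).
Proof.
apply: continuous_compact_integrable; first exact: segment_compact.
exact: continuous_subspaceT.
Qed.

(** A base point to the left of both 0 and t removes the case distinction on the sign of t, so the
    fundamental theorem of calculus applies also at t = 0. *)
Let primitive0_shift (a t : R) : a < 0 -> a < t ->
  P t = \int[leb]_(x in `[a, t]) g x - \int[leb]_(x in `[a, 0]) g x.
Proof.
move=> a0 at_; rewrite /primitive0; case: ifPn => [t0|]; last first.
  rewrite -ltNge => t0; rewrite -[RHS]opprB; congr (- _).
  rewrite Rintegral_itvB ?bnd_simp ?(ltW at_) ?(ltW t0)//.
  rewrite Rintegral_itv_obnd_cbnd//.
  by apply: integrableS (@integrable_g t 0) => //; exact: subset_itv_oc_cc.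
rewrite Rintegral_itvB ?bnd_simp ?(ltW a0)//.
rewrite Rintegral_itv_obnd_cbnd//.
by apply: integrableS (@integrable_g 0 t) => //; exact: subset_itv_oc_cc.
Qed.

Lemma is_derive_primitive0 (t : R) : is_derive t 1 P (g t).
Proof.
pose a := - (1 + `|t|).
have a0 : a < 0 by rewrite /a oppr_lt0 ltr_pwDl.
have at_ : a < t.
  by rewrite /a ltrNl (le_lt_trans (ler_norm _))// normrN ltr_pwDl.
have tt1 : t < t + 1 by rewrite ltrDl.
have [D E] := @continuous_FTC1_closed R g a t (t + 1) tt1 (@integrable_g a (t + 1)) at_ (@cg t).
apply: (@near_eq_is_derive _ _ _ (fun y => \int[leb]_(x in `[a, y]) g x - \int[leb]_(x in `[a, 0]) g x)).
  by have := lt_nbhsr at_; apply: filterS => y ay; rewrite (primitive0_shift a0 ay).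
have D1 : is_derive t 1 (fun y : R => \int[leb]_(x in `[a, y]) g x) (g t).
  by split; [exact: D|rewrite -derive1E].
have := is_deriveB D1 (is_derive_cst (\int[leb]_(x in `[a, 0]) g x) t 1).
by rewrite subr0.
Qed.

Lemma continuous_primitive0 : continuous P.
Proof.
by move=> t; apply/differentiable_continuous/derivable1_diffP; case: (is_derive_primitive0 t).
Qed.

Lemma primitive0_MVT (x y : R) : exists2 c : R, `|c| <= Num.max `|x| `|y| & P y - P x = g c * (y - x).
Proof.
wlog xy : x y / x <= y.
  move=> H; have [|/ltW yx] := leP x y; first exact: H.
  have [c cxy E] := H y x yx; exists c; first by rewrite maxC.
  by rewrite -[LHS]opprB E -mulrN opprB.
have [|c cxy E] := @MVT_segment R P g x y xy (fun t _ => is_derive_primitive0 t).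
  by apply: continuous_subspaceT; exact: continuous_primitive0.
exists c => //; move: cxy; rewrite in_itv/= => /andP[xc cy].
rewrite ler_norml; apply/andP; split.
  apply: le_trans xc; rewrite lerNl le_max; apply/orP; left.
  by rewrite -normrN ler_norm.
by apply: le_trans cy _; rewrite le_max ler_norm orbT.
Qed.

Lemma primitive00 : P 0 = 0.
Proof. by rewrite /primitive0 lexx set_itv1 Rintegral_set1. Qed.

Lemma primitive0_homo : {homo P : x y / x <= y}.
Proof.
move=> x y xy; have [c _ E] := primitive0_MVT x y.
by rewrite -subr_ge0 E mulr_ge0// subr_ge0.
Qed.

Lemma bounded_on_segment (C : R) : exists2 L : R, 0 <= L &
  forall x, `|x| <= C -> g x <= L.
Proof.
have [C0|C0] := leP 0 C; last first.
  by exists 0 => // x xC; have := le_lt_trans xC C0; rewrite normr_lt0.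
have ab : - C <= C by lra.
have [|c _ Hc] := @EVT_max R g (- C) C ab; first exact: continuous_subspaceT.
by exists (g c) => // x xC; apply: Hc; rewrite in_itv/= -ler_norml.
Qed.

Lemma primitive0_ge0 (t : R) : 0 <= t -> 0 <= P t.
Proof. by move=> t0; rewrite -primitive00 primitive0_homo. Qed.

Lemma primitive0_lipschitz (C : R) : exists2 L : R, 0 <= L &
  forall x y, `|x| <= C -> `|y| <= C -> `|P x - P y| <= L * `|x - y|.
Proof.
have [L L0 HL] := bounded_on_segment C; exists L => // x y xC yC.
have [z zxy ->] := primitive0_MVT y x.
by rewrite normrM ler_wpM2r// ger0_norm// HL// (le_trans zxy)// ge_max yC.
Qed.

End antiderivative.

Lemma integrable_indic_lty d (W : measurableType d) (R : realType)
    (mu : {measure set W -> \bar R}) (A : set W) : measurable A -> (mu A < +oo)%E ->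
  mu.-integrable setT (EFin \o (\1_A : W -> R)).
Proof.
move=> mA Aoo; apply/integrableP; split.
  by apply/measurable_EFinP; exact: measurable_indic.
rewrite (_ : (\int[mu]_x _ = \int[mu]_x (\1_A x : R)%:E)%E); first by rewrite integral_indic// setIT.
by apply: eq_integral => x _; rewrite /= ger0_norm// indicE ler0n.
Qed.

(** * The nonlinear term and its derivative *)

Section bounded_support.
Context d (W : measurableType d) (R : realType).
Variables (mu : {measure set W -> \bar R}) (Om : set W).
Hypotheses (mOm : measurable Om) (Om_oo : (mu Om < +oo)%E).
Local Notation m := (fine (mu Om)).

Let integrable_cst_indic (C : R) : mu.-integrable setT (EFin \o (fun x => C * \1_Om x)).
Proof. exact: (integrableZl measurableT C (integrable_indic_lty mOm Om_oo)). Qed.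

Lemma bounded_support_integrable (f : W -> R) (C : R) : measurable_fun setT f ->
  (forall x, `|f x| <= C) -> (forall x, ~ Om x -> f x = 0) ->
  mu.-integrable setT (EFin \o f).
Proof.
move=> mf fC f0; apply: (le_integrable measurableT _ _ (integrable_cst_indic C)) => /=.
  exact/measurable_EFinP.
move=> x _; rewrite lee_fin; apply: le_trans (ler_norm _); rewrite indicE.
have [_|/negP xO] := boolP (x \in Om); first by rewrite mulr1.
by rewrite f0 ?normr0 ?mulr0// => /mem_set.
Qed.

Lemma bounded_support_Rintegral_le (f : W -> R) (C : R) : measurable_fun setT f ->
  (forall x, f x <= C) -> mu.-integrable setT (EFin \o f) ->
  (forall x, ~ Om x -> f x = 0) -> \int[mu]_x f x <= C * m.
Proof.
move=> mf fC intf f0.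
have -> : C * m = \int[mu]_x (C * \1_Om x).
  rewrite RintegralZl//; last exact: integrable_indic_lty.
  by rewrite /Rintegral integral_indic// setIT.
apply: le_Rintegral => // x _; rewrite indicE.
have [_|/negP xO] := boolP (x \in Om); first by rewrite mulr1.
by rewrite f0 ?mulr0// => /mem_set.
Qed.

Lemma bounded_support_Rintegral_norm (f : W -> R) (C : R) : measurable_fun setT f ->
  (forall x, `|f x| <= C) -> (forall x, ~ Om x -> f x = 0) ->
  `|\int[mu]_x f x| <= C * m.
Proof.
move=> mf fC f0; have intf := bounded_support_integrable mf fC f0.
apply: le_trans (le_normr_Rintegral measurableT intf) _.
apply: bounded_support_Rintegral_le => //.
- exact: measurableT_comp.
- exact: integrable_abse intf.
- by move=> x /f0 ->; rewrite normr0.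
Qed.

End bounded_support.

Section nonlinear_integral.
Context d (W : measurableType d) (R : realType).
Variables (mu : {measure set W -> \bar R}) (Om : set W).
Hypotheses (mOm : measurable Om) (Om_oo : (mu Om < +oo)%E).
Variables (b : W -> R) (B : R).
Hypotheses (mb : measurable_fun setT b) (b_ge0 : forall x, 0 <= b x).
Hypotheses (bB : forall x, b x <= B) (b_out : forall x, ~ Om x -> b x = 0).
Variable g : R -> R.
Hypotheses (cg : continuous g) (g_ge0 : forall t, 0 <= g t).
Local Notation P := (primitive0 g).
Local Notation m := (fine (mu Om)).
Implicit Types v w : W -> R.

Definition potential v : R := \int[mu]_x (b x * P (v x)).

Let bn x : `|b x| <= `|B|.
Proof. by rewrite (ger0_norm (b_ge0 x)) (le_trans (bB x))// ler_norm. Qed.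

Lemma measurable_potential v : measurable_fun setT v ->
  measurable_fun setT (fun x => b x * P (v x)).
Proof.
move=> mv; apply: measurable_funM => //; apply: (@measurableT_comp _ _ _ _ _ _ P) => //.
by apply: continuous_measurable_fun; exact: continuous_primitive0.
Qed.

Lemma potential_integrable v (C : R) : measurable_fun setT v ->
  (forall x, `|v x| <= C) -> mu.-integrable setT (EFin \o (fun x => b x * P (v x))).
Proof.
move=> mv vC; have [L L0 HL] := primitive0_lipschitz cg g_ge0 C.
have C0 x : 0 <= C := le_trans (normr_ge0 _) (vC x).
apply: (@bounded_support_integrable _ _ _ mu Om mOm Om_oo _ (`|B| * (L * C))).
- exact: measurable_potential.
- move=> x; rewrite normrM; apply: ler_pM => //.
  have := HL (v x) 0 (vC x); rewrite primitive00 normr0 !subr0 => /(_ (C0 x))/le_trans; apply.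
  exact: ler_wpM2l.
- by move=> x /b_out ->; rewrite mul0r.
Qed.

Lemma potentialB v w (C : R) : measurable_fun setT v -> measurable_fun setT w ->
  (forall x, `|v x| <= C) -> (forall x, `|w x| <= C) ->
  potential v - potential w = \int[mu]_x (b x * (P (v x) - P (w x))).
Proof.
move=> mv mw vC wC; rewrite /potential -RintegralB//; last 2 first.
- exact: potential_integrable vC.
- exact: potential_integrable wC.
by apply: eq_Rintegral => x _; rewrite mulrBr.
Qed.

Lemma potential_lipschitz (C : R) : exists2 K : R, 0 <= K & forall v w (e : R),
  measurable_fun setT v -> measurable_fun setT w ->
  (forall x, `|v x| <= C) -> (forall x, `|w x| <= C) ->
  (forall x, `|v x - w x| <= e) -> `|potential v - potential w| <= K * e.
Proof.
have [L L0 HL] := primitive0_lipschitz cg g_ge0 C.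
exists (`|B| * L * m); first by rewrite !mulr_ge0// fine_ge0.
move=> v w e mv mw vC wC vw; rewrite (potentialB mv mw vC wC).
rewrite mulrAC; apply: (bounded_support_Rintegral_norm mOm Om_oo).
- have -> : (fun x => b x * (P (v x) - P (w x))) = (fun x => b x * P (v x) - b x * P (w x)).
    by apply/funext => x; rewrite mulrBr.
  by apply: measurable_funB; exact: measurable_potential.
- move=> x; rewrite normrM -mulrA; apply: ler_pM => //.
  by apply: le_trans (HL _ _ (vC x) (wC x)) _; exact: ler_wpM2l.
- by move=> x /b_out ->; rewrite mul0r.
Qed.

Lemma potential_homo v w (C : R) : measurable_fun setT v -> measurable_fun setT w ->
  (forall x, `|v x| <= C) -> (forall x, `|w x| <= C) ->
  (forall x, v x <= w x) -> potential v <= potential w.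
Proof.
move=> mv mw vC wC vw; apply: le_Rintegral => //.
- exact: potential_integrable vC.
- exact: potential_integrable wC.
by move=> x _; rewrite ler_wpM2l//; exact: (primitive0_homo cg g_ge0).
Qed.

Lemma potential_le v (C t : R) : measurable_fun setT v -> (forall x, `|v x| <= C) ->
  0 <= t -> (forall x, v x <= t) -> potential v <= B * P t * m.
Proof.
move=> mv vC t0 vt; apply: (bounded_support_Rintegral_le mOm Om_oo).
- exact: measurable_potential.
- move=> x; have P0 := primitive0_ge0 cg g_ge0 t0.
  apply: (@le_trans _ _ (b x * P t)); last exact: ler_wpM2r.
  by rewrite ler_wpM2l//; exact: (primitive0_homo cg g_ge0).
- exact: potential_integrable vC.
- by move=> x /b_out ->; rewrite mul0r.
Qed.

Lemma potential_ge v (C t b0 : R) (A : set W) : measurable A -> (mu A < +oo)%E ->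
  (forall x, A x -> b0 <= b x) -> measurable_fun setT v -> (forall x, `|v x| <= C) ->
  (forall x, 0 <= v x) -> 0 <= t -> (forall x, A x -> t <= v x) ->
  b0 * P t * fine (mu A) <= potential v.
Proof.
move=> mA Aoo b0b mv vC v0 t0 tv.
have P0 := primitive0_ge0 cg g_ge0.
have -> : b0 * P t * fine (mu A) = \int[mu]_x (b0 * P t * \1_A x).
  rewrite RintegralZl//; last exact: integrable_indic_lty.
  by rewrite /Rintegral integral_indic// setIT.
apply: le_Rintegral => //.
- exact: (integrableZl measurableT _ (integrable_indic_lty mA Aoo)).
- exact: potential_integrable vC.
move=> x _; rewrite indicE; have [/set_mem xA|_] := boolP (x \in A); last first.
  by rewrite mulr0 mulr_ge0// P0.
rewrite mulr1; apply: (@le_trans _ _ (b x * P t)).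
  by apply: ler_wpM2r; [exact: P0|exact: b0b].
by rewrite ler_wpM2l//; apply: (primitive0_homo cg g_ge0); exact: tv.
Qed.

(** Dominated convergence: G is Lipschitz on [-2C, 2C], where all the arguments lie, so the
    difference quotients are bounded by a multiple of the indicator of [Om]. *)
Lemma potential_derivative v w (C : R) : measurable_fun setT v -> measurable_fun setT w ->
  (forall x, `|v x| <= C) -> (forall x, `|w x| <= C) ->
  k.+1%:R * (potential (fun x => v x + k.+1%:R^-1 * w x) - potential v) @[k --> \oo] -->
  \int[mu]_x (b x * g (v x) * w x).
Proof.
move=> mv mw vC wC.
have C0 x : 0 <= C := le_trans (normr_ge0 _) (vC x).
have [L L0 HL] := primitive0_lipschitz cg g_ge0 (C + C).
pose q k x : R := b x * (k.+1%:R * (P (v x + k.+1%:R^-1 * w x) - P (v x))).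
have mvk k : measurable_fun setT (fun x => v x + k.+1%:R^-1 * w x).
  by apply: measurable_funD => //; exact: measurable_funM.
have kw k x : `|k.+1%:R^-1 * w x| <= C.
  rewrite normrM gtr0_norm ?invr_gt0// (le_trans _ (wC x))// ler_piMl//.
  by rewrite invf_le1// ler1n.
have vkC k x : `|v x + k.+1%:R^-1 * w x| <= C + C.
  by apply: le_trans (ler_normD _ _) _; apply: lerD.
have vCC x : `|v x| <= C + C by rewrite (le_trans (vC x))// lerDl (C0 x).
have mq k : measurable_fun setT (q k).
  have -> : q k = (fun x => k.+1%:R * (b x * P (v x + k.+1%:R^-1 * w x) - b x * P (v x))).
    by apply/funext => x; rewrite /q; ring.
  apply: measurable_funM => //; apply: measurable_funB; exact: measurable_potential.
have qE k : k.+1%:R * (potential (fun x => v x + k.+1%:R^-1 * w x) - potential v) =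
    \int[mu]_x q k x.
  rewrite (potentialB (mvk k) mv (vkC k) vCC) -RintegralZl//.
    by apply: eq_Rintegral => x _; rewrite /q; ring.
  have := integrableB measurableT (potential_integrable (mvk k) (vkC k)) (potential_integrable mv vCC).
  by apply: eq_integrable => // x _ /=; rewrite mulrBr EFinB.
rewrite (_ : (fun k => _) = (fun k => \int[mu]_x q k x)); last by apply/funext => k; exact: qE.
have mgv : measurable_fun setT (fun x => b x * g (v x) * w x).
  apply: measurable_funM => //; apply: measurable_funM => //.
  apply: (@measurableT_comp _ _ _ _ _ _ g) => //.
  exact: continuous_measurable_fun.
pose D x : R := `|B| * (L * C) * \1_Om x.
have iD : mu.-integrable setT (EFin \o D).
  exact: (integrableZl measurableT _ (integrable_indic_lty mOm Om_oo)).
have q_le k x : `|q k x| <= D x.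
  rewrite /D indicE; have [_|/negP xO] := boolP (x \in Om); last first.
    by rewrite /q b_out ?mul0r ?normr0 ?mulr0// => /mem_set.
  rewrite mulr1 /q normrM; apply: ler_pM => //.
  rewrite normrM [X in X * _]gtr0_norm// -ler_pdivlMl//.
  apply: le_trans (HL _ _ (vkC k x) (vCC x)) _.
  rewrite addrAC subrr add0r normrM gtr0_norm ?invr_gt0// mulrCA ler_wpM2l ?invr_ge0//.
  by rewrite ler_wpM2l.
have q_cvg x : q k x @[k --> \oo] --> b x * g (v x) * w x.
  rewrite /q -mulrA; apply: cvgMr.
  have [D1 E1] := is_derive_primitive0 cg (v x).
  have dP : differentiable P (v x) by apply/derivable1_diffP.
  have Dw : 'D_(w x) P (v x) = g (v x) * w x.
    by rewrite deriveE// -[w x in LHS]mulr1 linearZ/= -deriveE// E1 mulrC.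
  have : h^-1 *: (P (h *: w x + v x) - P (v x)) @[h --> 0^'] --> 'D_(w x) P (v x).
    exact: (@diff_derivable _ _ _ _ _ _ dP).
  move=> /cvgr_dnbhsP H.
  have := H (fun k : nat => k.+1%:R^-1).
  move=> /(_ _)/wrap[]; first by split; [move=> k; rewrite invr_eq0 pnatr_eq0|exact: cvg_harmonic].
  rewrite -Dw => H2; apply: cvg_trans H2; apply: near_eq_cvg.
  by apply: nearW => k /=; rewrite invrK [_ *: w x + _]addrC.
have mqE k : measurable_fun setT (EFin \o q k) by exact/measurable_EFinP.
have mgE : measurable_fun setT (EFin \o (fun x => b x * g (v x) * w x)) by exact/measurable_EFinP.
have [||_ _] := dominated_convergence measurableT mqE mgE _ iD _.
- by apply: aeW => x _; apply: cvg_EFin; [exact: nearW|exact: q_cvg].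
- by apply: aeW => x k _ /=; rewrite lee_fin.
move=> H; apply: (@fine_cvg _ _ _ _ (fun k => \int[mu]_x (q k x)%:E)%E).
rewrite /Rintegral fineK//; apply: integrable_fin_num => //.
have [Lg Lg0 HLg] := bounded_on_segment cg g_ge0 C.
apply: (@bounded_support_integrable _ _ _ mu Om mOm Om_oo _ (`|B| * Lg * C)) => //.
  move=> x; rewrite !normrM; apply: ler_pM => //.
  by apply: ler_pM => //; rewrite ger0_norm// HLg.
by move=> x /b_out ->; rewrite !mul0r.
Qed.

End nonlinear_integral.

(** * Values realizing lower and upper limits along a filter *)

Lemma limf_einf_lt (R : realType) (f : R -> \bar R) (F : set_system R) (c : \bar R) :
  (limf_einf f F < c)%E -> forall V, F V -> exists2 x, V x & (f x < c)%E.
Proof.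
move=> fc V FV; have : (ereal_inf (f @` V) < c)%E.
  apply: le_lt_trans fc; rewrite limf_einfE; apply: ereal_sup_ubound.
  by exists V.
by move=> /ereal_inf_lt[_ [x Vx <-] fx]; exists x.
Qed.

Lemma limf_esup_gt (R : realType) (f : R -> \bar R) (F : set_system R) (c : \bar R) :
  (c < limf_esup f F)%E -> forall V, F V -> exists2 x, V x & (c < f x)%E.
Proof.
move=> fc V FV; have : (c < ereal_sup (f @` V))%E.
  apply: lt_le_trans fc _; rewrite limf_esupE; apply: ereal_inf_lbound.
  by exists V.
by move=> /ereal_sup_gt[_ [x Vx <-] fx]; exists x.
Qed.

(** * A bump inside the domain and a bounded representative of the weight *)

Lemma sqr_half_lt (R : realFieldType) (e : R) : 0 < e -> 0 < e ^+ 2 - (e / 2) ^+ 2.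
Proof. by move=> e0; nra. Qed.

Lemma rV_bump_ge (R : realType) n (c : 'rV[R]_n) (e : R) (x : 'rV[R]_n) : 0 < e ->
  (forall i, `|x 0 i - c 0 i| <= e / 2) -> flat 0 (e ^+ 2 - (e / 2) ^+ 2) ^+ n <= rV_bump c e x.
Proof.
move=> e0 H; have t0 : 0 < e ^+ 2 - (e / 2) ^+ 2 by exact: sqr_half_lt.
rewrite -[X in _ ^+ X]card_ord -prodr_const; apply: ler_prod => i _; rewrite flat_ge0/=.
have le_t : e ^+ 2 - (e / 2) ^+ 2 <= e ^+ 2 - (x 0 i - c 0 i) ^+ 2.
  rewrite lerD2l lerN2 -[leLHS]real_normK ?num_real// lerXn2r ?nnegrE//.
  by rewrite divr_ge0// ltW.
rewrite /flat t0 (lt_le_trans t0 le_t) !expr0 ler_pM2l// ler_expR lerN2.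
by rewrite lef_pV2 ?posrE// (lt_le_trans t0).
Qed.

Section bump_and_weight.
Context {R : realType} {r : nat} {d : 'I_r.+1 -> nat}.
Local Notation n := (\sum_i d i)%N.
Local Notation T := (stratified_space R d).
Local Notation mu := (lebesgue_rV R n).
Variable Omega : set T.
Hypotheses (oOmega : open Omega) (Omega_neq0 : Omega !=set0).

(** The function along which J is made negative; [A] is the region where its lower bound is used. *)
Lemma bump_test : exists phi (A : set T),
  [/\ test_function Omega phi, forall x, 0 <= phi x, forall x, A x -> 1 <= phi x, A `<=` Omega &
      measurable A /\ (0 < mu A < +oo)%E].
Proof.
have [c Oc] := Omega_neq0; have /nbhs_ballP[e /= e0 eO] : nbhs c Omega by exact: open_nbhs_nbhs.
pose e' := e / 2; have e'0 : 0 < e' by exact: divr_gt0.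
have sub x : `|x - c| <= e' -> Omega x.
  move=> xc; apply: eO; rewrite -ball_normE/= distrC; apply: le_lt_trans xc _.
  by rewrite /e' ltr_pdivrMr// ltr_pMr// ltr1n.
have close : closure [set x | rV_bump c e' x != 0] `<=` [set x | `|x - c| <= e'].
  have <- : closed_ball c e' = [set x | `|x - c| <= e'].
    by rewrite closed_ballE//; apply/seteqP; split=> x /=; rewrite distrC.
  rewrite [X in _ `<=` X](iffLR (closure_id _) (@closed_ball_closed _ _ c e')).
  apply: closure_subset.
  move=> x /(rV_bump_neq0 e'0) xc; rewrite closed_ballE// /closed_ball_/= distrC; exact: xc.
have tb : test_function Omega (rV_bump c e').
  split; first exact: smooth_rV_bump.
  - apply: (subclosed_compact (@closed_closure _ _) (@compact_rV_ball R n (`|c| + e'))) => x /close xc /=.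
    rewrite -[x](subrK c) addrC; apply: le_trans (ler_normD _ _) _; exact: lerD.
  - by move=> x /close; exact: sub.
pose dl := flat 0 (e' ^+ 2 - (e' / 2) ^+ 2) ^+ n.
have dl0 : 0 < dl by rewrite exprn_gt0// flat_gt0// sqr_half_lt.
pose A := box (fun i => c 0 i) (fun=> e' / 2).
have Ac x : A x -> forall i, `|x 0 i - c 0 i| <= e' / 2.
  by move=> Ax i; have := Ax i; rewrite ler_distl.
exists (fun x => dl^-1 * rV_bump c e' x), A; split.
- exact: testZ.
- by move=> x; rewrite mulr_ge0 ?invr_ge0 ?(ltW dl0)// rV_bump_ge0.
- by move=> x /Ac Ax; rewrite ler_pdivlMl// mulr1; exact: rV_bump_ge.
- move=> x /Ac Ax; apply: sub; apply/rV_norm_leP; first exact: ltW.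
  move=> i; rewrite !mxE; apply: le_trans (Ax i) _.
  by rewrite ler_pdivrMr// ler_peMr ?(ltW e'0)// ler1n.
- split; first exact: measurable_box.
  rewrite lebesgue_box; last by move=> i; rewrite divr_ge0// ltW.
  by rewrite ltry lte_fin prodr_gt0// => i _; rewrite mulr_gt0 ?divr_gt0.
Qed.

(** The weight beta is controlled only almost everywhere and is measurable only on the domain.
    Clamping it between b0 and B' and extending it by 0 gives a representative for which all
    estimates hold at every point. *)
Lemma truncated_weight (beta : T -> R) : measurable_fun Omega beta ->
  (Linfty_norm Omega beta < +oo)%E -> (0 < ess_inf_on Omega beta)%E ->
  exists (b : T -> R) (b0 B : R),
    [/\ measurable_fun setT b, forall x, 0 <= b x <= B, forall x, ~ Omega x -> b x = 0,
        0 < b0 /\ forall x, Omega x -> b0 <= b x &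
        \forall x \ae mu, Omega x -> beta x = b x].
Proof.
move=> mbeta; have [phi [A [_ _ _ AO [mA /andP[A0 _]]]]] := bump_test.
have mOmega := open_measurable_rV oOmega.
(* The norm of order +oo is the essential supremum only when the measure is nonzero. *)
have muT : (0 < mu setT)%E.
  by apply: lt_le_trans A0 _; apply: le_measure; rewrite ?inE.
rewrite /Linfty_norm unlock muT => supB inf0.
have [B HB] : exists B : R, \forall x \ae mu, `|(beta \_ Omega) x| <= B.
  have [B supB'] : exists B : R, (ess_sup mu (abse \o (EFin \o beta \_ Omega)) <= B%:E)%E.
    by move: supB; case: (ess_sup _ _) => [B||]// _; [exists B; rewrite lexx|exists 0; rewrite leNye].
  by exists B; have /ess_supP := supB'; apply: filterS => x /=; rewrite lee_fin.
have [b0 b0_gt0 Hb0] : exists2 b0 : R, 0 < b0 & \forall x \ae mu, Omega x -> b0 <= beta x.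
  have [b0 b0_gt0 inf0'] : exists2 b0 : R, 0 < b0 & (b0%:E <= ess_inf_on Omega beta)%E.
    move: inf0; case: (ess_inf_on _ _) => [c||]//; first by rewrite lte_fin => c0; exists c; rewrite ?lexx.
    by exists 1 => //; rewrite leey.
  exists b0 => //; have /ess_infP := inf0'; apply: filterS => x + Ox.
  by rewrite /patch mem_set//= lee_fin.
pose B' := Num.max b0 B.
pose b x := \1_Omega x * Num.max b0 (Num.min B' ((beta \_ Omega) x)).
have bO x : Omega x -> b x = Num.max b0 (Num.min B' (beta x)).
  by move=> Ox; rewrite /b indicE mem_set// mul1r patchE mem_set.
have bN x : ~ Omega x -> b x = 0.
  by move=> Ox; rewrite /b indicE memNset// mul0r.
have b0B : b0 <= B' by rewrite le_max lexx.
exists b, b0, B'; split=> //.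
- apply: measurable_funM; first exact: measurable_indic.
  apply: measurable_maxr => //; apply: measurable_minr => //.
  exact: (measurable_restrictT _ _).1.
- move=> x; case: (pselect (Omega x)) => Ox; last first.
    by rewrite bN// lexx (le_trans (ltW b0_gt0)).
  by rewrite bO// le_max (ltW b0_gt0)/= ge_max b0B ge_min lexx.
- by split=> // x Ox; rewrite bO// le_max lexx.
- apply: filterS2 HB Hb0 => x xB xb0 Ox; rewrite bO// min_r; last first.
    rewrite le_max; apply/orP; right; move: xB; rewrite patchE mem_set//.
    by apply: le_trans; exact: ler_norm.
  by rewrite max_r// xb0.
Qed.

End bump_and_weight.

(** * The energy functional *)

Section variational_problem.
Context {R : realType} {r : nat} {d : 'I_r.+1 -> nat}.
Local Notation n := (\sum_i d i)%N.
Local Notation T := (stratified_space R d).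
Local Notation mu := (lebesgue_rV R n).
Local Notation nu := (mu \x mu)%E.
Variables (G : stratified_group R d) (N : T -> R) (hN : homogeneous_norm G N).
Local Notation Q := (homogeneous_dim d).
Local Notation hd := (hdist G N).
Variables (s p : R).
Hypotheses (s0 : 0 < s) (s1 : s < 1) (p1 : 1 < p) (sp : Q%:R < s * p).
Variable (Omega : set T).
Hypotheses (mOmega : measurable Omega) (bOmega : bounded_set Omega).
Variables (b : T -> R) (B : R).
Hypotheses (mb : measurable_fun setT b) (b_ge0 : forall x, 0 <= b x).
Hypotheses (bB : forall x, b x <= B) (b_out : forall x, ~ Omega x -> b x = 0).
Variable g : R -> R.
Hypotheses (cg : continuous g) (g_ge0 : forall t, 0 <= g t).
Variable lam : R.
Hypothesis lam0 : 0 < lam.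
Implicit Types (x y z : T) (u v w phi psi : T -> R).

Let p0 : 0 < p. Proof. exact: lt_trans p1. Qed.

Local Notation gdiff := (gdiff G N s p).
Local Notation gagliardo := (gagliardo G N s p).
Local Notation gnorm := (gagliardo_norm G N s p).
Local Notation al := (@holder_exponent R r d s p).
Local Notation P := (primitive0 g).
Local Notation test := (test_function Omega).
Local Notation m := (fine (mu Omega)).
Local Notation Psi := (potential mu b g).

Let Omega_lty : (mu Omega < +oo)%E.
Proof. by have [rho _ H] := domain_radius bOmega; exact: bounded_lebesgue_lty mOmega H. Qed.

Definition functional u : R := gnorm u `^ p / p - lam * Psi u.
Local Notation J := functional.

Lemma test0 : test (fun=> 0).
Proof.
have E : [set x : T | (0 : R) != 0] = set0 by apply/seteqP; split=> x //=; rewrite eqxx.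
by split; rewrite ?E ?closure0//; [move=> k; exact: cd_cst|exact: compact0].
Qed.

Let test_gag phi : test phi -> gagliardo phi.
Proof. exact: (test_gagliardo hN s0 s1 p1 bOmega). Qed.

Let test_meas phi : test phi -> measurable_fun setT phi.
Proof. by move=> /test_gag[]. Qed.

Lemma functional0 : J (fun=> 0) = 0.
Proof.
have -> : (fun=> 0) = (fun x : T => 0 * (0 : R)) by apply/funext => x; rewrite mul0r.
rewrite /J gnormZ//; last exact: test_gag test0.
rewrite normr0 mul0r powR0 ?gt_eqF// mul0r sub0r mul0r /potential.
rewrite (_ : \int[mu]_x _ = 0) ?mulr0 ?oppr0//.
rewrite /Rintegral; under eq_integral do rewrite primitive00 mulr0.
by rewrite integral0.
Qed.

(** * Existence of a minimizer in the interior of a ball *)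

Section minimization.
Local Opaque gagliardo_norm energy potential.
Variables (C0 tau : R).
Hypotheses (C0_gt0 : 0 < C0) (tau_gt0 : 0 < tau).
Hypothesis test_sup_le : forall phi, test phi -> forall x, `|phi x| <= C0 * gnorm phi.
Hypothesis subcritical : lam * (B * P tau * m) * p < (tau / C0) `^ p.

Let rad : R := tau / C0.
Let rad0 : 0 < rad. Proof. exact: divr_gt0. Qed.
(** The ball is taken among test functions rather than in their completion; the minimizer appears
    only as a limit. *)
Let adm phi := test phi /\ gnorm phi <= rad.

Let adm_le phi : adm phi -> forall x, `|phi x| <= tau.
Proof.
move=> [tphi rphi] x; apply: le_trans (test_sup_le tphi x) _.
by rewrite -ler_pdivlMl// mulrC.
Qed.

Let S : set R := [set J phi | phi in adm].
Let j := inf S.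

Let adm0 : adm (fun=> 0).
Proof.
split; first exact: test0.
have -> : (fun=> 0) = (fun x : T => 0 * (0 : R)) by apply/funext => x; rewrite mul0r.
rewrite gnormZ//; last exact: test_gag test0.
by rewrite normr0 mul0r ltW.
Qed.

Let Psi_le v : measurable_fun setT v -> (forall x, `|v x| <= tau) -> Psi v <= B * P tau * m.
Proof.
move=> mv vt; apply: (potential_le mOmega Omega_lty mb b_ge0 bB b_out cg g_ge0 mv vt) => //.
  exact: ltW.
by move=> x; exact: le_trans (ler_norm _) (vt x).
Qed.

Let S_lb : has_lbound S.
Proof.
exists (- (lam * (B * P tau * m))) => _ [phi Aphi <-].
have h1 : 0 <= gnorm phi `^ p / p by rewrite divr_ge0 ?powR_ge0 ?ltW.
have h2 : lam * Psi phi <= lam * (B * P tau * m).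
  by rewrite ler_pM2l//; apply: Psi_le; [exact: test_meas Aphi.1|exact: adm_le].
rewrite /functional; move: h1 h2; set X := lam * (_ * _); lra.
Qed.

Let j_le phi : adm phi -> j <= J phi.
Proof. by move=> Aphi; apply: (ge_inf S_lb); exists phi. Qed.

(** Composing with [smooth_abs c] does not increase the seminorm, and lowers Psi by at most K c,
    because [smooth_abs c] lies above t - c and G is nondecreasing. *)
Let minimizing (e : R) : 0 < e -> exists phi, [/\ adm phi, forall x, 0 <= phi x & J phi <= j + e].
Proof.
move=> e0; have e20 : 0 < e / 2 by exact: divr_gt0.
have iS : has_inf S by split; [exists (J (fun=> 0)); exists (fun=> 0)|exact: S_lb].
have [_ [phi Aphi <-] Jphi] := inf_adherent e20 iS.
have [K K0 HK] := potential_lipschitz mOmega Omega_lty mb b_ge0 bB b_out cg g_ge0 (tau + 1).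
(* The bound c <= 1 keeps phi - c within tau + 1, where K is valid; the other bound gives lam K c <=
   e / 2. *)
pose c := Num.min 1 (e / 2 / (lam * K + 1)).
have lK : 0 < lam * K + 1 by rewrite ltr_wpDl// mulr_ge0// ltW.
have c0 : 0 < c by rewrite lt_min ltr01 divr_gt0.
have c1 : c <= 1 by rewrite ge_min lexx.
have [tphi rphi] := Aphi.
have tpsi : test (smooth_abs c \o phi).
  by apply: test_comp => //; [exact: smooth_smooth_abs|exact/smooth_abs0/ltW].
have [_ npsi] := gagliardo_contraction hN p1 (test_gag tphi) (test_meas tpsi)
  (fun x y => smooth_abs_lip (phi x) (phi y) c0).
have Apsi : adm (smooth_abs c \o phi) := conj tpsi (le_trans npsi rphi).
exists (smooth_abs c \o phi); split => //.
  by move=> x; apply: smooth_abs_ge0; exact: ltW.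
have mphi := test_meas tphi.
have mphic : measurable_fun setT (fun x => phi x - c) by apply: measurable_funB.
have le1 (x : T) : `|phi x| <= tau + 1 by rewrite (le_trans (adm_le Aphi x))// lerDl.
have le2 (x : T) : `|(smooth_abs c \o phi) x| <= tau + 1 by rewrite (le_trans (adm_le Apsi x))// lerDl.
have le3 (x : T) : `|phi x - c| <= tau + 1.
  by rewrite (le_trans (ler_normB _ _))// lerD ?(adm_le Aphi)// ger0_norm// ltW.
have P1 : Psi phi - K * c <= Psi (fun x => phi x - c).
  rewrite lerBlDr -lerBlDl; apply: le_trans (ler_norm _) _; apply: HK => // x.
  by rewrite opprB addrCA subrr addr0 ger0_norm// ltW.
have P2 : Psi (fun x => phi x - c) <= Psi (smooth_abs c \o phi).
  apply: (potential_homo mOmega Omega_lty mb b_ge0 bB b_out cg g_ge0 mphic (test_meas tpsi) le3 le2).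
  by move=> x; apply: le_trans (smooth_abs_ge c (phi x)); rewrite lerD2r ler_norm.
have E1 : gnorm (smooth_abs c \o phi) `^ p / p <= gnorm phi `^ p / p.
  have pV0 : 0 <= p^-1 by rewrite invr_ge0 ltW.
  exact: (ler_wpM2r pV0 (ler_powR_base (ltW p0) (gnorm_ge0 G N s p _) npsi)).
have lKc : lam * (K * c) <= e / 2.
  have : c * (lam * K + 1) <= e / 2 by rewrite -ler_pdivlMr// ge_min lexx orbT.
  move/(le_trans _); apply; rewrite (_ : c * (lam * K + 1) = lam * (K * c) + c); last by ring.
  by rewrite lerDl ltW.
move: Jphi; rewrite -/j /J => Jphi.
have H := ler_wpM2l (ltW lam0) (le_trans P1 P2).
rewrite /functional; apply: le_trans (lerB E1 H) _.
rewrite mulrBr opprB addrA addrAC [e in leRHS]splitr addrA.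
exact: lerD (ltW Jphi) lKc.
Qed.

Let equicontinuous x (e : R) : 0 < e -> \forall y \near x, forall phi, adm phi ->
  `|phi x - phi y| <= e.
Proof.
move=> e0; have [C HC0 HC] := test_holder hN s0 s1 p1 sp bOmega.
have al0 : 0 < al := holder_exponent_gt0 p1 sp.
have c1 : continuous (fun y => hd x y).
  by move=> y; apply: (@continuous_comp _ _ _ (pair x) (fun z : T * T => hd z.1 z.2));
    [exact: continuous_pairl|exact: continuous_hdist].
have c2 : continuous (fun y => `|hd x y| `^ al).
  move=> y; apply: (@continuous_comp _ _ _ (fun y => hd x y) (fun t : R => `|t| `^ al)).
    exact: c1.
  exact: continuous_norm_powR.
have Cr : 0 < C * rad + 1 by rewrite ltr_wpDl// mulr_ge0// ltW.
have /cvgrPdist_lt/(_ (e / (C * rad + 1))) := c2 x.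
rewrite (hdistxx hN) normr0 powR0 ?gt_eqF// => /(_ (divr_gt0 e0 Cr)).
apply: filterS => y; rewrite sub0r normrN !ger0_norm ?powR_ge0 ?(hdist_ge0 hN)//.
rewrite ltr_pdivlMr// => ye phi [tphi rphi].
apply: le_trans (HC _ tphi x y) _; apply: le_trans (ltW ye).
rewrite mulrC ler_wpM2l ?powR_ge0//.
apply: (@le_trans _ _ (C * rad)); first by rewrite ler_wpM2l// ltW.
by rewrite lerDl.
Qed.

(** Uniform convergence controls Psi, and convergence in seminorm places u in [X0_space]. *)
Definition test_limit u (psi : nat -> T -> R) := [/\ forall k, test (psi k),
  forall k x, `|psi k x - u x| <= k.+1%:R^-1 &
  gnorm (fun x => psi k x - u x) @[k --> \oo] --> (0 : R)].

Let uniform_limit : exists u (psi : nat -> T -> R), [/\ forall k, adm (psi k),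
  forall k x, 0 <= psi k x, forall k, J (psi k) <= j + k.+1%:R^-1,
  forall k x, `|psi k x - u x| <= k.+1%:R^-1 & forall x, ~ Omega x -> u x = 0].
Proof.
have k0 k : 0 < k.+1%:R^-1 :> R by rewrite invr_gt0.
have /choice[phi Hphi] := fun k => minimizing (k0 k).
have [rho rho0 Hr] := domain_radius bOmega.
have Aphi k : adm (phi k) by have [] := Hphi k.
have [|x e e0|u0 Hu] := ascoli_cluster (@compact_rV_ball R n rho) (phi := phi) (C := tau).
- by move=> k x; exact: (adm_le (Aphi k) x).
- exact: filterS (fun y H k => H (phi k) (Aphi k)) (equicontinuous x e0).
pose u x := if `[< Omega x >] then u0 x else 0.
have uO x : ~ Omega x -> u x = 0 by rewrite /u; case: asboolP.
have /choice[kk Hkk] : forall i : nat, exists k, (i <= k)%N /\ forall x, `|phi k x - u x| <= i.+1%:R^-1.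
  move=> i; have [k ik H] := Hu _ i (k0 i); exists k; split=> // x.
  rewrite /u; case: asboolP => Ox; first by apply: H; exact: Hr.
  by rewrite (test_notin (Aphi k).1 Ox) subrr normr0 ltW.
exists u, (fun i => phi (kk i)); split; last exact: uO.
- by move=> k; exact: Aphi.
- by move=> k x; have [_ + _] := Hphi (kk k); exact.
- move=> k; have [_ _ H] := Hphi (kk k); apply: le_trans H _.
  by rewrite lerD2l lef_pV2 ?posrE// ler_nat ltnS; have [] := Hkk k.
- by move=> k; have [] := Hkk k.
Qed.

(** A nonnegative minimizing sequence with a uniform limit u is Cauchy in seminorm by uniform
    convexity. Fatou's lemma then gives convergence in seminorm to u and J u <= j. Finally
    [subcritical] excludes that u lies on the sphere. *)
Lemma minimizer : exists u (psi : nat -> T -> R),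
  [/\ gagliardo u, forall x, 0 <= u x <= tau, forall x, ~ Omega x -> u x = 0 & gnorm u < rad] /\
  test_limit u psi /\ forall phi, test phi -> gnorm phi <= rad -> J u <= J phi.
Proof.
have [u [psi [Apsi psi_ge0 Jpsi psiu uO]]] := uniform_limit.
have tpsi k : test (psi k) by have [] := Apsi k.
have Gpsi k := test_gag (tpsi k).
have mpsi k := test_meas (tpsi k).
have [K K0 HK] := potential_lipschitz mOmega Omega_lty mb b_ge0 bB b_out cg g_ge0 tau.
have k0 k : 0 < k.+1%:R^-1 :> R by rewrite invr_gt0.
have small (e : R) : 0 < e -> exists i : nat, forall k, (i <= k)%N -> k.+1%:R^-1 < e.
  move=> e0; have [i _ Hi] := @near_infty_natSinv_lt R (PosNum e0).
  by exists i => k; exact: Hi.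
have inv_le i k : (i <= k)%N -> k.+1%:R^-1 <= i.+1%:R^-1 :> R.
  by move=> ik; rewrite lef_pV2 ?posrE// ler_nat.
have psi_cvg x : psi k x @[k --> \oo] --> u x.
  apply/cvgrPdist_le => e e0; have [i Hi] := small e e0; exists i => // k /= ik.
  by rewrite distrC (le_trans (psiu k x))// ltW// Hi.
have psi_shift i x : psi (i + l)%N x @[l --> \oo] --> u x.
  have := psi_cvg x; rewrite -(cvg_shiftn i); apply: cvg_trans; apply: near_eq_cvg.
  by apply: nearW => l /=; rewrite addnC.
have mu_ : measurable_fun setT u.
  by apply: (@measurable_fun_cvg _ _ _ setT psi) => // x _; exact: psi_cvg.
have lim_le x (c : R) : (forall k, psi k x <= c) -> u x <= c.
  move=> H; apply: (ler_cvg_to (psi_cvg x) (@cvg_cst _ c _ _ _)); exact: nearW.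
have lim_ge x (c : R) : (forall k, c <= psi k x) -> c <= u x.
  move=> H; apply: (ler_cvg_to (@cvg_cst _ c _ _ _) (psi_cvg x)); exact: nearW.
have u_ge0 x : 0 <= u x by apply: lim_ge.
have u_le x : u x <= tau.
  by apply: lim_le => k; apply: le_trans (ler_norm _) (adm_le (Apsi k) x).
have un x : `|u x| <= tau by rewrite ger0_norm.
have PsiB k : `|Psi (psi k) - Psi u| <= K * k.+1%:R^-1.
  exact: (HK _ _ _ (mpsi k) mu_ (adm_le (Apsi k)) un (psiu k)).
pose E k := energy nu p (gdiff (psi k)).
have EJ k : E k / p <= j + k.+1%:R^-1 + lam * Psi (psi k).
  by have := Jpsi k; rewrite /functional gnorm_powR// lerBlDr.
have E_le k : E k <= rad `^ p.
  rewrite /E -gnorm_powR//; have [_ H] := Apsi k.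
  exact: (ler_powR_base (ltW p0) (gnorm_ge0 _ _ _ _ _) H).
(* The midpoint of psi k and psi l is admissible, so J is at least j there, while it is close to j
   at both ends. Since Psi is nearly the same at the three functions, the midpoint defect of the
   energy is small. *)
have cauchy (e : R) : 0 < e -> exists i : nat, forall k l, (i <= k)%N -> (i <= l)%N ->
    energy nu p (gdiff (fun x => psi k x - psi l x)) <= e.
  move=> e0; have rp0 : 0 < rad `^ p by exact: powR_gt0.
  (* Both energies are at most rad^p, so the first term of the convexity inequality is at most e /
     2. *)
  have e1 : 0 < e / (4 * rad `^ p) by rewrite divr_gt0// mulr_gt0.
  have [C C_ge0 HC] := energy_uniform_convexity nu p1 e1.
  pose D := C * (p * (1 + lam * (K + K))) + 1.
  have D0 : 0 < D.
    by rewrite ltr_wpDl// mulr_ge0// mulr_ge0 ?(ltW p0)// addr_ge0// mulr_ge0 ?addr_ge0// ltW.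
  have [i Hi] := small (e / 2 / D) (divr_gt0 (divr_gt0 e0 (ltr0Sn R 1)) D0).
  exists i => k l ik il.
  set mid := fun x => (psi k x + psi l x) / 2.
  have midE : mid = (fun x => 2^-1 * (psi k x + psi l x)) by apply/funext => x; rewrite mulrC.
  have tmid : test mid by rewrite midE; apply/testZ/testD.
  have nmid : gnorm mid <= rad.
    rewrite midE gnormZ//; last exact: gagliardoD.
    rewrite gtr0_norm ?invr_gt0// ler_pdivrMl//.
    apply: le_trans (gnormD p1 (Gpsi k) (Gpsi l)) _.
    have [_ h1] := Apsi k; have [_ h2] := Apsi l; have -> : 2 * rad = rad + rad by rewrite mulr_natl mulr2n.
    exact: (lerD h1 h2).
  have Amid : adm mid := conj tmid nmid.
  have Jmid := j_le Amid.
  have dk x : `|mid x - u x| <= i.+1%:R^-1.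
    rewrite (_ : mid x - u x = 2^-1 * ((psi k x - u x) + (psi l x - u x))); last by rewrite /mid; field.
    rewrite normrM gtr0_norm ?invr_gt0// ler_pdivrMl//.
    apply: le_trans (ler_normD _ _) _.
    have -> : 2 * i.+1%:R^-1 = i.+1%:R^-1 + i.+1%:R^-1 :> R by rewrite mulr_natl mulr2n.
    exact: lerD (le_trans (psiu k x) (inv_le i k ik)) (le_trans (psiu l x) (inv_le i l il)).
  have Pmid : `|Psi mid - Psi u| <= K * i.+1%:R^-1.
    exact: (HK _ _ _ (test_meas tmid) mu_ (adm_le Amid) un dk).
  have Pk q : (i <= q)%N -> `|Psi (psi q) - Psi u| <= K * i.+1%:R^-1 /\ q.+1%:R^-1 <= i.+1%:R^-1 :> R.
    move=> iq; have h := inv_le i q iq.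
    by split; [exact: le_trans (PsiB q) (ler_wpM2l K0 h)|exact: h].
  have := HC _ _ (Gpsi k).2 (Gpsi l).2; rewrite -/(E k) -/(E l).
  have -> : (fun z : T * T => gdiff (psi k) z - gdiff (psi l) z) = gdiff (fun x => psi k x - psi l x).
    by rewrite gdiffB.
  have -> : (fun z : T * T => (gdiff (psi k) z + gdiff (psi l) z) / 2) = gdiff mid.
    by rewrite midE gdiffZ gdiffD; apply/funext => z; rewrite mulrC.
  move/le_trans; apply.
  have EM : energy nu p (gdiff mid) >= p * (j + lam * Psi mid).
    by rewrite -gnorm_powR// -ler_pdivlMl// [leRHS]mulrC -lerBrDr.
  have [Pk1 ik1] := Pk k ik; have [Pl1 il1] := Pk l il.
  have bound : (E k + E l) / 2 - energy nu p (gdiff mid) <= p * (1 + lam * (K + K)) * i.+1%:R^-1.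
    have h1 : E k <= p * (j + k.+1%:R^-1 + lam * Psi (psi k)) by rewrite -ler_pdivrMl// mulrC EJ.
    have h2 : E l <= p * (j + l.+1%:R^-1 + lam * Psi (psi l)) by rewrite -ler_pdivrMl// mulrC EJ.
    have h3 : j + k.+1%:R^-1 + lam * Psi (psi k) <= j + i.+1%:R^-1 + lam * (Psi u + K * i.+1%:R^-1).
      rewrite lerD ?lerD2l//; apply: (ler_wpM2l (ltW lam0)); rewrite -lerBlDl; exact: le_trans (ler_norm _) Pk1.
    have h4 : j + l.+1%:R^-1 + lam * Psi (psi l) <= j + i.+1%:R^-1 + lam * (Psi u + K * i.+1%:R^-1).
      rewrite lerD ?lerD2l//; apply: (ler_wpM2l (ltW lam0)); rewrite -lerBlDl; exact: le_trans (ler_norm _) Pl1.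
    have h5 : j + lam * (Psi u - K * i.+1%:R^-1) <= j + lam * Psi mid.
      rewrite lerD2l; apply: (ler_wpM2l (ltW lam0)); rewrite lerBlDl -lerBlDr.
      apply: le_trans (ler_norm _) _; rewrite distrC; exact: Pmid.
    have {h3}h1 := le_trans h1 (ler_wpM2l (ltW p0) h3).
    have {h4}h2 := le_trans h2 (ler_wpM2l (ltW p0) h4).
    have {h5}EM := le_trans (ler_wpM2l (ltW p0) h5) EM.
    apply: le_trans (lerB (ler_wpM2r _ (lerD h1 h2)) EM) _ => //.
    by rewrite le_eqVlt; apply/orP; left; apply/eqP; field.
  have iD : i.+1%:R^-1 * D <= e / 2 by rewrite -ler_pdivlMr// ltW// Hi.
  apply: (@le_trans _ _ (e / 2 + C * (p * (1 + lam * (K + K)) * i.+1%:R^-1))).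
    apply: lerD; last by rewrite ler_wpM2l.
    apply: (@le_trans _ _ (e / (4 * rad `^ p) * (rad `^ p + rad `^ p))).
      by rewrite ler_wpM2l ?(ltW e1)// lerD.
    by rewrite le_eqVlt; apply/orP; left; apply/eqP; field; rewrite gt_eqF.
  rewrite [leRHS]splitr lerD2l; apply: le_trans iD.
  rewrite /D [leRHS]mulrDr mulr1 (_ : C * _ = i.+1%:R^-1 * (C * (p * (1 + lam * (K + K))))).
    by rewrite lerDl; exact: ltW (k0 i).
  by rewrite mulrA mulrC.
(* Let the second index of the Cauchy estimate tend to infinity and apply Fatou's lemma; the shift
   by i keeps that index in the range of the estimate. *)
have Gdiff (e : R) : 0 < e -> exists i : nat, forall k, (i <= k)%N ->
    gagliardo (fun x => psi k x - u x) /\ energy nu p (gdiff (fun x => psi k x - u x)) <= e.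
  move=> e0; have [i Hi] := cauchy e e0; exists i => k ik.
  have mk : measurable_fun setT (fun x => psi k x - u x) by apply: measurable_funB.
  have [] := @fatou_energy _ _ _ nu p p1 (fun l => gdiff (fun x => psi k x - psi (i + l)%N x))
    (gdiff (fun x => psi k x - u x)) e.
  - exact: measurable_gdiff.
  - by move=> l; have [] := gagliardoB p1 (Gpsi k) (Gpsi (i + l)%N).
  - move=> z; apply: cvgMl.
    have c1 x : psi k x - psi (i + l)%N x @[l --> \oo] --> psi k x - u x.
      apply: cvgB; first exact: cvg_cst.
      exact: psi_shift.
    by apply: cvgB; exact: c1.
  - by move=> l; apply: Hi => //; rewrite leq_addr.
  by move=> L1 L2; split.
have [i0 Hi0] := Gdiff 1 ltr01.
have Gu : gagliardo u.
  have [H _] := Hi0 i0 (leqnn _); have := gagliardoB p1 (Gpsi i0) H.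
  by rewrite (_ : (fun x => _) = u)//; apply/funext => x; rewrite opprB addrCA subrr addr0.
have gcvg : gnorm (fun x => psi k x - u x) @[k --> \oo] --> (0 : R).
  apply/cvgrPdist_le => e e0; have [i Hi] := Gdiff (e `^ p) (powR_gt0 _ e0).
  exists i => // k /= ik; have [_ H] := Hi k ik.
  rewrite sub0r normrN ger0_norm ?gnorm_ge0//.
  have : gnorm (fun x => psi k x - u x) `^ p <= e `^ p by rewrite gnorm_powR.
  exact: ler_powR_inv (ltW e0).
have Ju : J u <= j.
  apply/ler_addgt0Pr => e e0; pose c := e / (1 + lam * (K + K)).
  have lK : 0 < 1 + lam * (K + K) by rewrite ltr_wpDr// mulr_ge0 ?addr_ge0// ltW.
  have c0 : 0 < c by exact: divr_gt0.
  have [i Hi] := small c c0.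
  have [||_] := @fatou_energy _ _ _ nu p p1 (fun l => gdiff (psi (i + l)%N)) (gdiff u)
    (p * (j + c + lam * (Psi u + K * c))) Gu.2.1 (fun l => (Gpsi (i + l)%N).2).
  - by move=> z; apply: cvgMl; apply: cvgB; exact: psi_shift.
  - move=> l; rewrite -/(E _) -ler_pdivrMl// mulrC; apply: le_trans (EJ _) _.
    have ic : (i + l).+1%:R^-1 <= c by rewrite ltW// Hi// leq_addr.
    rewrite lerD ?lerD2l// ler_pM2l// -lerBlDl.
    by apply: le_trans (ler_norm _) _; apply: le_trans (PsiB _) _; rewrite ler_wpM2l.
  rewrite -gnorm_powR// -ler_pdivrMl// mulrC => H.
  have cE : c * (1 + lam * (K + K)) = e by rewrite /c divfK// gt_eqF.
  have lKc : 0 <= lam * K * c := mulr_ge0 (mulr_ge0 (ltW lam0) K0) (ltW c0).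
  rewrite /functional lerBlDr; apply: le_trans H _; rewrite -cE -subr_ge0.
  by rewrite (_ : _ - _ = lam * K * c); [exact: lKc|ring].
exists u, psi; split; last first.
  split; first exact: And3 tpsi psiu gcvg.
  by move=> phi tphi rphi; apply: le_trans Ju (j_le (conj tphi rphi)).
have ub x : 0 <= u x <= tau by rewrite u_ge0 u_le.
apply: (And4 Gu ub uO); rewrite ltNge; apply/negP => ru.
(* On the sphere, J u <= J 0 = 0 would give rad^p / p <= lam * Psi u, against [subcritical]. *)
have : J u <= 0 by rewrite -functional0; exact: le_trans Ju (j_le adm0).
rewrite /functional subr_le0 => H; have := ler_powR_base (ltW p0) (ltW rad0) ru.
apply/negP; rewrite -ltNge; apply: le_lt_trans subcritical.
rewrite -ler_pdivrMr//; apply: le_trans H _.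
exact: (ler_wpM2l (ltW lam0) (Psi_le mu_ un)).
Qed.

End minimization.

(** * The Euler-Lagrange equation of the minimizer *)

Section euler_lagrange.
Variables (u : T -> R) (psi : nat -> T -> R) (tau rad : R).
Hypotheses (Gu : gagliardo u) (u_bnd : forall x, 0 <= u x <= tau).
Hypotheses (u_out : forall x, ~ Omega x -> u x = 0) (u_rad : gnorm u < rad).
Hypothesis u_lim : test_limit u psi.
Hypothesis u_min : forall phi, test phi -> gnorm phi <= rad -> J u <= J phi.

Let mu_ : measurable_fun setT u. Proof. exact: Gu.1. Qed.

Let un x : `|u x| <= tau. Proof. by have /andP[h1 h2] := u_bnd x; rewrite ger0_norm. Qed.

Let tau0 : 0 <= tau. Proof. by have /andP[h1 h2] := u_bnd 0; exact: le_trans h2. Qed.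

Let psi_test k : test (psi k). Proof. by case: u_lim. Qed.

Let test_bounded phi : test phi -> exists2 C : R, 0 <= C & forall x, `|phi x| <= C.
Proof.
move=> tphi; have [C C0 HC] := test_sup hN s0 s1 p1 sp bOmega.
exists (C * gnorm phi); last exact: HC.
exact: (mulr_ge0 (ltW C0) (gnorm_ge0 G N s p phi)).
Qed.

Local Opaque gagliardo_norm energy potential pairing.

(** Minimality is known against test functions only, so u + t phi is approached by psi k + t phi,
    which lies in the ball for large k. The sequence [h k] bounds J at these functions and tends to
    J (u + t phi). *)
Let min_line phi (t : R) : test phi -> 0 <= t -> gnorm u + t * gnorm phi < rad ->
  J u <= J (fun x => u x + t * phi x).
Proof.
move=> tphi t0 small.
have [_ psiu gcvg] := u_lim.
have tt := testZ t tphi; have Gt := test_gag tt.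
set w := fun x => u x + t * phi x.
have Gw : gagliardo w := gagliardoD p1 Gu Gt.
pose wk k x := psi k x + t * phi x.
have twk k : test (wk k) := testD (psi_test k) tt.
have Gwk k : gagliardo (wk k) := test_gag (twk k).
pose dl k := gnorm (fun x => psi k x - u x).
have dl0 k : 0 <= dl k by exact: gnorm_ge0.
have wkw k : gnorm (wk k) <= gnorm w + dl k.
  have := gnormB_le p1 (Gwk k) Gw.
  by rewrite (_ : (fun x => wk k x - w x) = (fun x => psi k x - u x))//;
    apply/funext => x; rewrite /wk /w; ring.
have uu : gnorm w <= gnorm u + t * gnorm phi.
  have := gnormD p1 Gu Gt; rewrite (gnormZ p1 t (test_gag tphi)) ger0_norm//.
have [Cp Cp0 HCp] := test_bounded tt.
pose C := tau + 1 + Cp.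
have wC x : `|w x| <= C.
  apply: le_trans (ler_normD _ _) _; apply: lerD (HCp x).
  by apply: le_trans (un x) _; rewrite lerDl.
have wkC k x : `|wk k x| <= C.
  apply: le_trans (ler_normD _ _) _; apply: lerD (HCp x).
  rewrite (_ : psi k x = u x + (psi k x - u x)); last by rewrite addrCA subrr addr0.
  apply: le_trans (ler_normD _ _) _; apply: lerD (un x) _.
  by apply: le_trans (psiu k x) _; rewrite invf_le1// ler1n.
have [K K0 HK] := potential_lipschitz mOmega Omega_lty mb b_ge0 bB b_out cg g_ge0 C.
have PsiB k : `|Psi (wk k) - Psi w| <= K * k.+1%:R^-1.
  apply: (HK _ _ _ (Gwk k).1 Gw.1 (wkC k) wC) => x.
  by rewrite (_ : wk k x - w x = psi k x - u x) ?psiu//; rewrite /wk /w; ring.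
pose h k := `|gnorm w + dl k| `^ p / p - lam * (Psi w - K * k.+1%:R^-1).
have hcvg : h k @[k --> \oo] --> J w.
  apply: cvgB.
    apply: cvgMl; rewrite -[X in _ --> X `^ p](ger0_norm (gnorm_ge0 G N s p w)).
    apply: (continuous_cvg _ (@continuous_norm_powR _ p p0 _)).
    by rewrite -[X in _ --> X]addr0; apply: cvgD; [exact: cvg_cst|exact: gcvg].
  apply: cvgMr; rewrite -[X in _ --> X]subr0; apply: cvgB; first exact: cvg_cst.
  by rewrite -[X in _ --> X](mulr0 K); apply: cvgMr; exact: cvg_harmonic.
have Jh k : J (wk k) <= h k.
  rewrite /functional; apply: lerB.
    apply: ler_wpM2r; first by rewrite invr_ge0 ltW.
    rewrite ger0_norm; last exact: addr_ge0 (gnorm_ge0 G N s p w) (dl0 k).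
    exact: (ler_powR_base (ltW p0) (gnorm_ge0 G N s p _) (wkw k)).
  apply: (ler_wpM2l (ltW lam0)); rewrite lerBlDr -lerBlDl.
  by apply: le_trans (ler_norm _) _; rewrite distrC; exact: PsiB.
apply: (ler_cvg_to (@cvg_cst _ (J u) _ _ _) hcvg).
have e0 : 0 < rad - (gnorm u + t * gnorm phi) by rewrite subr_gt0.
have /cvgrPdist_lt/(_ _ e0) := gcvg; apply: filterS => k.
rewrite sub0r normrN ger0_norm; last exact: dl0.
move=> dk; apply: le_trans (u_min (twk k) _) (Jh k).
apply: le_trans (wkw k) _; rewrite -lerBrDl.
apply: le_trans (ltW dk) _; exact: lerB (lexx _) uu.
Qed.

Let increment_le (a1 a2 c1 c2 l : R) : a1 / p - l * c1 <= a2 / p - l * c2 ->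
  l * (c2 - c1) <= (a2 - a1) / p.
Proof.
move=> H; rewrite -subr_ge0; move: H; rewrite -subr_ge0.
by rewrite (_ : (a2 - a1) / p - _ = a2 / p - l * c2 - (a1 / p - l * c1))//; ring.
Qed.

(** By [pairing_tangent] at w = u + t phi, the energy grows by at most t p times the pairing of w
    and phi. Minimality divided by t = 1 / (k + 1) then passes to the limit. *)
Let variation_le phi : test phi ->
  lam * \int[mu]_x (b x * g (u x) * phi x) <= pairing nu p (gdiff u) (gdiff phi).
Proof.
move=> tphi; have Gphi := test_gag tphi.
have [Cp Cp0 HCp] := test_bounded tphi.
have uC x : `|u x| <= tau + Cp by apply: le_trans (un x) _; rewrite lerDl.
have pC x : `|phi x| <= tau + Cp by apply: le_trans (HCp x) _; rewrite lerDr.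
have H1 := potential_derivative mOmega Omega_lty mb b_ge0 bB b_out cg g_ge0 mu_ Gphi.1 uC pC.
have H2 := pairing_cvg p1 Gu.2 Gphi.2.
have H3 : lam * (k.+1%:R * (Psi (fun x => u x + k.+1%:R^-1 * phi x) - Psi u)) @[k --> \oo] -->
    lam * \int[mu]_x (b x * g (u x) * phi x) by apply: cvgMr.
apply: (ler_cvg_to H3 H2).
have e0 : 0 < (rad - gnorm u) / (gnorm phi + 1).
  by rewrite divr_gt0 ?subr_gt0// ltr_wpDl// gnorm_ge0.
have := @near_infty_natSinv_lt R (PosNum e0); apply: filterS => k /= ke.
set t : R := k.+1%:R^-1; have t0 : 0 < t by rewrite invr_gt0.
have small : gnorm u + t * gnorm phi < rad.
  have g1 : 0 < gnorm phi + 1 by rewrite ltr_wpDl// gnorm_ge0.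
  rewrite -ltrBrDl; apply: le_lt_trans (_ : t * (gnorm phi + 1) < _).
    by apply: (ler_wpM2l (ltW t0)); rewrite lerDl.
  by rewrite -ltr_pdivlMr.
have Jt := min_line tphi (ltW t0) small.
set w := fun x => u x + t * phi x in Jt *.
have gw : gdiff w = (fun z : T * T => gdiff u z + t * gdiff phi z).
  by rewrite /w gdiffD gdiffZ.
have LZ : inLp nu p (fun z : T * T => t * gdiff phi z) := inLpZ t Gphi.2.
have Lw : inLp nu p (fun z : T * T => gdiff u z + t * gdiff phi z) := inLpD p1 Gu.2 LZ.
have := pairing_tangent p1 Lw Gu.2.
rewrite (_ : (fun z : T * T => gdiff u z + t * gdiff phi z - gdiff u z) =
    (fun z : T * T => t * gdiff phi z)); last first.
  by apply/funext => z; rewrite addrAC subrr add0r.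
rewrite (pairingZ p1 t Lw Gphi.2) -gw => tang.
have Ew : lam * (Psi w - Psi u) <= t * pairing nu p (gdiff w) (gdiff phi).
  have : lam * (Psi w - Psi u) <= (energy nu p (gdiff w) - energy nu p (gdiff u)) / p.
    rewrite -2!(gnorm_powR G N s p1); exact: increment_le Jt.
  move/le_trans; apply; rewrite ler_pdivrMr// mulrC; exact: tang.
rewrite mulrCA -ler_pdivlMl ?ltr0Sn//; exact: Ew.
Qed.

(* The right-hand side is written as a pairing in order to apply [pairing_young] to it. *)
Let h x : R := (b x * g (u x)) `^ (p - 1)^-1.

Let pdual_h x : pdual p (h x) = b x * g (u x).
Proof.
have bg0 : 0 <= b x * g (u x) by exact: mulr_ge0.
rewrite /pdual ger0_norm ?powR_ge0//; have [E|E] := eqVneq (b x * g (u x)) 0.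
  by rewrite /h E powR0 ?mulr0// invr_eq0 subr_eq0 gt_eqF.
have h0 : 0 < h x by rewrite powR_gt0// lt0r E.
rewrite -[X in _ * X]powRr1 ?(ltW h0)// -powRD; last by rewrite (gt_eqF h0) implybT.
rewrite (_ : p - 2 + 1 = p - 1); last by ring.
by rewrite -powRrM mulVf ?powRr1// subr_eq0 gt_eqF.
Qed.

Let inLp_bounded v (C : R) : measurable_fun setT v -> (forall x, `|v x| <= C) ->
  (forall x, ~ Omega x -> v x = 0) -> inLp mu p v.
Proof.
move=> mv vC vO; split=> //.
apply: (@bounded_support_integrable _ _ _ mu Omega mOmega Omega_lty _ (C `^ p)).
- exact: measurable_norm_powR.
- move=> x; rewrite ger0_norm ?powR_ge0//.
  exact: (ler_powR_base (ltW p0) (normr_ge0 _) (vC x)).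
- by move=> x /vO ->; rewrite normr0 powR0// gt_eqF.
Qed.

Lemma inLp_gagliardo w : gagliardo w -> (forall x, ~ Omega x -> w x = 0) -> inLp mu p w.
Proof.
move=> Gw w0; have [C _ HC] := poincare hN s0 p1 bOmega.
by apply: (inLp_lty Gw.1); apply: le_lt_trans (HC w Gw w0) (ltry _).
Qed.

Let h_Lp : inLp mu p h.
Proof.
have [L L0 HL] := bounded_on_segment cg g_ge0 tau.
apply: (inLp_bounded (C := (`|B| * L) `^ (p - 1)^-1)).
- apply: (@measurableT_comp _ _ _ _ _ _ (fun t : R => t `^ (p - 1)^-1)).
    exact: measurable_powR.
  apply: measurable_funM => //; apply: (@measurableT_comp _ _ _ _ _ _ g) => //.
  exact: continuous_measurable_fun.
- move=> x; rewrite ger0_norm ?powR_ge0//; apply: ler_powR_base.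
  + by rewrite invr_ge0 subr_ge0 ltW.
  + exact: mulr_ge0.
  + by apply: ler_pM => //; [exact: le_trans (ler_norm _)|exact: HL].
- by move=> x /b_out E; rewrite /h E mul0r powR0// invr_eq0 subr_eq0 gt_eqF.
Qed.

Let pairing_h v : pairing mu p h v = \int[mu]_x (b x * g (u x) * v x).
Proof. by apply: eq_Rintegral => x _; rewrite pdual_h. Qed.

Let defect v : R := pairing nu p (gdiff u) (gdiff v) - lam * pairing mu p h v.

Let defectD v w : gagliardo v -> gagliardo w -> inLp mu p v -> inLp mu p w ->
  defect (fun x => v x + w x) = defect v + defect w.
Proof.
move=> Gv Gw Lv Lw; rewrite /defect gdiffD (pairingD p1 Gu.2 Gv.2 Gw.2).
by rewrite (pairingD p1 h_Lp Lv Lw); ring.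
Qed.

Let test_Lp phi : test phi -> inLp mu p phi.
Proof.
move=> tphi; have [C _ HC] := test_bounded tphi.
apply: (inLp_bounded (test_meas tphi) HC) => x; exact: test_notin.
Qed.

(** Test functions form a vector space, so the inequality of [variation_le] holds for phi and for -
    phi. *)
Let defect_test phi : test phi -> defect phi = 0.
Proof.
move=> tphi; have H phi' : test phi' -> 0 <= defect phi'.
  by move=> t'; rewrite subr_ge0 pairing_h; exact: variation_le.
apply/le_anti/andP; split; last exact: H.
have := H _ (testZ (-1) tphi); rewrite /defect gdiffZ (pairingZ p1 (-1) Gu.2 (test_gag tphi).2).
rewrite (pairingZ p1 (-1) h_Lp (test_Lp tphi)) !mulN1r mulrN -opprD.
by rewrite oppr_ge0.
Qed.

Let young_sum (c a1 l a2 c' a3 K : R) : c * a1 + l * (c * a2) + (c' * a3 + l * (c' * (K * a3))) =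
  c * (a1 + l * a2) + c' * (1 + l * K) * a3.
Proof. ring. Qed.

Lemma X0_space_approx phi : X0_space G N Omega s p phi -> gagliardo phi /\
  exists2 f : nat -> T -> R, (forall k, test (f k)) &
    gnorm (fun x => phi x - f k x) @[k --> \oo] --> (0 : R).
Proof.
move=> [Lphi phi0 [f tf fphi]].
have mphi : measurable_fun setT phi by move: Lphi => /andP[]/set_mem.
have mf k : measurable_fun setT (f k \- phi) by apply: measurable_funB => //; exact: test_meas.
have [fin _] := (fine_cvgP _ _).1 fphi.
have Gf : \forall k \near \oo, gagliardo (f k \- phi).
  apply: filterS fin => k fk; apply: (X0_norm_lty hN p1 (mf k)).
  by move: fk; rewrite fin_numElt => /andP[].
have [k0 _ Hk0] := Gf.
have Gphi : gagliardo phi.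
  have := gagliardoB p1 (test_gag (tf k0)) (Hk0 k0 (leqnn _)).
  by rewrite (_ : (fun x => _) = phi)//; apply/funext => x /=; rewrite opprB addrCA subrr addr0.
split=> //; exists f => //.
have fE k : X0_norm G N s p (f k \- phi) = (gnorm (fun x => phi x - f k x))%:E.
  rewrite gnormB_sym; apply: (X0_norm_gagliardo hN p1).
  exact: (gagliardoB p1 (test_gag (tf k)) Gphi).
move: fphi; under eq_fun do rewrite fE.
by move=> /fine_cvgP[].
Qed.

(** The defect is additive and vanishes on test functions, so it equals the defect of w = phi - f k.
    Young's inequality with parameter eta and [poincare] bound it by eta A + D ||w||^p, which is
    made small by choosing eta first and k next. *)
Lemma euler_lagrange phi : X0_space G N Omega s p phi ->
  pairing nu p (gdiff u) (gdiff phi) = lam * \int[mu]_x (b x * g (u x) * phi x).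
Proof.
move=> Xphi; have [Gphi [f tf fcvg]] := X0_space_approx Xphi.
have [_ phi0 _] := Xphi.
rewrite -pairing_h; apply/eqP; rewrite -subr_eq0 -/(defect phi) -normr_le0.
apply/ler_addgt0Pr => e e0; rewrite add0r.
have [C C0 HC] := poincare hN s0 p1 bOmega.
set A := energy nu p (gdiff u) + lam * energy mu p h.
have A0 : 0 <= A.
  exact: addr_ge0 (energy_ge0 _ _ _) (mulr_ge0 (ltW lam0) (energy_ge0 _ _ _)).
have A1 : 0 < A + 1 by rewrite ltr_wpDl.
pose eta := e / 2 / (A + 1).
have eta0 : 0 < eta by rewrite !divr_gt0.
pose D := eta `^ (1 - p) * (1 + lam * C).
have D0 : 0 < D.
  by apply: mulr_gt0; [exact: powR_gt0|rewrite ltr_wpDr// mulr_ge0 ?(ltW lam0) ?(ltW C0)].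
have e1 : 0 < (e / 2 / D) `^ p^-1 by rewrite powR_gt0// !divr_gt0.
have /cvgrPdist_lt/(_ _ e1)[k _ /(_ k (leqnn _))] := fcvg.
set w := fun x => phi x - f k x.
rewrite /= sub0r normrN ger0_norm; last exact: gnorm_ge0.
move=> wk; have Gw : gagliardo w := gagliardoB p1 Gphi (test_gag (tf k)).
have w0 x : ~ Omega x -> w x = 0.
  by move=> Ox; rewrite /w (phi0 x Ox) (test_notin (tf k) Ox) subr0.
have Lw := inLp_gagliardo Gw w0.
have wp : gnorm w `^ p <= e / 2 / D.
  have := ler_powR_base (ltW p0) (gnorm_ge0 G N s p w) (ltW wk).
  by rewrite -powRrM mulVf ?gt_eqF// powRr1// !divr_ge0// ltW.
have Ew : energy mu p w <= C * gnorm w `^ p.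
  by rewrite -lee_fin -energyE//; exact: HC.
have -> : defect phi = defect w.
  have := defectD (test_gag (tf k)) Gw (test_Lp (tf k)) Lw.
  rewrite (_ : (fun x => f k x + w x) = phi); last first.
    by apply/funext => x; rewrite /w addrC subrK.
  by move=> ->; rewrite (defect_test (tf k)) add0r.
rewrite /defect; apply: le_trans (ler_normB _ _) _.
rewrite normrM (gtr0_norm lam0).
have Y1 := pairing_young p1 eta0 Gu.2 Gw.2; have Y2 := pairing_young p1 eta0 h_Lp Lw.
rewrite -!gnorm_powR// in Y1.
apply: le_trans (lerD Y1 (ler_wpM2l (ltW lam0) Y2)) _.
have Y3 := ler_wpM2l (ltW lam0) (ler_wpM2l (powR_ge0 eta (1 - p)) Ew).
have eA : eta * A <= e / 2.
  rewrite /eta -mulrA ler_piMr ?divr_ge0 ?(ltW e0)// mulrC ler_pdivrMr// mul1r.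
  by rewrite lerDl.
have wD : D * gnorm w `^ p <= e / 2 by rewrite -ler_pdivlMl// mulrC.
rewrite [leRHS]splitr; apply: le_trans (lerD eA wD).
rewrite mulrDr addrACA; apply: le_trans (lerD (lexx _) (lerD (lexx _) Y3)) _.
rewrite /A /D -gnorm_powR// le_eqVlt; apply/orP; left; apply/eqP.
exact: young_sum.
Qed.

Lemma source_integrable v : inLp mu p v ->
  mu.-integrable setT (EFin \o (fun x => b x * g (u x) * v x)).
Proof.
move=> Lv; have := pairing_integrable p1 h_Lp Lv.
by rewrite (_ : (fun x => pdual p (h x) * v x) = (fun x => b x * g (u x) * v x))//;
  apply/funext => x; rewrite pdual_h.
Qed.

End euler_lagrange.

(** * From minimizers to weak solutions *)

Section weak_solutions.
Local Notation kern := (frac_kernel G N s p).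

Lemma pdual_gdiff u phi (z : T * T) : pdual p (gdiff u z) * gdiff phi z =
  `|u z.2 - u z.1| `^ (p - 2) * (u z.2 - u z.1) * (phi z.2 - phi z.1) * kern z.2 z.1.
Proof.
rewrite /pdual /gdiff; set k := kern z.2 z.1.
have k0 : 0 <= k := kern_ge0 _ _ _ _ _ _.
(* The exponents (p - 2) / p and 2 / p add up to 1. The case k = 0 is apart, since the addition rule
   for exponents requires a nonzero base here. *)
have kk : k `^ p^-1 `^ (p - 2) * (k `^ p^-1 * k `^ p^-1) = k.
  have [->|kN0] := eqVneq k 0.
    by rewrite [X in _ * (X * _)]powR0 ?mul0r ?mulr0// invr_eq0 gt_eqF.
  have kp : 0 < k by rewrite lt0r kN0.
  rewrite -powRrM -!powRD ?kN0 ?implybT//.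
  rewrite (_ : p^-1 * (p - 2) + (p^-1 + p^-1) = 1) ?powRr1//.
  by field; rewrite gt_eqF.
rewrite normrM powRM// (ger0_norm (powR_ge0 k _)) -[in RHS]kk; ring.
Qed.

Lemma frac_plap_formE u phi : gagliardo u -> gagliardo phi ->
  frac_plap_form G N s p u phi = (pairing nu p (gdiff u) (gdiff phi))%:E.
Proof.
move=> [_ Lu] [_ Lphi]; have iuphi := pairing_integrable p1 Lu Lphi.
rewrite /pairing /Rintegral fineK; last exact: integrable_fin_num.
rewrite -(integral12_prod_meas1 iuphi).
by apply: eq_integral => y _; apply: eq_integral => x _; rewrite /= pdual_gdiff.
Qed.

Variable beta : T -> R.
Hypothesis mbeta : measurable_fun Omega beta.
Hypothesis beta_b : \forall x \ae mu, Omega x -> beta x = b x.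

Lemma source_integral u phi (tau : R) : gagliardo u ->
  (forall x, 0 <= u x <= tau) -> inLp mu p phi ->
  (\int[mu]_(x in Omega) (beta x * g (u x) * phi x)%:E =
   (\int[mu]_x (b x * g (u x) * phi x))%:E)%E.
Proof.
move=> Gu utau Lphi; have [mu_ _] := Gu.
have ibg := source_integrable Gu utau Lphi.
rewrite /Rintegral fineK; last exact: integrable_fin_num.
have mgu : measurable_fun setT (g \o u).
  apply: (@measurableT_comp _ _ _ _ _ _ g) => //; exact: continuous_measurable_fun.
rewrite [RHS](_ : _ = (\int[mu]_(x in Omega) (b x * g (u x) * phi x)%:E)%E); last first.
  rewrite [RHS]integral_mkcond; apply: eq_integral => x _ /=.
  by rewrite patchE; case: ifPn => // /negP xO; rewrite b_out ?mul0r// => /mem_set.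
apply: ae_eq_integral => //.
- apply/measurable_EFinP; apply: measurable_funM; last exact: measurable_funTS Lphi.1.
  by apply: measurable_funM => //; exact: measurable_funTS mgu.
- apply/measurable_EFinP; apply: measurable_funTS; apply: measurable_funM; last exact: Lphi.1.
  exact: measurable_funM.
- by apply: filterS beta_b => x bx Ox; rewrite bx.
Qed.

Section minimizers.
Variables (u : T -> R) (psi : nat -> T -> R) (tau rad : R).
Hypotheses (Gu : gagliardo u) (u_bnd : forall x, 0 <= u x <= tau).
Hypotheses (u_out : forall x, ~ Omega x -> u x = 0) (u_rad : gnorm u < rad).
Hypothesis u_lim : test_limit u psi.
Hypothesis u_min : forall phi, test phi -> gnorm phi <= rad -> J u <= J phi.

Lemma minimizer_X0_space : X0_space G N Omega s p u.
Proof.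
have Lu := inLp_gagliardo Gu u_out.
split=> //.
  apply/andP; split; apply: mem_set => /=; first exact: Gu.1.
  by rewrite /finite_norm (pnormE Lu) ltry.
have [tpsi _ gcvg] := u_lim.
exists psi => //; under eq_fun => k.
  rewrite (X0_norm_gagliardo hN p1); last first.
    exact: (gagliardoB p1 (test_gag (tpsi k)) Gu).
  over.
by apply: cvg_EFin; [exact: nearW|exact: gcvg].
Qed.

(** A function that is zero almost everywhere has Psi = 0, hence J >= 0; so a negative value of J
    makes u a nontrivial solution. *)
Lemma minimizer_weak_solution : J u < 0 -> weak_solution G N Omega s p beta g lam u.
Proof.
move=> Ju; split; first exact: minimizer_X0_space.
- move=> u0; have : Psi u = 0.
    rewrite /potential /Rintegral (ae_eq_integral (cst 0%E))//.
    + by rewrite integral_cst// mul0e.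
    + by apply/measurable_EFinP; apply: measurable_potential => //; exact: Gu.1.
    + by apply: filterS u0 => x /= -> _; rewrite primitive00 mulr0.
  move=> Psi0; move: Ju; rewrite /functional Psi0 mulr0 subr0 ltNge => /negP; apply.
  by rewrite divr_ge0 ?powR_ge0// ltW.
move=> phi Xphi; have [Gphi _] := X0_space_approx Xphi.
have [_ phi0 _] := Xphi.
have Lphi := inLp_gagliardo Gphi phi0.
rewrite frac_plap_formE// (source_integral Gu u_bnd Lphi) -EFinM; congr (_%:E).
exact: (euler_lagrange Gu u_bnd u_rad u_lim u_min Xphi).
Qed.

End minimizers.

Hypotheses (oOmega : open Omega) (Omega_neq0 : Omega !=set0).
Variable b0 : R.
Hypotheses (b0_gt0 : 0 < b0) (b0_le : forall x, Omega x -> b0 <= b x).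

(** The constants do not depend on t and tau, so the lemma can be applied at every pair of scales.
    The last two conclusions are what makes the norms blow up when t does. *)
Lemma solution_between : exists (C0 c e H : R), [/\ 0 < C0, 0 < c, 0 < e &
  forall t tau, 0 < t -> 0 < tau -> t * c <= tau -> P tau < e * tau `^ p -> H * t `^ p < P t ->
  exists u, [/\ weak_solution G N Omega s p beta g lam u, gagliardo u,
    forall x, 0 <= u x <= tau, gnorm u <= tau / C0 &
    (forall x, u x <= C0 * gnorm u) /\ t `^ p <= lam * Psi u]].
Proof.
have [C0 C0_gt0 HC0] := test_sup hN s0 s1 p1 sp bOmega.
have [phi [A [tphi phi_ge0 phi1 AO [mA /andP[A0 Aoo]]]]] := bump_test oOmega Omega_neq0.
have Gphi := test_gag tphi.
set m := fine (mu Omega); set a := fine (mu A).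
have a0 : 0 < a by rewrite /a fine_gt0// A0.
have m0 : 0 <= m by exact: fine_ge0.
have B0 : 0 <= B by exact: le_trans (bB 0).
pose K := lam * B * m * p * C0 `^ p.
have K0 : 0 <= K by rewrite !mulr_ge0 ?powR_ge0// ltW.
have K1 : 0 < K + 1 by rewrite ltr_wpDl.
pose k := gnorm phi.
have k_ge0 : 0 <= k by exact: gnorm_ge0.
(* With k the seminorm of the bump: t c <= tau puts t phi in the ball of radius tau / C0; the choice
   of e yields the subcritical inequality; the choice of H makes lam b0 G(t) a exceed t^p (k^p / p +
   1), so that J (t phi) <= - t^p. *)
exists C0, (C0 * (k + 1)), (K + 1)^-1, ((k `^ p / p + 1) / (lam * b0 * a)); split => //.
- by rewrite mulr_gt0// ltr_wpDl.
- by rewrite invr_gt0.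
move=> t tau t0 tau0 t_tau Ptau Pt.
have sub : lam * (B * P tau * m) * p < (tau / C0) `^ p.
  rewrite powRM ?invr_ge0 ?(ltW tau0) ?(ltW C0_gt0)// powRV ?(ltW C0_gt0)//.
  rewrite ltr_pdivlMr ?powR_gt0// (_ : _ * C0 `^ p = K * P tau); last by rewrite /K; ring.
  rewrite ltr_pdivlMl// in Ptau; apply: le_lt_trans Ptau.
  by apply: ler_wpM2r; [exact: (primitive0_ge0 cg g_ge0 (ltW tau0))|rewrite lerDl].
have [u [psi [[Gu u_bnd u_out u_rad] [u_lim u_min]]]] := minimizer C0_gt0 tau0 HC0 sub.
have tt := testZ t tphi.
have t_rad : gnorm (fun x => t * phi x) <= tau / C0.
  rewrite (gnormZ p1 t Gphi) gtr0_norm// ler_pdivlMr//; apply: le_trans t_tau.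
  by rewrite -/k -mulrA ler_pM2l// mulrC ler_pM2l// lerDl.
have Jt : J (fun x => t * phi x) <= - t `^ p.
  rewrite /functional (gnormZ p1 t Gphi) gtr0_norm// -/k powRM ?(ltW t0)//.
  have mt : measurable_fun setT (fun x => t * phi x) by have [] := gagliardoZ t Gphi.
  have := potential_ge mOmega Omega_lty mb b_ge0 bB b_out cg g_ge0 mA Aoo
    (fun x Ax => b0_le (AO x Ax)) mt (HC0 _ tt) (fun x => mulr_ge0 (ltW t0) (phi_ge0 x)) (ltW t0).
  move=> /(_ _)/wrap[].
    by move=> x Ax; rewrite -[leLHS]mulr1 ler_pM2l// phi1.
  rewrite -/a => Psi_t.
  have l1 : t `^ p * (k `^ p / p + 1) <= lam * (b0 * P t * a).
    have lba : 0 < lam * b0 * a by rewrite !mulr_gt0.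
    move: Pt; rewrite mulrAC ltr_pdivrMr// => /ltW; rewrite mulrC.
    move/le_trans; apply; rewrite le_eqVlt; apply/orP; left; apply/eqP; ring.
  have l2 := le_trans l1 (ler_wpM2l (ltW lam0) Psi_t).
  rewrite lerBlDr addrC -lerBlDr opprK; apply: le_trans l2.
  by rewrite mulrDr mulr1 mulrA.
have Ju : J u <= - t `^ p := le_trans (u_min _ tt t_rad) Jt.
have Ju0 : J u < 0 by apply: le_lt_trans Ju _; rewrite oppr_lt0 powR_gt0.
exists u; split; [|exact: Gu|exact: u_bnd|exact: (ltW u_rad)|split].
- exact: (minimizer_weak_solution Gu u_bnd u_out u_rad u_lim u_min Ju0).
- have [tpsi psiu gcvg] := u_lim.
  (* The sup bound holds for test functions and passes to u along psi, which converges both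
     uniformly and in seminorm. *)
  move=> x; apply/ler_addgt0Pr => e e0.
  have e1 : 0 < e / (1 + C0) by rewrite divr_gt0// addr_gt0.
  have H1 := @near_infty_natSinv_lt R (PosNum e1).
  have /cvgrPdist_lt/(_ _ e1) H2 := gcvg.
  have [j _ /(_ j (leqnn _))[/= h1 h2]] := filterI H1 H2.
  have {h2} : gnorm (fun x => psi j x - u x) < e / (1 + C0).
    by apply: le_lt_trans h2; rewrite sub0r normrN ler_norm.
  have Gj := test_gag (tpsi j).
  move=> /ltW h2; have h3 := le_trans (gnormB_le p1 Gj Gu) (lerD (lexx _) h2).
  have h4 := le_trans (HC0 _ (tpsi j) x) (ler_wpM2l (ltW C0_gt0) h3).
  have h5 := le_trans (psiu j x) (ltW h1).
  rewrite (_ : u x = psi j x - (psi j x - u x)); last by rewrite opprB addrCA subrr addr0.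
  apply: le_trans (ler_norm _) (le_trans (ler_normB _ _) (le_trans (lerD h4 h5) _)).
  rewrite le_eqVlt; apply/orP; left; apply/eqP.
  by move: (gnorm u) => k'; field; rewrite gt_eqF// addr_gt0.
- move: Ju; rewrite /functional lerBlDr addrC -lerBlDr opprK => /(le_trans _); apply.
  by rewrite lerDr divr_ge0 ?powR_ge0// ltW.
Qed.

End weak_solutions.

End variational_problem.

(** * Choice of the scales at either endpoint *)

Theorem theorem1p5 (R : realType) (r : nat) (d : 'I_r.+1 -> nat)
  (G : stratified_group R d) (N : stratified_space R d -> R)
  (hN : homogeneous_norm G N)
  (Omega : set (stratified_space R d))
  (hOmega_open : open Omega) (hOmega_bounded : bounded_set Omega)
  (hOmega_nonempty : Omega !=set0)
  (s p : R) (hs0 : 0 < s) (hs1 : s < 1) (hp : 1 < p)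
  (hsp : (homogeneous_dim d)%:R < s * p)
  (beta : stratified_space R d -> R)
  (hbeta_meas : measurable_fun Omega beta)
  (hbeta_Linfty : (Linfty_norm Omega beta < +oo)%E)
  (hbeta_inf : (0 < ess_inf_on Omega beta)%E)
  (g : R -> R) (hg_continuous : continuous g)
  (M : endpoint)
  (hg_ge0 : forall tau, 0 <= g tau) (hg0 : g 0 = 0)
  (hg_liminf : limf_einf (fun tau => (primitive0 g tau / tau `^ p)%:E)
                 (endpoint_filter R M) = 0%E)
  (hg_limsup : limf_esup (fun tau => (primitive0 g tau / tau `^ p)%:E)
                 (endpoint_filter R M) = +oo%E)
  (lam : R) (hlam : 0 < lam) :
  exists u : nat -> stratified_space R d -> R,
    [/\ forall n, weak_solution G N Omega s p beta g lam (u n) /\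
          \forall x \ae lebesgue_rV R (\sum_i d i), 0 <= u n x,
        M = plus_infty ->
          X0_norm G N s p (u n) @[n --> \oo] --> +oo%E &
        M = zero_plus ->
          X0_norm G N s p (u n) @[n --> \oo] --> 0%E /\
          Linfty_norm Omega (u n) @[n --> \oo] --> 0%E].

Proof.
have [b [b0 [B [mb b_bnd b_out [b0_gt0 b0_le] beta_b]]]] :=
  truncated_weight hOmega_open hOmega_nonempty hbeta_meas hbeta_Linfty hbeta_inf.
have b_ge0 x : 0 <= b x by have /andP[] := b_bnd x.
have bB x : b x <= B by have /andP[] := b_bnd x.
have mOmega := open_measurable_rV hOmega_open.
have [C0 [c [e [H [C0_gt0 c0 e0 sol]]]]] := solution_between hN hs0 hs1 hp hsp mOmega
  hOmega_bounded mb b_ge0 bB b_out hg_continuous hg_ge0 hlam hbeta_meas beta_b hOmega_open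
  hOmega_nonempty b0_gt0 b0_le.
have often_small V : endpoint_filter R M V -> exists2 tau, V tau &
    primitive0 g tau / tau `^ p < e.
  move=> FV; have lt_e : (limf_einf (fun tau => (primitive0 g tau / tau `^ p)%:E)
      (endpoint_filter R M) < e%:E)%E by rewrite hg_liminf lte_fin.
  by have [tau Vtau] := limf_einf_lt lt_e FV; rewrite lte_fin => ?; exists tau.
have often_large V : endpoint_filter R M V -> exists2 t, V t & H < primitive0 g t / t `^ p.
  move=> FV; have gt_H : (H%:E < limf_esup (fun tau => (primitive0 g tau / tau `^ p)%:E)
      (endpoint_filter R M))%E by rewrite hg_limsup ltry.
  by have [t Vt] := limf_esup_gt gt_H FV; rewrite lte_fin => ?; exists t.
pose m := fine (lebesgue_rV R (\sum_i d i) Omega).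
have Psi_le (u : stratified_space R d -> R) (A : R) : 0 <= A -> measurable_fun setT u -> (forall x, 0 <= u x <= A) ->
    potential (lebesgue_rV R (\sum_i d i)) b g u <= B * primitive0 g A * m.
  move=> A0 mu_ uA; have [rho _ Hr] := domain_radius hOmega_bounded.
  apply: (potential_le mOmega (bounded_lebesgue_lty mOmega Hr) mb b_ge0 bB b_out hg_continuous
    hg_ge0 mu_ (C := A) _ A0).
  - by move=> x; have /andP[h1 h2] := uA x; rewrite ger0_norm.
  - by move=> x; have /andP[] := uA x.
pose good k u := [/\ weak_solution G N Omega s p beta g lam u, gagliardo G N s p u,
  forall x, 0 <= u x, M = plus_infty -> gagliardo_norm G N s p u >= k%:R &
  M = zero_plus -> gagliardo_norm G N s p u <= k.+1%:R^-1 / C0 /\ forall x, u x <= k.+1%:R^-1].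
have /choice[u Hu] : forall k : nat, exists u, good k u.
  move=> k; rewrite /good => {good}; move: often_small often_large.
  case: M {hg_liminf hg_limsup} => small large.
  (* At 0+, tau is chosen first, below 1 / (k + 1), and then t < tau / c. *)
  - have [|tau [tau0 tauk]] := small [set t | 0 < t /\ t < k.+1%:R^-1].
      by apply: filterI; [exact: nbhs_right_gt|apply: nbhs_right_lt].
    rewrite ltr_pdivrMr ?powR_gt0// => Ptau.
    have [|t [t0 tc]] := large [set t | 0 < t /\ t < tau / c].
      by apply: filterI; [exact: nbhs_right_gt|apply: nbhs_right_lt; exact: divr_gt0].
    rewrite ltr_pdivlMr ?powR_gt0// => Pt; rewrite ltr_pdivlMr// in tc.
    have [u [wu Gu u_bnd nu [_ _]]] := sol t tau t0 tau0 (ltW tc) Ptau Pt.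
    exists u; split => //.
    + by move=> x; have /andP[] := u_bnd x.
    + move=> _; split.
        by apply: le_trans nu _; rewrite ler_pM2r ?invr_gt0// ltW.
      by move=> x; have /andP[_ /le_trans] := u_bnd x; apply; exact: ltW.
  (* At +oo, t is chosen first and tau > t c afterwards. [A] bounds lam * Psi(u) for nonnegative u
     <= C0 k, in particular if the seminorm of the solution were below k; then t <= t^p <= lam *
     Psi(u) <= A would contradict A < t. The bound t > 1 gives t <= t^p. *)
  - pose A := lam * (B * primitive0 g (C0 * k%:R) * m).
    have [|t [t1 At]] := large [set t | 1 < t /\ A < t].
      by apply: filterI; apply: nbhs_pinfty_gt; exact: num_real.
    have t0 : 0 < t by exact: lt_trans t1.
    rewrite ltr_pdivlMr ?powR_gt0// => Pt.
    have [|tau [tau0 tc]] := small [set tau | 0 < tau /\ t * c < tau].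
      by apply: filterI; apply: nbhs_pinfty_gt; exact: num_real.
    rewrite ltr_pdivrMr ?powR_gt0// => Ptau.
    have [u [wu Gu u_bnd nu [uC tPsi]]] := sol t tau t0 tau0 (ltW tc) Ptau Pt.
    have u0 x : 0 <= u x by have /andP[] := u_bnd x.
    exists u; split => // _; rewrite leNgt; apply/negP => nk.
    have uk x : 0 <= u x <= C0 * k%:R.
      by rewrite u0/= (le_trans (uC x))// ler_pM2l// ltW.
    have PA : lam * potential (lebesgue_rV R (\sum_i d i)) b g u <= A.
      by apply: (ler_wpM2l (ltW hlam)); apply: Psi_le Gu.1 uk; rewrite mulr_ge0// ltW.
    have tt : t <= t `^ p by rewrite -[leLHS]powRr1 ?ler_powR ?(ltW t1) ?(ltW hp) ?(ltW t0).
    by have := le_lt_trans (le_trans tt (le_trans tPsi PA)) At; rewrite ltxx.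
exists u; split.
- by move=> k; have [wu _ u0 _ _] := Hu k; split => //; exact: aeW.
- move=> Moo; apply/cvgeyPge => A; exists (Num.bound `|A|) => // k /= Ak.
  have [_ Gu _ /(_ Moo) ku _] := Hu k.
  rewrite (X0_norm_gagliardo hN hp Gu) lee_fin; apply: le_trans ku.
  rewrite (le_trans (ler_norm A))// (le_trans (ltW (archi_boundP (normr_ge0 A))))//.
  by rewrite ler_nat.
move=> M0; split.
- rewrite (_ : (fun k => _) = (fun k => (gagliardo_norm G N s p (u k))%:E)); last first.
    by apply/funext => k; have [_ Gu _ _ _] := Hu k; exact: X0_norm_gagliardo.
  apply: cvg_EFin; first exact: nearW.
  apply: (@squeeze_cvgr _ _ _ _ (fun=> 0) (fun k => k.+1%:R^-1 / C0)).
  + apply: nearW => k; have [_ _ _ _ /(_ M0)[uk _]] := Hu k.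
    by rewrite gnorm_ge0.
  + exact: cvg_cst.
  + rewrite -[X in _ --> X](mul0r C0^-1); apply: cvgMl; exact: cvg_harmonic.
- apply: (@squeeze_cvge _ _ _ _ (fun=> 0%E) _ (fun k => (k.+1%:R^-1)%:E)).
  + apply: nearW => k; rewrite Lnorm_ge0/=; have [_ _ u0 _ /(_ M0)[_ uk]] := Hu k.
    rewrite /Linfty_norm unlock; case: ifPn => _; last by rewrite lee_fin invr_ge0.
    apply/ess_supP; apply: nearW => x /=; rewrite lee_fin patchE; case: ifPn => _.
      by rewrite ger0_norm.
    by rewrite normr0 invr_ge0.
  + exact: cvg_cst.
  + by apply: cvg_EFin; [exact: nearW|exact: cvg_harmonic].
Qed.
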